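(* Let $\beta\in B$ and let $a\in\mathbb R^d$ be such that $J_\beta(a)$ is finite. Then: (i) the $F(a)$-dual value $K_{F(a),\beta}^*(a)$ is attained and $J_\beta(a)=\omega_{F(a),\beta}+K^*_{F(a),\beta}(a)$; (ii) the primal solution $g_a$ exists if and only if $\Theta_{F(a),\beta}\neq\emptyset$ and the moment vector of the effective $F(a)$-dual solution $g^*_{F(a),a}$ exists and equals $a$, in which case $g_a=g^*_{F(a),a}$; (iii) the generalized primal solution $\hat g_a$ exists if and only if $\Theta_{F(a),\beta}\neq\emptyset$, in which case $\hat g_a=g^*_{F(a),a}$. (Equalities of functions are $\mu$-a.e.)
   Context: Setting. $(Z,\mathcal Z)$ is a measurable space with a $\sigma$-finite measure $\mu$, and $\varphi\colon Z\to\mathbb R^d$ is $\mathcal Z$-measurable (the moment mapping). $\Gamma$ is the class of functions $\gamma\colon\mathbb R\to(-\infty,+\infty]$ that are finite and strictly convex on $(0,+\infty)$, equal to $+\infty$ for $t<0$, and satisfy $\gamma(0)=\lim_{t\downarrow0}\gamma(t)$. $B$ is the class of functions $\beta\colon Z\times\mathbb R\to(-\infty,+\infty]$ such that $\beta(\cdot,t)$ is $\mathcal Z$-measurable for each $t$ and $\beta(z,\cdot)\in\Gamma$ for each $z$. Convention: an integral whose positive and negative parts are both infinite equals $+\infty$. $\mathcal G$ is the linear space of $\mathcal Z$-measurable $g\colon Z\to\mathbb R$ with $\varphi g$ $\mu$-integrable (then $\int_Z\varphi g\,d\mu$ is the moment vector of $g$; functions not in $\mathcal G$ have no moment vector); $\mathcal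 G_a=\{g\in\mathcal G\colon\int_Z\varphi g\,d\mu=a\}$; the superscript $+$ denotes the subset of nonnegative functions. $H_\beta(g)=\int_Z\beta(z,g(z))\,\mu(dz)$, $J_\beta(a)=\inf_{g\in\mathcal G_a^+}H_\beta(g)$ ($\inf\emptyset=+\infty$). $\beta^*(z,r)=\sup_t[rt-\beta(z,t)]$, and $(\beta^* )'(z,\cdot)$ is its derivative in $r$. Primal solutions. Let $J_\beta(a)$ be finite. The primal solution $g_a$ for $a$ is the ($\mu$-a.e. unique) minimizer of $H_\beta$ over $\mathcal G_a^+$, if it exists. A minimizing sequence is a sequence $g_n\in\mathcal G_a^+$ with $H_\beta(g_n)\to J_\beta(a)$. If all minimizing sequences converge locally in measure to a common measurable function, that limit is the generalized primal solution $\hat g_a$; here $g_n\to\hat g_a$ locally in measure means $\mu(Y\cap\{|g_n-\hat g_a|>\varepsilon\})\to0$ for every $Y\in\mathcal Z$ with $\mu(Y)<\infty$ and every $\varepsilon>0$. Faces. $\mathrm{cn}_\varphi(\mu)=\{\int_Z\varphi g\,d\mu\colon g\in\mathcal G^+\}$. A face of a convex set $C\subseteq\mathbb R^d$ is a nonempty convex $F\subseteq C$ such that every closed line segment in $C$ with a relative interior point in $F$ lies in $F$. For $a\in\mathrm{cn}_\varphi(\mu)$, $F(a)$ is the unique face of $\mathrm{cn}_\varphi(\mu)$ whose relative interior contains $a$ (finiteness of $J_\beta(a)$ implies $a\in\mathrm{cn}_\varphi(\mu)$). $\mathrm{cl}$ is closure. For a face $F$ of $\mathrm{cn}_\varphi(\mu)$: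 $\omega_{F,\beta}=\int_{\{\varphi\notin\mathrm{cl}(F)\}}\beta(z,0)\,\mu(dz)$. $F$-dual problem. $K_{F,\beta}(\vartheta)=\int_{\{\varphi\in\mathrm{cl}(F)\}}\beta^*(z,\langle\vartheta,\varphi(z)\rangle)\,\mu(dz)$, and $K^*_{F,\beta}(a)=\sup_{\vartheta\in\mathbb R^d}[\langle\vartheta,a\rangle-K_{F,\beta}(\vartheta)]$ is the $F$-dual value for $a$; if it is finite, its maximizers are the $F$-dual solutions for $a$. $\Theta_{F,\beta}$ is the set of $\vartheta$ with $K_{F,\beta}(\vartheta)<+\infty$ such that for $\mu$-a.a. $z$ with $\varphi(z)\in\mathrm{cl}(F)$ the function $r\mapsto\beta^*(z,r)$ is finite in a neighborhood of $\langle\vartheta,\varphi(z)\rangle$. For $\vartheta\in\Theta_{F,\beta}$, $f_{F,\vartheta}(z)=(\beta^* )'(z,\langle\vartheta,\varphi(z)\rangle)$ if $\varphi(z)\in\mathrm{cl}(F)$ and the derivative exists, and $f_{F,\vartheta}(z)=0$ otherwise. If $\Theta_{F,\beta}\ne\emptyset$ and $F$-dual solutions for $a$ exist, then each of them belongs to $\Theta_{F,\beta}$ and all of them give $\mu$-a.e. the same function $f_{F,\vartheta}$; this function is the effective $F$-dual solution $g^*_{F,a}$ for $a$. *)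

(* Defs.v *)
From HB Require Import structures.
From mathcomp Require Import all_boot all_order all_algebra.
From mathcomp Require Import all_classical all_reals all_analysis.
From mathcomp Require Import measurable_realfun.

Set Implicit Arguments.
Unset Strict Implicit.
Unset Printing Implicit Defensive.

Import Order.TTheory GRing.Theory Num.Theory.
Import numFieldNormedType.Exports.

Local Open Scope classical_set_scope.
Local Open Scope ring_scope.

Section ConvexSets.
Context {R : realType} {n : nat}.
Implicit Types (C F A : set 'rV[R]_n) (x y a : 'rV[R]_n).

Definition dotv x y : R := \sum_(i < n) x 0 i * y 0 i.

Definition segment x y : set 'rV[R]_n :=
  [set (1 - t) *: x + t *: y | t in [set t : R | 0 <= t <= 1]].

Definition open_segment x y : set 'rV[R]_n :=
  [set (1 - t) *: x + t *: y | t in [set t : R | 0 < t < 1]].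

Definition affine_set A :=
  forall x y (t : R), A x -> A y -> A ((1 - t) *: x + t *: y).

Definition affine_hull C : set 'rV[R]_n :=
  [set x | forall A, affine_set A -> C `<=` A -> A x].

Definition relint C : set 'rV[R]_n :=
  [set x | C x /\ exists2 U, nbhs x U & U `&` affine_hull C `<=` C].

(* A segment reduced to a point is its own relative interior, so
   [open_segment x y] is the relative interior of [segment x y] also when
   x = y. *)
Definition is_face C F :=
  [/\ F !=set0, F `<=` C,
      convex_set (F : set (convex_lmodType 'rV[R]_n)) &
      forall x y, segment x y `<=` C -> open_segment x y `&` F !=set0 ->
        segment x y `<=` F].

(* The unique face of the convex set C whose relative interior contains a
   (for a in C). *)
Definition face_at C a : set 'rV[R]_n :=
  get [set F | is_face C F /\ relint F a].

End ConvexSets.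

Section ConvexIntegrands.
Context {R : realType}.
Local Open Scope ereal_scope.

Definition Gamma : set (R -> \bar R) := [set gam | [/\
  forall t : R, -oo < gam t,
  forall t : R, (0 < t)%R -> gam t \is a fin_num,
  forall s t u : R, (0 < s)%R -> (0 < t)%R -> s != t -> (0 < u < 1)%R ->
    gam ((1 - u) * s + u * t)%R < (1 - u)%R%:E * gam s + u%:E * gam t,
  forall t : R, (t < 0)%R -> gam t = +oo &
  gam t @[t --> 0^'+] --> gam 0%R]].

Definition conjugate (gam : R -> \bar R) (r : R) : \bar R :=
  ereal_sup (range (fun t : R => (r * t)%R%:E - gam t)).

Definition finite_near (h : R -> \bar R) (r : R) :=
  \forall s \near r, h s \is a fin_num.

(* [fine] sends infinite values to 0, hence the finiteness condition. *)
Definition ederivable (h : R -> \bar R) (r : R) :=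
  finite_near h r /\ derivable (fine \o h : R -> R^o) r 1.

Definition ederive (h : R -> \bar R) (r : R) : R :=
  derive1 (fine \o h : R -> R^o) r.

End ConvexIntegrands.

Section Problem.
Context {d : measure_display} {Z : measurableType d} {R : realType} {n : nat}.
Variables (mu : {measure set Z -> \bar R}) (phi : Z -> 'rV[R]_n)
  (beta : Z -> R -> \bar R).
Implicit Types (g h : Z -> R) (a theta : 'rV[R]_n) (F : set 'rV[R]_n).

Local Open Scope ereal_scope.

(* The library integral of f is \int f^\+ - \int f^\-, where +oo - +oo = -oo;
   here it is +oo instead. *)
Definition pintegral (D : set Z) (f : Z -> \bar R) : \bar R :=
  if (\int[mu]_(z in D) f^\+ z == +oo) && (\int[mu]_(z in D) f^\- z == +oo)
  then +oo else \int[mu]_(z in D) f z.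

Definition classB : set (Z -> R -> \bar R) := [set b : Z -> R -> \bar R |
  (forall t, measurable_fun [set: Z] (b^~ t)) /\
  (forall z, Gamma (b z))].

Definition classG : set (Z -> R) := [set g |
  measurable_fun [set: Z] g /\
  forall i, mu.-integrable [set: Z] (fun z => (phi z 0%R i * g z)%R%:E)].

Definition moment g : 'rV[R]_n := \row_i (\int[mu]_z (phi z 0 i * g z))%R.

Definition classG_at a : set (Z -> R) := [set g | classG g /\ moment g = a].

Definition classGp : set (Z -> R) :=
  [set g | classG g /\ forall z, (0 <= g z)%R].

Definition classGp_at a : set (Z -> R) :=
  [set g | classG_at a g /\ forall z, (0 <= g z)%R].

Definition Hfun g : \bar R := pintegral [set: Z] (fun z => beta z (g z)).

Definition Jfun a : \bar R := ereal_inf [set Hfun g | g in classGp_at a].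

Definition primal_solution a g :=
  classGp_at a g /\ forall h, classGp_at a h -> Hfun g <= Hfun h.

Definition minimizing_sequence a (gs : nat -> Z -> R) :=
  (forall k, classGp_at a (gs k)) /\ Hfun (gs k) @[k --> \oo] --> Jfun a.

Definition cvg_locally_in_measure (gs : nat -> Z -> R) g :=
  forall Y, measurable Y -> mu Y < +oo -> forall eps : R, (0 < eps)%R ->
    mu (Y `&` [set z | eps < `|gs k z - g z|]%R) @[k --> \oo] --> 0.

Definition generalized_primal_solution a g :=
  measurable_fun [set: Z] g /\
  forall gs, minimizing_sequence a gs -> cvg_locally_in_measure gs g.

Definition cn : set 'rV[R]_n := [set moment g | g in classGp].

Definition omega F : \bar R :=
  pintegral [set z | ~ closure F (phi z)] (fun z => beta z 0%R).

Definition Kfun F theta : \bar R :=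
  pintegral [set z | closure F (phi z)]
    (fun z => conjugate (beta z) (dotv theta (phi z))).

Definition dual_objective F a theta : \bar R :=
  (dotv theta a)%:E - Kfun F theta.

Definition dual_value F a : \bar R := ereal_sup (range (dual_objective F a)).

Definition dual_solution F a theta :=
  dual_value F a \is a fin_num /\ dual_objective F a theta = dual_value F a.

Definition Theta F : set 'rV[R]_n := [set theta |
  Kfun F theta < +oo /\
  {ae mu, forall z, closure F (phi z) ->
     finite_near (conjugate (beta z)) (dotv theta (phi z))}].

Definition dual_fun F theta (z : Z) : R :=
  if `[< closure F (phi z) /\
         ederivable (conjugate (beta z)) (dotv theta (phi z)) >]
  then ederive (conjugate (beta z)) (dotv theta (phi z)) else 0%R.

(* g is a version of the effective F-dual solution for a: all the F-dual
   solutions lie in Theta F and give g, up to mu-a.e. equality. *)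
Definition effective_dual_solution F a g :=
  [/\ Theta F !=set0, exists theta, dual_solution F a theta,
      measurable_fun [set: Z] g &
      forall theta, dual_solution F a theta ->
        Theta F theta /\ g = dual_fun F theta %[ae mu]].

End Problem.

(* Main.v *)
(** Let D be the set where phi lies in the closure of the face F of a.  A density
with moment a vanishes a.e. off D, so H = omega + H_D and only D matters.

The Fenchel gap gap(r, t) = beta^*(r) + beta(t) - r t >= 0 controls everything
else.  Integrating it gives, for every dual solution theta,
H(g) = J(a) + \int_D gap(<theta, phi>, g) on the primal feasible set, so g is
optimal iff its gap is zero a.e. and minimizing sequences are those whose gap
tends to 0 in L^1.  For fixed z the gap has a zero iff beta^* is finite near
<theta, phi>; the zero is then the derivative of beta^* and the gap grows away
from it, which forces minimizing sequences to converge in measure.  Otherwise a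
vanishing gap forces t -> +oo, which excludes any limit, and contradicts a bound
on the gap at another point of Theta.

A dual solution is a separating functional for the convex cone generated by the
points (moment g - a, H_D(g) - J_D + s), where J_D = J(a) - omega, s >= 0 and g
ranges over the perturbations of a feasible g0 on a set where all data are
bounded.  The functional is not vertical because a is a relative interior point
of F, and integrals and suprema are interchanged by switching greedily between
rational constants. *)

Require Import Defs.
From HB Require Import structures.
From mathcomp Require Import all_boot all_order all_algebra.
From mathcomp Require Import all_classical all_reals all_analysis.
From mathcomp Require Import measurable_realfun.
From mathcomp Require Import ring lra.

Set Implicit Arguments.
Unset Strict Implicit.
Unset Printing Implicit Defensive.

Import Order.TTheory GRing.Theory Num.Theory.
Import numFieldNormedType.Exports.
Local Open Scope classical_set_scope.
Local Open Scope ring_scope.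

(** * Separation of convex cones *)

(** Finiteness of J(a) provides one density with an integrable integrand. Nothing says that
    densities near it have finite values, or that a is interior to [cn]. Two devices make up for
    this. First, D is exhausted by sets of finite measure on which phi, the base density and its
    integrand are bounded and beta z has a uniform affine minorant; bounded changes of the base
    density on such a set cost only a finite amount. Since beta z may be +oo at 0, the trial values
    are positive rationals. Second, a vertical functional eta is nonnegative on all these changes.
    Localized, this says that eta . phi >= 0 a.e. on D, with equality where the base density is
    positive. Hence eta vanishes at a and is nonnegative on F, and it vanishes on all of F because F
    contains a - e x together with x, for some e > 0. So eta . phi = 0 on D, and the functional
    would be trivial. Since [cn] is a cone, F is exactly the set of x in [cn] with a - e x in [cn]
    for some e > 0, and it is handled in this form throughout. *)

Section LinearAlgebra.
Context {R : realType}.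

Definition sublinear (V : lmodType R) (p : V -> R) :=
  (forall x y, p (x + y) <= p x + p y) /\
  (forall c x, 0 <= c -> p (c *: x) = c * p x).

Lemma sublinear0 (V : lmodType R) (p : V -> R) : sublinear p -> p 0 = 0.
Proof. by move=> [_ pZ]; rewrite -(scale0r 0) pZ// mul0r. Qed.

Lemma sublinear_ge0 (V : lmodType R) (p : V -> R) x :
  sublinear p -> 0 <= p x + p (- x).
Proof. by move=> sp; rewrite -(sublinear0 sp) -(subrr x) sp.1. Qed.

(** The infimum of [p (x + t *: w) - t * p w] over t >= 0 is finite because
    [p (x + t *: w) + p (- x) >= t * p w]. It is at most [p w] at [w] (t = 0) and at most [- p w] at
    [- w] (t = 1). *)
Lemma sublinear_linear_along (V : lmodType R) (p : V -> R) w : sublinear p ->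
  exists q : V -> R, [/\ sublinear q, forall x, q x <= p x &
    q w + q (- w) <= 0].
Proof.
move=> sp; have [pD pZ] := sp.
pose A x := [set p (x + t *: w) - t * p w | t in [set t : R | 0 <= t]].
have A0 x : A x !=set0 by exists (p (x + 0 *: w) - 0 * p w); exists 0 => /=.
have Alb x : lbound (A x) (- p (- x)).
  move=> _ [t /= t0 <-]; rewrite lerNl opprB lerBlDr -pZ//.
  by rewrite (le_trans _ (pD _ _))// addKr.
have hA x : has_inf (A x) by split; [exact: A0|exists (- p (- x)); exact: Alb].
have q_ge x r : A x r -> inf (A x) <= r.
  by move=> ?; apply: ge_inf => //; exact: (hA x).2.
have q_le x m : (forall t, 0 <= t -> m <= p (x + t *: w) - t * p w) ->
    m <= inf (A x).
  by move=> h; apply: lb_le_inf => // _ [t t0 <-]; exact: h.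
exists (fun x => inf (A x)); split.
- split.
    move=> x y.
    have h s t : 0 <= s -> 0 <= t -> inf (A (x + y)) <=
        (p (x + s *: w) - s * p w) + (p (y + t *: w) - t * p w).
      move=> s0 t0.
      have : inf (A (x + y)) <= p (x + y + (s + t) *: w) - (s + t) * p w.
        by apply: (q_ge); exists (s + t) => //=; rewrite addr_ge0.
      have := pD (x + s *: w) (y + t *: w).
      by rewrite addrACA -scalerDl; lra.
    suff : inf (A (x + y)) - inf (A y) <= inf (A x) by lra.
    apply: (q_le) => s s0.
    suff : inf (A (x + y)) - (p (x + s *: w) - s * p w) <= inf (A y) by lra.
    by apply: (q_le) => t t0; have := h s t s0 t0; lra.
  have half c x : 0 < c -> inf (A (c *: x)) <= c * inf (A x).
    move=> c0; rewrite mulrC -ler_pdivrMr//; apply: (q_le) => t t0.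
    rewrite ler_pdivrMr//; apply: (q_ge); exists (c * t) => /=.
      by rewrite mulr_ge0// ltW.
    by rewrite -scalerA -scalerDr pZ ?ltW//; ring.
  move=> c x; rewrite le_eqVlt => /predU1P[<-|c0].
    rewrite scale0r mul0r; apply/eqP; rewrite eq_le; apply/andP; split.
      by apply: (q_ge); exists 0 => //=; rewrite scale0r addr0 mul0r sublinear0// subr0.
    by apply: q_le => t t0; rewrite add0r pZ// subrr.
  apply/eqP; rewrite eq_le half//=.
  rewrite -ler_pdivlMl//; have := @half c^-1 (c *: x).
  by rewrite scalerA mulVf ?gt_eqF// scale1r invr_gt0; apply.
- move=> x; apply: (q_ge); exists 0 => //=.
  by rewrite scale0r addr0 mul0r subr0.
- have h1 : inf (A w) <= p w.
    by apply: (q_ge); exists 0 => //=; rewrite scale0r addr0 mul0r subr0.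
  have h2 : inf (A (- w)) <= - p w.
    by apply: (q_ge); exists 1 => //=; rewrite scale1r addNr mul1r sublinear0// add0r.
  lra.
Qed.

(** Each further step only lowers the function, so the bound on [q w + q (- w)] obtained for earlier
    vectors survives. *)
Lemma sublinear_linear_along_seq (V : lmodType R) (p : V -> R) (s : seq V) :
  sublinear p -> exists q : V -> R, [/\ sublinear q, forall x, q x <= p x &
    forall w, w \in s -> q w + q (- w) <= 0].
Proof.
move=> sp; elim: s => [|w s [q [sq qp qs]]]; first by exists p; split.
have [r [sr rq rw]] := sublinear_linear_along w sq.
exists r; split=> // [x|x]; first exact: le_trans (rq x) (qp x).
rewrite inE => /predU1P[->//|/qs]; apply: le_trans.
exact: lerD.
Qed.

(* A sublinear function that is linear along every vector of a basis is linear,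
   so Hahn-Banach needs only finitely many one-dimensional steps. *)
Lemma hahn_banach_vect (V : vectType R) (p : V -> R) : sublinear p ->
  exists l : {scalar V}, forall x, l x <= p x.
Proof.
move=> sp.
have [q [sq qp qb]] := sublinear_linear_along_seq (vbasis (@fullv R V)) sp.
have [qD qZ] := sq.
(* The condition [q x + q (- x) <= 0] is stable under sums and scalar multiples, so it spreads from
   the basis to every vector. *)
have qN x : q (- x) = - q x.
  suff : q x + q (- x) <= 0 by have := sublinear_ge0 x sq; lra.
  rewrite (coord_vbasis (memvf x)).
  elim/big_ind: _ => [|u v hu hv|i _].
  - by rewrite oppr0 sublinear0// addr0.
  - by rewrite opprD; have := qD u v; have := qD (- u) (- v); lra.
  - set c := coord _ _ _; set b := _`_i.
    have hb : q b + q (- b) <= 0 by apply: qb; rewrite mem_nth// size_tuple.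
    have [c0|c0] := leP 0 c.
      by rewrite -scalerN (qZ _ b)// (qZ _ (- b))// -mulrDr mulr_ge0_le0.
    have c0' : 0 <= - c by rewrite oppr_ge0 ltW.
    have -> : c *: b = (- c) *: (- b) by rewrite scalerN scaleNr opprK.
    by rewrite -scalerN opprK (qZ _ b)// (qZ _ (- b))// -mulrDr addrC mulr_ge0_le0.
have ql : scalar q.
  move=> c x y; have hD u v : q (u + v) = q u + q v.
    apply/eqP; rewrite eq_le qD/=.
    have := qD (- u) (- v); rewrite -opprD !qN; lra.
  rewrite hD; congr (_ + _).
  have [c0|c0] := leP 0 c; first exact: qZ.
  rewrite -[LHS]opprK -qN -scaleNr qZ ?oppr_ge0 ?ltW//; ring.
pose L := GRing.isLinear.Build R V R *%R q ql.
pose l : {scalar V} := HB.pack q L.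
by exists l.
Qed.

(** Among the finite families in [S], take one whose span has maximal dimension: adjoining a further
    point of [S] cannot enlarge it. *)
Lemma finite_span (V : vectType R) (S : set V) : exists2 s : seq V,
  (forall x, x \in s -> S x) & forall x, S x -> x \in << s >>%VS.
Proof.
pose P k := `[< exists2 s : seq V, (forall x, x \in s -> S x) &
  \dim << s >>%VS = k >].
have P0 : exists k, P k.
  by exists (\dim << ([::] : seq V) >>%VS); apply/asboolP; exists [::].
have Pmax k : P k -> (k <= \dim (@fullv R V))%N.
  by move=> /asboolP[s _ <-]; rewrite dimvS// subvf.
case: (ex_maxnP P0 Pmax) => k /asboolP[s sS sk] kmax.
exists s => // x Sx; apply: contrapT => /negP xs.
have : P (\dim << x :: s >>%VS).
  apply/asboolP; exists (x :: s) => // y.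
  by rewrite inE => /predU1P[->//|/sS].
move=> /kmax; rewrite -sk leqNgt => /negP; apply.
rewrite span_cons ltn_neqAle dimvS ?addvSr// andbT; apply: contra xs.
move=> /eqP h.
have : (<< s >> == <[x]> + << s >>)%VS.
  by rewrite -(geq_leqif (dimv_leqif_eq (addvSr <[x]> << s >>))) h.
by move=> /eqP ->; rewrite (subvP (addvSl _ _))// memv_line.
Qed.

Definition is_cone (V : lmodType R) (S : set V) :=
  (forall x y, S x -> S y -> S (x + y)) /\
  (forall c x, 0 <= c -> S x -> S (c *: x)).

Lemma cone_sum (V : lmodType R) (S : set V) (I : eqType) (r : seq I) (f : I -> V) :
  is_cone S -> S 0 -> (forall i, i \in r -> S (f i)) -> S (\sum_(i <- r) f i).
Proof. by move=> [SD SZ] S0 Sf; rewrite big_seq; elim/big_ind: _. Qed.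

Lemma span_coord (V : vectType R) (s : seq V) v : v \in << s >>%VS ->
  v = \sum_(i < size s) coord (in_tuple s) i v *: s`_i.
Proof. by move=> vs; rewrite {1}(coord_span (X := in_tuple s) vs). Qed.

(* The sum e of a spanning sequence of elements of S is an order unit of the span;
   Hahn-Banach is applied to the gauge v |-> inf {t | t e - v in S}. *)
Lemma cone_functional (V : vectType R) (S : set V) x :
  is_cone S -> S x -> ~ S (- x) ->
  exists l : {scalar V}, (forall u, S u -> 0 <= l u) /\
    exists2 u, S u & 0 < l u.
Proof.
move=> cS Sx SNx; have [SD SZ] := cS.
have S0 : S 0 by rewrite -(scale0r x); apply: (SZ).
have [s sS Ss] := finite_span S.
pose e := \sum_(i < size s) s`_i.
have snth i : (i < size s)%N -> S s`_i by move=> i_lt; apply/sS/mem_nth.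
have Se : S e by apply: cone_sum => // i _; exact: snth.
pose L : {vspace V} := << s >>%VS.
have absorb v : v \in L -> exists2 t, 0 <= t & S (t *: e - v).
  move=> vL; pose c i := coord (in_tuple s) i v.
  have sc0 : 0 <= \sum_i `|c i| by apply: sumr_ge0.
  exists (\sum_i `|c i|) => //.
  rewrite [X in _ - X](span_coord vL) scaler_sumr -sumrB; apply: cone_sum => // i _.
  rewrite -scalerBl; apply: (SZ); last exact: snth.
  rewrite subr_ge0 (le_trans (ler_norm _))// (bigD1 i)//= lerDl.
  exact: sumr_ge0.
(* Some [t *: e - x] lies in [S], so [- e] in [S] would put [- x] in [S]. This is what keeps the
   gauge bounded below. *)
have SNe : ~ S (- e).
  move=> SNe; have [t t0 St] := absorb _ (Ss _ Sx); apply: (SNx).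
  have -> : - x = (t *: e - x) + t *: (- e) by rewrite scalerN addrAC subrr add0r.
  by apply: (SD) => //; apply: (SZ).
have Sge0 t : S (t *: e) -> 0 <= t.
  move=> St; rewrite leNgt; apply/negP => t0; apply: (SNe).
  have -> : - e = (- t^-1) *: (t *: e).
    by rewrite scalerA mulNr mulVf ?lt_eqF// scaleN1r.
  by apply: (SZ) => //; rewrite oppr_ge0 invr_le0 ltW.
(* The projection onto the span defines the gauge on the whole space; on [S] it is the identity. *)
pose A v := [set t | S (t *: e - projv L v)].
have projL v : projv L v \in L by exact: memv_proj.
have A0 v : A v !=set0 by have [t _ ?] := absorb _ (projL v); exists t.
have hA v : has_inf (A v).
  split => //; have [t t0 St] := absorb _ (projL (- v)).
  exists (- t) => r /= Ar; rewrite lerNl -subr_ge0 opprK addrC; apply: (Sge0).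
  by have := SD _ _ Ar St; rewrite linearN/= opprK addrACA addNr addr0 -scalerDl.
pose p v := inf (A v).
have p_ge v t : A v t -> p v <= t by move=> ?; apply: ge_inf => //; exact: (hA v).2.
have p_le v m : (forall t, A v t -> m <= t) -> m <= p v.
  by move=> h; apply: lb_le_inf => // t; exact: h.
have sp : sublinear p.
  split.
    move=> u v; have h s' t : A u s' -> A v t -> p (u + v) <= s' + t.
      move=> As At; apply: (p_ge); rewrite /A/= scalerDl linearD/= opprD addrACA.
      exact: SD.
    suff : p (u + v) - p v <= p u by lra.
    apply: (p_le) => r Ar; suff : p (u + v) - r <= p v by lra.
    by apply: (p_le) => t At; have := h _ _ Ar At; lra.
  have half c v : 0 < c -> p (c *: v) <= c * p v.
    move=> c0; rewrite mulrC -ler_pdivrMr//; apply: (p_le) => t At.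
    rewrite ler_pdivrMr//; apply: (p_ge).
    rewrite /A/= mulrC linearZ/= -scalerA -scalerBr; apply: (SZ) => //.
    exact: ltW.
  move=> c v; rewrite le_eqVlt => /predU1P[<-|c0].
    rewrite scale0r mul0r; apply/eqP; rewrite eq_le; apply/andP; split.
      by apply: (p_ge); rewrite /A/= scale0r linear0 subr0.
    by apply: (p_le) => t; rewrite /A/= linear0 subr0; exact: Sge0.
  apply/eqP; rewrite eq_le half//=.
  rewrite -ler_pdivlMl//; have := @half c^-1 (c *: v).
  by rewrite scalerA mulVf ?gt_eqF// scale1r invr_gt0; apply.
have [l lp] := hahn_banach_vect sp.
have projS u : S u -> projv L u = u by move=> Su; apply: projv_id; exact: Ss.
exists l; split.
  move=> u Su; have : l (- u) <= 0.
    apply: le_trans (lp _) (p_ge _ _ _).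
    by rewrite /A/= linearN/= projS// scale0r opprK add0r.
  by rewrite linearN/= oppr_le0.
exists e => //; have : l (- e) <= -1.
  apply: le_trans (lp _) (p_ge _ _ _).
  by rewrite /A/= linearN/= projS// scaleN1r opprK addNr.
by rewrite linearN/=; lra.
Qed.

End LinearAlgebra.

(** * The face of a point of a cone *)

Section Faces.
Context {R : realType} {n : nat}.
Implicit Types (C F : set 'rV[R]_n) (a x y : 'rV[R]_n).

Lemma scalar_rV_bound (l : {scalar 'rV[R]_n}) :
  exists2 M, 0 < M & forall v, `|l v| <= M * `|v|.
Proof.
exists (1 + \sum_j `|l (delta_mx 0 j)|).
  by rewrite ltr_pwDl// sumr_ge0.
move=> v; rewrite {1}(row_sum_delta v) linear_sum/=.
rewrite (le_trans (ler_norm_sum _ _ _))// mulrDl mul1r ler_wpDl//.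
rewrite mulr_suml; apply: ler_sum => j _.
rewrite linearZ/= normrM mulrC ler_wpM2l//.
rewrite [leRHS]mx_normrE; exact: le_bigmax (0, j).
Qed.

Lemma cone_sub_shrink C a x (e f : R) : is_cone C -> C a -> 0 <= f -> f <= e ->
  C (a - e *: x) -> C (a - f *: x).
Proof.
move=> [CD CZ] Ca f0 fe Cx.
have [e0|e0] := leP e 0.
  by have -> : f = e by apply/eqP; rewrite eq_le fe (le_trans e0 f0).
have -> : a - f *: x = (1 - f / e) *: a + (f / e) *: (a - e *: x).
  rewrite scalerBr addrA -scalerDl subrK scale1r scalerA divfK// gt_eqF//.
by apply: (CD); apply: (CZ) => //; rewrite ?subr_ge0 ?ler_pdivrMr ?mul1r ?divr_ge0// ltW.
Qed.

(** In a cone, [a - e *: x] belongs to [C] for some e > 0 iff the segment from [x] to [a] can be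
    prolonged beyond [a] inside [C]; such [x] form the smallest face containing [a]. *)
Definition min_face C a := [set x | C x /\ exists2 e : R, 0 < e & C (a - e *: x)].

Lemma min_face_cone C a : is_cone C -> C a -> is_cone (min_face C a).
Proof.
move=> cC Ca; have [CD CZ] := cC; split.
  move=> x y [Cx [e e0 Cex]] [Cy [f f0 Cfy]]; split; first exact: CD.
  exists (Num.min e f / 2); first by rewrite divr_gt0// lt_min e0.
  have m0 : 0 <= Num.min e f by rewrite le_min !ltW.
  have -> : a - (Num.min e f / 2) *: (x + y) =
      2^-1 *: (a - Num.min e f *: x) + 2^-1 *: (a - Num.min e f *: y).
    rewrite !scalerBr addrACA -scalerDl -opprD scalerDr !scalerA [2^-1 * _]mulrC.
    by rewrite (_ : 2^-1 + 2^-1 = 1) ?scale1r//; field.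
  apply: (CD); apply: (CZ) => //.
    by apply: cone_sub_shrink Cex => //; rewrite ge_min lexx.
  by apply: cone_sub_shrink Cfy => //; rewrite ge_min lexx orbT.
move=> c x c0 [Cx [e e0 Cex]]; split; first exact: CZ.
exists (e / (c + 1)); first by rewrite divr_gt0// ltr_wpDl.
rewrite scalerA; apply: cone_sub_shrink Cex => //.
  by rewrite mulr_ge0// divr_ge0// ltW// ltr_wpDl.
by rewrite -mulrA ger_pMr// mulrC ler_pdivrMr ?ltr_wpDl// mul1r lerDl.
Qed.

Lemma min_face_self C a : is_cone C -> C a -> min_face C a a.
Proof.
move=> [_ CZ] Ca; split => //; exists 1 => //.
by rewrite scale1r subrr -(scale0r a); apply: (CZ).
Qed.

Lemma min_face_is_face C a : is_cone C -> C a -> is_face C (min_face C a).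
Proof.
move=> cC Ca; have [CD CZ] := cC; have [FD FZ] := min_face_cone cC Ca.
split.
- by exists a; exact: min_face_self.
- by move=> x [].
- move=> x y t; rewrite !inE => Fx Fy; apply: (FD); apply: (FZ) => //.
  by rewrite subr_ge0 le1.
- move=> x y sC [_ [[t /andP[t0 t1] <-]] [_ [e e0 Ce]]].
  have Cx : C x.
    by apply: sC; exists 0; rewrite /= ?lexx ?ler01// subr0 scale1r scale0r addr0.
  have Cy : C y.
    by apply: sC; exists 1; rewrite /= ?lexx ?ler01// subrr scale1r scale0r add0r.
  have Fx : min_face C a x.
    split => //; exists (e * (1 - t)); first by rewrite mulr_gt0 ?subr_gt0.
    have -> : a - (e * (1 - t)) *: x =
        (a - e *: ((1 - t) *: x + t *: y)) + (e * t) *: y.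
      by rewrite scalerDr !scalerA opprD addrA subrK.
    by apply: (CD) => //; apply: (CZ) => //; rewrite mulr_ge0// ltW.
  have Fy : min_face C a y.
    split => //; exists (e * t); first by rewrite mulr_gt0.
    have -> : a - (e * t) *: y =
        (a - e *: ((1 - t) *: x + t *: y)) + (e * (1 - t)) *: x.
      by rewrite scalerDr !scalerA opprD addrA addrAC subrK.
    by apply: (CD) => //; apply: (CZ) => //; rewrite mulr_ge0 ?subr_ge0// ltW.
  move=> _ [s /andP[s0 s1] <-].
  by apply: (FD); apply: (FZ) => //; rewrite subr_ge0.
Qed.

(** A small [v] in the span of the face is a combination of finitely many of its points with small
    coefficients. Cut [a] into [N] equal shares, one per point and a spare: each share absorbs its
    term, so [a + v] stays in [C]. *)
Lemma min_face_relint C a : is_cone C -> C a -> relint (min_face C a) a.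
Proof.
move=> cC Ca; have [CD CZ] := cC; have [FD FZ] := min_face_cone cC Ca.
split; first exact: min_face_self.
have [s sF Fs] := finite_span (min_face C a).
have C0 : C 0 by rewrite -(scale0r a); apply: (CZ).
pose c i : {scalar 'rV[R]_n} := coord (in_tuple s) i.
have /choice[e he] : forall i : 'I_(size s),
    exists e : R, 0 < e /\ C (a - e *: s`_i).
  by move=> i; have [_ [e e0 Ce]] := sF _ (mem_nth 0 (ltn_ord i)); exists e.
have /choice[M hM] : forall i : 'I_(size s),
    exists M : R, 0 < M /\ forall v, `|c i v| <= M * `|v|.
  by move=> i; have [M M0 hM] := scalar_rV_bound (c i); exists M.
pose N : R := (size s)%:R + 1.
have N0 : 0 < N by rewrite ltr_wpDl.
(* Chosen so that [|v| < r] forces [N * |c i v| <= e i] for every [i]. *)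
pose r := \big[Num.min/1]_i (e i / (N * M i)).
have r0 : 0 < r.
  rewrite /r; elim/big_ind: _ => // [u v u0 v0|i _]; first by rewrite lt_min u0.
  by rewrite divr_gt0 ?mulr_gt0//; [exact: (he i).1|exact: (hM i).1].
have key v : v \in << s >>%VS -> `|v| < r -> C (a + v).
  move=> vs vr; have -> : a + v = N^-1 *: a +
      \sum_(i < size s) (N^-1 *: a + c i v *: s`_i).
    rewrite big_split/= -(span_coord vs) sumr_const card_ord addrA; congr (_ + _).
    rewrite -scaler_nat scalerA -scalerDl -[X in X + _]mul1r -mulrDl addrC -/N.
    by rewrite divff ?gt_eqF// scale1r.
  apply: (CD); first by apply: (CZ) => //; rewrite invr_ge0 ltW.
  apply: cone_sum => // i _.
  have [e0 Ce] := he i; have [M0 hMi] := hM i.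
  have Fi := sF _ (mem_nth 0 (ltn_ord i)).
  have [ci|ci] := leP 0 (c i v).
    by apply: (CD); apply: (CZ) => //; [rewrite invr_ge0 ltW|exact: Fi.1].
  have -> : N^-1 *: a + c i v *: s`_i = N^-1 *: (a - (N * - c i v) *: s`_i).
    by rewrite scalerBr scalerA mulrA mulVf ?gt_eqF// mul1r scaleNr opprK.
  apply: (CZ); first by rewrite invr_ge0 ltW.
  apply: cone_sub_shrink Ce => //; first by rewrite mulr_ge0// ?oppr_ge0 ltW.
  rewrite -ltr0_norm// mulrC -ler_pdivlMr// (le_trans (hMi v))//.
  rewrite mulrC -ler_pdivlMr// -mulrA -invfM.
  by rewrite (le_trans (ltW vr))// /r; exact: bigmin_le_cond.
exists (ball a r); first exact: nbhsx_ballx.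
move=> y [ya hy].
have ys : y \in << s >>%VS.
  apply: (hy (fun x => x \in << s >>%VS)); last by move=> x /Fs.
  by move=> x z t xs zs; rewrite memvD// memvZ.
have as_ : a \in << s >>%VS by apply: Fs; exact: min_face_self.
have nya : `|y - a| < r by rewrite distrC; move: ya; rewrite -ball_normE.
split.
  by rewrite -(subrKC a y); apply: (key) => //; rewrite memvB.
(* [a - y / 2] is half of [a + (a - y)], and [a - y] is as small as [y - a]. *)
exists (2^-1); first by rewrite invr_gt0.
have -> : a - 2^-1 *: y = 2^-1 *: (a + (a - y)).
  by rewrite addrA -mulr2n scalerBr -(scaler_nat 2 a) scalerA mulVf ?pnatr_eq0// scale1r.
apply: (CZ) => //; apply: (key); first by rewrite memvB.
by rewrite distrC.
Qed.

(** For one inclusion, the segment from [x] to [a] is prolonged inside [F], which is possible at a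
    relative interior point. For the other, the face property is applied to the prolonged segment in
    [C], which has [a] in its interior. *)
Lemma face_relint_uniq C F a : is_cone C -> C a -> is_face C F -> relint F a ->
  F = min_face C a.
Proof.
move=> cC Ca [_ FC cF Fs] [Fa [U Ua UF]]; have [CD CZ] := cC.
apply/seteqP; split => x.
  move=> Fx; split; first exact: FC.
  move/nbhs_ballP : Ua => [r /= r0 rU].
  pose e := r / (1 + `|x - a|) / 2.
  have n0 : 0 < 1 + `|x - a| by rewrite ltr_pwDl.
  have e0 : 0 < e by rewrite !divr_gt0.
  have Fy : F ((1 + e) *: a - e *: x).
    apply: UF; split.
      apply: rU; rewrite -ball_normE/= scalerDl scale1r -addrA opprD addNKr.
      rewrite -scalerBr normrN normrZ gtr0_norm// distrC /e.
      rewrite mulrAC ltr_pdivrMr// mulrAC ltr_pdivrMr// -mulrA ltr_pM2l//; lra.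
    move=> A afA FA; have := afA a x (- e) (FA _ Fa) (FA _ Fx).
    by rewrite opprK scaleNr.
  exists (e / (1 + e)); first by rewrite divr_gt0// addr_gt0.
  have -> : a - (e / (1 + e)) *: x = (1 + e)^-1 *: ((1 + e) *: a - e *: x).
    by rewrite scalerBr !scalerA mulVf ?gt_eqF ?addr_gt0// scale1r mulrC.
  by apply: (CZ); [rewrite invr_ge0 ltW// addr_gt0|exact: FC].
move=> [Cx [e e0 Ce]].
pose y := (1 + e) *: a - e *: x.
have Cy : C y.
  by rewrite /y scalerDl scale1r addrAC addrC; apply: (CD) => //; apply: (CZ) => //; exact: ltW.
suff : segment x y `<=` F.
  by apply; exists 0; rewrite /= ?lexx ?ler01// subr0 scale1r scale0r addr0.
apply: Fs.
  by move=> _ [t /andP[t0 t1] <-]; apply: (CD); apply: (CZ) => //; rewrite subr_ge0.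
exists a; split => //; exists (1 + e)^-1 => /=.
  by rewrite invr_gt0 addr_gt0//= invf_lt1 ?addr_gt0// ltrDl.
rewrite /y scalerBr !scalerA mulVf ?gt_eqF ?addr_gt0// scale1r addrCA -scalerBl.
rewrite (_ : _ - _ = 0) ?scale0r ?addr0//.
by field; rewrite gt_eqF// addr_gt0.
Qed.

Lemma face_at_coneE C a : is_cone C -> C a -> face_at C a = min_face C a.
Proof.
move=> cC Ca; have : [set F | is_face C F /\ relint F a] (face_at C a).
  apply: (@getI _ _ (min_face C a)) => /=.
  by split; [exact: min_face_is_face|exact: min_face_relint].
by move=> [fF rF]; exact: face_relint_uniq.
Qed.

End Faces.

(** * Strictly convex integrands and their conjugates *)

Section StrictlyConvexIntegrands.
Context {R : realType}.
Implicit Types (gam : R -> \bar R) (r s t : R).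
Local Open Scope ereal_scope.

Lemma Gamma_gtNy gam t : Gamma gam -> -oo < gam t.
Proof. by move=> []. Qed.

Lemma Gamma_fin gam t : Gamma gam -> (0 < t)%R -> gam t \is a fin_num.
Proof. by move=> [_ + _ _ _]; exact. Qed.

Lemma Gamma_neg gam t : Gamma gam -> (t < 0)%R -> gam t = +oo.
Proof. by move=> [_ _ _ + _]; exact. Qed.

Lemma Gamma_fin_ge0 gam t : Gamma gam -> gam t \is a fin_num -> (0 <= t)%R.
Proof.
by move=> hg ft; rewrite leNgt; apply/negP => /(Gamma_neg hg) gt; rewrite gt in ft.
Qed.

(** Where the conjugate is finite, the Fenchel gap is [gam] plus an affine function of t, so it
    inherits what is proved for [Gamma]. *)
Lemma Gamma_affine gam (k r : R) : Gamma gam ->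
  Gamma (fun t => gam t + (k - r * t)%:E).
Proof.
move=> [gNy gfin gconv gneg g0]; split.
- by move=> t; rewrite ltNye adde_eq_ninfty negb_or -ltNye gNy.
- by move=> t t0; rewrite fin_numD gfin.
- move=> s t u s0 t0 st u01.
  have u01' : (0 < (1 - u) * s + u * t)%R.
    by move/andP: u01 => [u0 u1]; rewrite addr_gt0 ?mulr_gt0// subr_gt0.
  have := gconv s t u s0 t0 st u01.
  rewrite -(fineK (gfin _ s0)) -(fineK (gfin _ t0)) -(fineK (gfin _ u01')).
  set x := fine (gam s); set y := fine (gam t); set w := fine _ => h.
  have {}h : (w < (1 - u) * x + u * y)%R by exact: h.
  suff : (w + (k - r * ((1 - u) * s + u * t)) <
      (1 - u) * (x + (k - r * s)) + u * (y + (k - r * t)))%R by exact.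
  lra.
- by move=> t t0; rewrite gneg.
- apply: cvgeD => //; first by rewrite fin_num_adde_defl.
  apply: cvg_EFin; first by near=> t.
  rewrite /comp/=; apply: cvgB; first exact: cvg_cst.
  by apply: cvgMr; apply: cvg_at_right_filter; exact: cvg_id.
Unshelve. all: end_near.
Qed.

Lemma Gamma_strict_pos gam x y z : Gamma gam -> (0 < x)%R -> (x < y)%R -> (y < z)%R ->
  (fine (gam y) * (z - x) < fine (gam x) * (z - y) + fine (gam z) * (y - x))%R.
Proof.
move=> hg x0 xy yz; have [_ gfin gconv _ _] := hg.
have xz : (x < z)%R by exact: lt_trans yz.
have y0 : (0 < y)%R by exact: lt_trans xy.
have z0 : (0 < z)%R by exact: lt_trans yz.
have zx : (0 < z - x)%R by rewrite subr_gt0.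
have := gconv x z ((y - x) / (z - x))%R x0 z0.
rewrite lt_eqF// => /(_ isT).
rewrite divr_gt0 ?subr_gt0//= ltr_pdivrMr// mul1r ltrD2r yz => /(_ isT).
have -> : ((1 - (y - x) / (z - x)) * x + (y - x) / (z - x) * z)%R = y.
  by field; rewrite gt_eqF.
rewrite -(fineK (gfin _ x0)) -(fineK (gfin _ y0)) -(fineK (gfin _ z0)).
rewrite -!EFinM -EFinD lte_fin /= => h.
rewrite -ltr_pdivlMr//; apply: lt_le_trans h _.
rewrite le_eqVlt; apply/orP; left; apply/eqP; field.
by rewrite gt_eqF.
Qed.

Lemma Gamma_cvg0 gam : Gamma gam -> gam 0%R \is a fin_num ->
  fine (gam s) @[s --> 0^'+] --> fine (gam 0%R).
Proof. by move=> [_ _ _ _ g0] f0; apply: fine_cvg; rewrite fineK. Qed.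

(** [Gamma] asks for strict convexity on positive arguments only. At [x = 0] the weak inequality is
    a limit; strictness returns by using it at the midpoint [m] of [x] and [y] together with the
    strict inequality on [m < y < z]. *)
Lemma Gamma_strict gam x y z : Gamma gam -> gam x \is a fin_num ->
  (x < y)%R -> (y < z)%R ->
  (fine (gam y) * (z - x) < fine (gam x) * (z - y) + fine (gam z) * (y - x))%R.
Proof.
move=> hg xfin xy yz; have x0 := Gamma_fin_ge0 hg xfin.
have weak y' : (x < y')%R -> (y' < z)%R -> (fine (gam y') * (z - x) <=
    fine (gam x) * (z - y') + fine (gam z) * (y' - x))%R.
  move=> xy' yz'; move: x0 xfin xy'; rewrite le_eqVlt => /predU1P[<-|x0] xfin xy'; last first.
    by rewrite ltW// Gamma_strict_pos.
  rewrite leNgt; apply/negP => h; rewrite -subr_lt0 in h.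
  have cv : (fine (gam s) * (z - y') + fine (gam z) * (y' - s) -
      fine (gam y') * (z - s))%R @[s --> 0^'+] -->
      (fine (gam 0) * (z - y') + fine (gam z) * (y' - 0) - fine (gam y') * (z - 0))%R.
    have id0 : s @[s --> (0:R)^'+] --> (0:R)%R.
      by apply: cvg_at_right_filter; exact: cvg_id.
    apply: cvgB; first apply: cvgD.
    - by apply: cvgMl; exact: Gamma_cvg0.
    - by apply: cvgMr; apply: cvgB => //; exact: cvg_cst.
    - by apply: cvgMr; apply: cvgB => //; exact: cvg_cst.
  have nb := cvgr_lt _ cv _ h.
  have : \forall s \near (0:R)^'+, False.
    near=> s.
    have := @Gamma_strict_pos gam s y' z hg.
    have : (fine (gam s) * (z - y') + fine (gam z) * (y' - s) -
      fine (gam y') * (z - s) < 0)%R by near: s; exact: nb.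
    have s0 : (0 < s)%R by near: s; exact: nbhs_right_gt.
    have sy : (s < y')%R by near: s; exact: nbhs_right_lt.
    move=> h1 /(_ s0 sy yz') h2; lra.
  by move/filter_ex => [].
pose m := ((x + y) / 2)%R.
have xm : (x < m)%R by rewrite /m; lra.
have my : (m < y)%R by rewrite /m; lra.
have m0 : (0 < m)%R by apply: le_lt_trans xm.
have h1 := weak m xm (lt_trans my yz).
have h2 := Gamma_strict_pos hg m0 my yz.
have zm : (0 < z - m)%R by rewrite subr_gt0 (lt_trans my).
have zx : (0 < z - x)%R by rewrite subr_gt0 (lt_trans xy).
have zy : (0 < z - y)%R by rewrite subr_gt0.
rewrite -(ltr_pM2l zm).
have h3 : ((z - x) * (fine (gam y) * (z - m)) <
  (z - x) * (fine (gam m) * (z - y) + fine (gam z) * (y - m)))%R.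
  by rewrite ltr_pM2l.
have h4 : ((z - y) * (fine (gam m) * (z - x)) <=
  (z - y) * (fine (gam x) * (z - m) + fine (gam z) * (m - x)))%R.
  by rewrite ler_pM2l.
have -> : ((z - m) * (fine (gam y) * (z - x)) = (z - x) * (fine (gam y) * (z - m)))%R by ring.
apply: lt_le_trans h3 _.
have -> : ((z - x) * (fine (gam m) * (z - y) + fine (gam z) * (y - m)) =
 (z - y) * (fine (gam m) * (z - x)) + (z - x) * (fine (gam z) * (y - m)))%R by ring.
have -> : ((z - m) * (fine (gam x) * (z - y) + fine (gam z) * (y - x)) =
 (z - y) * (fine (gam x) * (z - m) + fine (gam z) * (m - x)) +
 (z - x) * (fine (gam z) * (y - m)))%R by ring.
by rewrite lerD2r.
Unshelve. all: end_near.
Qed.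

(** By convexity the difference quotients at [t] lie between the slopes [A] and [B] of the chords
    over [[t / 2, t]] and [[t, t + 1]]; this gives a Lipschitz bound. *)
Lemma Gamma_continuous gam t : Gamma gam -> (0 < t)%R ->
  {for t, continuous (fine \o gam : R -> R)}.
Proof.
move=> hg t0; pose f := fine \o gam.
pose q := (t / 2)%R; pose p := (t + 1)%R.
have q0 : (0 < q)%R by rewrite divr_gt0.
have qt : (q < t)%R by rewrite /q; lra.
have tp : (t < p)%R by rewrite /p; lra.
have ch x y z : (0 < x)%R -> (x < y)%R -> (y < z)%R ->
  (f y * (z - x) < f x * (z - y) + f z * (y - x))%R.
  by move=> *; exact: Gamma_strict_pos.
have tq : (0 < t - q)%R by rewrite subr_gt0.
have p1 : (p - t = 1)%R by rewrite /p; ring.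
pose A := ((f t - f q) / (t - q))%R; pose B := (f p - f t)%R.
have AE : (f t - f q = A * (t - q))%R by rewrite /A divfK// gt_eqF.
pose K := (`|A| + `|B|)%R.
have bnd u v : (0 <= u -> A * u <= v -> v <= B * u -> `|v| <= K * u)%R.
  move=> u0 Au Bu; rewrite ler_norml mulrDl opprD; apply/andP; split.
    rewrite (le_trans _ Au)// -!mulNr (@le_trans _ _ (- `|A| * u))%R//.
      by rewrite gerDl mulNr oppr_le0 mulr_ge0.
    by rewrite ler_wpM2r// lerNl -normrN ler_norm.
  rewrite (le_trans Bu)// (@le_trans _ _ (`|B| * u))%R//.
    by rewrite ler_wpM2r// ler_norm.
  by rewrite lerDr mulr_ge0.
have lip s : (q < s)%R -> (s < p)%R -> (`|f t - f s| <= K * `|t - s|)%R.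
  move=> qs sp; have [st|ts|->] := ltgtP s t; last by rewrite !subrr normr0 mulr0.
    rewrite (gtr0_norm (x := (t - s)%R)) ?subr_gt0//.
    have h1 := ch q s t q0 qs st.
    have h2 := ch s t p (lt_trans q0 qs) st tp.
    rewrite p1 in h2.
    apply: bnd; first by rewrite subr_ge0 ltW.
      by rewrite -(ler_pM2r tq) (mulrAC A) -AE; lra.
    rewrite /B; have e : (p - s = 1 + (t - s))%R by rewrite /p; ring.
    by rewrite e in h2; lra.
  rewrite distrC [X in (_ <= _ * X)%R]distrC (gtr0_norm (x := (s - t)%R)) ?subr_gt0//.
  have h1 := ch q t s q0 qt ts.
  have h2 := ch t s p t0 ts sp.
  rewrite p1 in h2.
  apply: bnd; first by rewrite subr_ge0 ltW.
    by rewrite -(ler_pM2r tq) (mulrAC A) -AE; lra.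
  rewrite /B; have e : (p - s = 1 - (s - t))%R by rewrite /p; ring.
  by rewrite e in h2; lra.
have K1 : (0 < K + 1)%R by rewrite ltr_wpDl// addr_ge0.
apply/cvgrPdist_lt => e e0; near=> s.
have qs : (q < s)%R by near: s; exact: lt_nbhsr.
have sp : (s < p)%R by near: s; exact: lt_nbhsl.
apply: le_lt_trans (lip s qs sp) _.
have ts : (`|t - s| < e / (K + 1))%R.
  by near: s; apply: cvgr_dist_lt; rewrite ?divr_gt0//; exact: cvg_id.
rewrite ltr_pdivlMr// in ts; apply: le_lt_trans ts.
by rewrite mulrC ler_wpM2l// lerDl.
Unshelve. all: end_near.
Qed.

End StrictlyConvexIntegrands.

(** * Growth of a nonnegative integrand away from its zero *)

Section ZeroOfGamma.
Context {R : realType}.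
Implicit Types (gam : R -> \bar R) (r s t : R).
Local Open Scope ereal_scope.

(** At 0 continuity holds from the right only, since [gam] is +oo on the left; this is why arguments
    are approximated from above later on. *)
Lemma Gamma_cvg_right gam t : Gamma gam -> gam s @[s --> t^'+] --> gam t.
Proof.
move=> hg; have [t0|t0|->] := ltgtP t 0%R; last by case: hg.
- rewrite (Gamma_neg hg t0); apply: (@cvg_trans _ (cst +oo @ t^'+)).
    apply: near_eq_cvg; near=> s.
    have : (s < 0)%R by near: s; exact: nbhs_right_lt.
    by move=> /(Gamma_neg hg) ->.
  exact: cvg_cst.
- rewrite -(fineK (Gamma_fin hg t0)); apply: cvg_EFin.
    near=> s; apply: Gamma_fin => //; apply: lt_trans t0 _.
    by near: s; exact: nbhs_right_gt.
  by apply: cvg_at_right_filter; exact: Gamma_continuous.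
Unshelve. all: end_near.
Qed.

Variable gam : R -> \bar R.
Hypotheses (hg : Gamma gam) (g_ge0 : forall t, 0 <= gam t).

Lemma Gamma_zero_uniq s t : gam s = 0 -> gam t = 0 -> s = t.
Proof.
wlog st : s t / (s < t)%R => [wl s0 t0|].
  by have [st|ts|//] := ltgtP s t; [exact: wl|apply/esym; exact: wl].
move=> s0 t0.
have sm : (s < (s + t) / 2)%R by lra.
have mt : ((s + t) / 2 < t)%R by lra.
have sfin : gam s \is a fin_num by rewrite s0.
have := Gamma_strict hg sfin sm mt.
rewrite s0 t0 /= !mul0r addr0 ltNge mulr_ge0//; last by rewrite subr_ge0 ltW// (lt_trans sm).
by rewrite fine_ge0.
Qed.

Variable t0 : R.
Hypothesis gt0 : gam t0 = 0.

Let t0_ge0 : (0 <= t0)%R.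
Proof. by apply: (Gamma_fin_ge0 hg); rewrite gt0. Qed.

(** Applied to the Fenchel gap as a function of t: a lower bound for the gap at distance at least
    [e] from its zero [t0]. *)
Definition gap_margin (e : R) := mine (gam (t0 + e)) (gam (t0 - e)).

Lemma gap_margin_gt0 e : (0 < e)%R -> 0 < gap_margin e.
Proof.
move=> e0; rewrite /gap_margin lt_min !lt0e !g_ge0 !andbT; apply/andP; split.
  by apply/eqP => /Gamma_zero_uniq /(_ gt0); lra.
by apply/eqP => /Gamma_zero_uniq /(_ gt0); lra.
Qed.

Lemma gap_margin_fin e : (0 < e)%R -> gap_margin e \is a fin_num.
Proof.
(* [t0 + e] is positive, hence in the domain; [t0 - e] may lie outside it. *)
move=> e0; have f1 : gam (t0 + e) \is a fin_num.
  by apply: Gamma_fin => //; rewrite ltr_wpDl.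
rewrite fin_real// (lt_le_trans _ (ltW (gap_margin_gt0 e0)))//=.
by rewrite (@le_lt_trans _ _ (gam (t0 + e)))// ?ltey_eq ?f1// /gap_margin ge_min lexx.
Qed.

(** The chord from the zero [t0] to [t] passes above [gam] at distance [e] from [t0]. The linear
    growth, stronger than [gap_margin_le], is what [conjugate_upper] needs. *)
Lemma gap_margin_growth e t : (0 < e)%R -> (e <= `|t - t0|)%R ->
  gap_margin e * (`|t - t0| / e)%:E <= gam t.
Proof.
move=> e0 et.
have q1 : (0 <= `|t - t0| / e)%R by rewrite divr_ge0// ltW.
suff : exists2 x, gap_margin e <= x & x * (`|t - t0| / e)%:E <= gam t.
  by move=> [x gx]; apply: le_trans; apply: lee_wpmul2r; rewrite ?lee_fin.
have [tt|tt] := leP t t0; last first.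
  have te : (t0 + e <= t)%R by move: et; rewrite gtr0_norm ?subr_gt0//; lra.
  exists (gam (t0 + e)); first by rewrite /gap_margin ge_min lexx.
  rewrite gtr0_norm ?subr_gt0//.
  move: te; rewrite le_eqVlt => /predU1P[<-|te].
    by rewrite [(t0 + e - t0)%R]addrAC subrr add0r divff ?gt_eqF// mule1.
  have f1 : gam (t0 + e) \is a fin_num by apply: Gamma_fin => //; rewrite ltr_wpDl.
  have f2 : gam t \is a fin_num.
    by apply: Gamma_fin => //; apply: le_lt_trans tt.
  have f0 : gam t0 \is a fin_num by rewrite gt0.
  have t0e : (t0 < t0 + e)%R by rewrite ltrDl.
  have := Gamma_strict hg f0 t0e te.
  rewrite gt0 /= mul0r add0r -(fineK f1) -(fineK f2) -EFinM lee_fin.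
  have -> : (t0 + e - t0 = e)%R by ring.
  by move=> h; rewrite mulrA ler_pdivrMr// ltW.
exists (gam (t0 - e)); first by rewrite /gap_margin ge_min lexx orbT.
have [f2|] := boolP (gam t \is a fin_num); last first.
  by rewrite fin_numE negb_and !negbK gt_eqF ?(Gamma_gtNy _ hg)//= => /eqP ->; rewrite leey.
have tge0 := Gamma_fin_ge0 hg f2.
have te : (t <= t0 - e)%R by move: et; rewrite ler0_norm ?subr_le0//; lra.
rewrite ler0_norm ?subr_le0//.
move: te; rewrite le_eqVlt => /predU1P[->|te].
  rewrite (_ : - (t0 - e - t0) = e)%R; last by ring.
  by rewrite divff ?gt_eqF// mule1.
have f1 : gam (t0 - e) \is a fin_num by apply: Gamma_fin => //; apply: le_lt_trans te.
have t0e : (t0 - e < t0)%R by rewrite ltrBlDr ltrDl.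
have := Gamma_strict hg f2 te t0e.
rewrite gt0 /= mul0r addr0 -(fineK f1) -(fineK f2) -EFinM lee_fin.
rewrite (_ : t0 - (t0 - e) = e)%R; last by ring.
by move=> h; rewrite mulrA ler_pdivrMr// opprB ltW.
Qed.

Lemma gap_margin_le e t : (0 < e)%R -> (e <= `|t - t0|)%R -> gap_margin e <= gam t.
Proof.
move=> e0 et; apply: le_trans (gap_margin_growth e0 et).
rewrite -[leLHS]mule1; apply: lee_wpmul2l; first exact/ltW/gap_margin_gt0.
by rewrite lee_fin ler_pdivlMr// mul1r.
Qed.

End ZeroOfGamma.

Section Dichotomy.
Context {R : realType}.
Local Open Scope ereal_scope.

(** A minimum is attained on a compact interval [[a, M]], and left of [a] the values are at least 1.
    If [gam 0] is finite, [a] is 0; otherwise [gam] blows up at 0 and a small positive [a] keeps it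
    finite and continuous on the interval. *)
Lemma Gamma_zero_or_margin (gam : R -> \bar R) (M : R) : Gamma gam ->
  (forall t, 0 <= gam t) -> (0 < M)%R ->
  (exists t, gam t = 0) \/
  exists2 eta : R, (0 < eta)%R & forall t, (t <= M)%R -> eta%:E <= gam t.
Proof.
move=> hg g0 M0.
have [a [a0 aM afin acont ale]] : exists a : R, [/\ (0 <= a)%R, (a < M)%R,
    gam a \is a fin_num,
    (fine (gam s) @[s --> a^'+] --> fine (gam a)) &
    forall t, (t < a)%R -> 1 <= gam t].
  have [f0|] := boolP (gam 0%R \is a fin_num).
    exists 0%R; split => //; first exact: Gamma_cvg0.
    by move=> t /(Gamma_neg hg) ->; rewrite leey.
  rewrite fin_numE negb_and !negbK gt_eqF ?(Gamma_gtNy _ hg)//= => /eqP g0y.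
  have /cvgeyPge/(_ 1%R) : gam s @[s --> 0^'+] --> +oo by rewrite -g0y; exact: Gamma_cvg_right.
  move=> [e /= e0 he].
  pose a := Num.min (e / 2)%R (M / 2)%R.
  have a0 : (0 < a)%R by rewrite lt_min !divr_gt0.
  have ae : (a < e)%R by rewrite gt_min; apply/orP; left; lra.
  have aM : (a < M)%R by rewrite gt_min; apply/orP; right; lra.
  exists a; split => //; first exact: ltW.
  - exact: Gamma_fin.
  - by apply: cvg_at_right_filter; exact: Gamma_continuous.
  - move=> t ta; have [t0|t0|->] := ltgtP t 0%R.
    + by rewrite (Gamma_neg hg t0) leey.
    + apply: he => //=; rewrite sub0r normrN gtr0_norm//; exact: lt_trans ae.
    + by rewrite g0y leey.
have [||c cI cmin] := @EVT_min R (fine \o gam) a M.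
- exact: ltW.
- apply/continuous_within_itvP => //; split => //.
  + move=> x; rewrite in_itv/= => /andP[ax _].
    by apply: Gamma_continuous => //; exact: le_lt_trans ax.
  + by apply: cvg_at_left_filter; apply: Gamma_continuous => //.
have finI t : (a <= t)%R -> gam t \is a fin_num.
  rewrite le_eqVlt => /predU1P[<-//|ta]; apply: Gamma_fin => //.
  exact: le_lt_trans ta.
have [ac cM] : (a <= c)%R /\ (c <= M)%R by move: cI; rewrite in_itv/= => /andP.
have [fc0|fc0] := eqVneq (gam c) 0; first by left; exists c.
right; exists (Num.min 1 (fine (gam c)))%R.
  by rewrite lt_min ltr01/= fine_gt0// lt0e fc0 g0 -ge0_fin_numE ?g0// finI.
move=> t tM; have [ta|ta] := ltP t a.
  by apply: le_trans (ale _ ta); rewrite lee_fin ge_min lexx.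
rewrite -(fineK (finI _ ta)) lee_fin ge_min; apply/orP; right.
by apply: cmin; rewrite in_itv/= ta.
Qed.

End Dichotomy.

(** * Conjugates and the Fenchel gap *)

Section Conjugate.
Context {R : realType}.
Variable gam : R -> \bar R.
Hypothesis hg : Gamma gam.
Implicit Types (r s t : R).
Local Open Scope ereal_scope.

Definition gap (g : R -> \bar R) r t := conjugate g r + g t - (r * t)%:E.

Lemma conjugate_ge r t : (r * t)%:E - gam t <= conjugate gam r.
Proof. by apply: ereal_sup_ubound; exists t. Qed.

Lemma conjugate_gtNy r : -oo < conjugate gam r.
Proof.
apply: lt_le_trans (conjugate_ge r 1).
by rewrite -(fineK (Gamma_fin hg ltr01)) -EFinB ltNyr.
Qed.

Lemma conjugate_le r x : (forall t, gam t \is a fin_num -> (0 <= t)%R ->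
  (r * t - fine (gam t))%:E <= x) -> conjugate gam r <= x.
Proof.
move=> h; apply: ge_ereal_sup => _ [t _ <-].
have [f|] := boolP (gam t \is a fin_num).
  by rewrite -(fineK f) -EFinB h//; exact: Gamma_fin_ge0 f.
rewrite fin_numE negb_and !negbK gt_eqF ?(Gamma_gtNy _ hg)//= => /eqP ->.
by rewrite addeNy leNye.
Qed.

Lemma conjugate_homo r s : (r <= s)%R -> conjugate gam r <= conjugate gam s.
Proof.
move=> rs; apply: conjugate_le => t f t0; apply: le_trans (conjugate_ge s t).
by rewrite -{2}(fineK f) -EFinB lee_fin lerD2r ler_wpM2r.
Qed.

(** By right-continuity a rational slightly above t is almost as good as t. The countable supremum
    yields measurability of the conjugate and a countable list of trial constants. *)
Lemma conjugate_le_rat r x : (forall q : rat, (0 < q)%R ->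
  (r * ratr q)%:E - gam (ratr q) <= x) -> conjugate gam r <= x.
Proof.
move=> h; apply: conjugate_le => t f t0; rewrite leNgt; apply/negP => xt.
have cv : (r * s - fine (gam s))%R @[s --> t^'+] --> (r * t - fine (gam t))%R.
  apply: cvgB; last by apply: fine_cvg; rewrite fineK//; exact: Gamma_cvg_right.
  by apply: cvgMr; apply: cvg_at_right_filter; exact: cvg_id.
have [y xy yt] : exists2 y : R, x <= y%:E & (y < r * t - fine (gam t))%R.
  move: xt; case: x h => [x||] h; rewrite ?ltey ?lte_fin// => xt; first by exists x.
  by exists (r * t - fine (gam t) - 1)%R; rewrite ?leNye//; lra.
have [e /= e0 he] := cvgr_gt _ cv _ yt.
have te : (t < t + e)%R by rewrite ltrDl.
have [q] := rat_in_itvoo te.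
rewrite in_itv/= => /andP[tq qe].
have q0 : (0 < q)%R by rewrite -(ltr0q R); exact: le_lt_trans tq.
have := he (ratr q); rewrite /= ltr0_norm ?subr_lt0// => /(_ _ tq).
have -> : (- (t - ratr q) < e)%R by rewrite opprB ltrBlDl.
move=> /(_ isT) yq; have := h q q0; rewrite leNgt => /negP; apply.
have fq : gam (ratr q) \is a fin_num by apply: Gamma_fin => //; rewrite ltr0q.
by rewrite -(fineK fq) -EFinB; apply: le_lt_trans xy _; rewrite lte_fin.
Qed.

Lemma gap_ge0 r t : 0 <= gap gam r t.
Proof.
rewrite /gap.
have := conjugate_ge r t; have := conjugate_gtNy r; have := Gamma_gtNy t hg.
case: (gam t) => [g||]//; case: (conjugate gam r) => [c||]//; rewrite ?leey//.
move=> _ _ h; have {}h : (r * t - g <= c)%R by exact: h.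
by suff : (0 <= c + g - r * t)%R by []; lra.
Qed.

Lemma gapE r : conjugate gam r \is a fin_num ->
  gap gam r = fun t => gam t + (fine (conjugate gam r) - r * t)%:E.
Proof.
move=> f; apply/funext => t; rewrite /gap -{1}(fineK f) EFinB -addeA addeCA.
by rewrite addeA.
Qed.

Lemma gap_Gamma r : conjugate gam r \is a fin_num -> Gamma (gap gam r).
Proof. by move=> f; rewrite gapE//; exact: Gamma_affine. Qed.

Lemma gap0_fin r t : gap gam r t = 0 ->
  conjugate gam r \is a fin_num /\ gam t \is a fin_num.
Proof.
rewrite /gap; have := Gamma_gtNy t hg; have := conjugate_gtNy r.
by case: (conjugate gam r) => [c||]//; case: (gam t) => [g||].
Qed.

Section AtZero.
Variables r t0 : R.
Hypothesis gap0 : gap gam r t0 = 0.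

Let cfin : conjugate gam r \is a fin_num := (gap0_fin gap0).1.
Let gfin : gam t0 \is a fin_num := (gap0_fin gap0).2.

Lemma conjugate_subgradient s :
  (fine (conjugate gam r) + (s - r) * t0)%:E <= conjugate gam s.
Proof.
apply: le_trans (conjugate_ge s t0).
have := congr1 fine gap0; rewrite /gap -{1}(fineK cfin) -(fineK gfin)/=.
by rewrite -EFinB lee_fin; lra.
Qed.

(** [s * t - gam t] equals [conjugate gam r + (s - r) * t0] plus [(s - r) * (t - t0)] minus the gap
    at [t]. For [|t - t0| >= e] the growth of the gap beats the product once [|s - r| < m / e];
    nearer to [t0] the product is at most [|s - r| * e]. With [conjugate_subgradient] this makes
    [t0] the derivative. *)
Lemma conjugate_upper (e : R) : (0 < e)%R ->
  exists2 del : R, (0 < del)%R & forall s, (`|s - r| < del)%R ->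
    conjugate gam s <= (fine (conjugate gam r) + (s - r) * t0 + `|s - r| * e)%:E.
Proof.
move=> e0; have hG := gap_Gamma cfin; have g0 := gap_ge0 r.
have m0 := gap_margin_gt0 hG g0 gap0 e0.
have mf := gap_margin_fin hG g0 gap0 e0.
pose m := fine (gap_margin (gap gam r) t0 e).
have m0' : (0 < m)%R by rewrite fine_gt0// m0 -ge0_fin_numE// ltW.
exists (m / e)%R; first by rewrite divr_gt0.
move=> s sr; apply: conjugate_le => t f _; rewrite lee_fin.
have gE : gap gam r t = (fine (conjugate gam r) + fine (gam t) - r * t)%:E.
  by rewrite /gap -{1}(fineK cfin) -{1}(fineK f).
have := g0 t; rewrite gE lee_fin => gt_ge0.
suff : ((s - r) * (t - t0) - (fine (conjugate gam r) + fine (gam t) - r * t) <=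
    `|s - r| * e)%R by lra.
have le1 : ((s - r) * (t - t0) <= `|s - r| * `|t - t0|)%R.
  by rewrite -normrM ler_norm.
have [et|et] := leP e `|t - t0|%R.
  have := gap_margin_growth hG gap0 e0 et.
  rewrite -(fineK mf) gE -EFinM lee_fin -/m => h.
  have : (`|s - r| * `|t - t0| <= m / e * `|t - t0|)%R by rewrite ler_wpM2r// ltW.
  have : (0 <= `|s - r| * e)%R by rewrite mulr_ge0// ltW.
  rewrite [(m / e * _)%R]mulrAC -mulrA; lra.
have : (`|s - r| * `|t - t0| <= `|s - r| * e)%R by rewrite ler_wpM2l// ltW.
lra.
Qed.

Lemma gap_zero_finite_near : finite_near (conjugate gam) r.
Proof.
have [del del0 h] := conjugate_upper ltr01.
exists del => //= s /=; rewrite distrC => sr.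
rewrite fin_numE gt_eqF ?conjugate_gtNy//= lt_eqF//.
by apply: le_lt_trans (h s sr) _; rewrite ltry.
Qed.

Lemma conjugate_diff_quotient :
  (h^-1 *: ((fine \o conjugate gam) (h + r) - (fine \o conjugate gam) r))%R
  @[h --> (0 : R)%R^'] --> (t0 : R^o).
Proof.
apply/cvgrPdist_le => e e0.
have [del del0 hdel] := conjugate_upper e0.
have := gap_zero_finite_near; rewrite /finite_near => /nbhs_ballP[d /= d0 hd].
exists (Num.min del d); first by rewrite /= lt_min del0.
move=> h /=; rewrite sub0r normrN lt_min => /andP[hdl hd'] h0.
have ff : conjugate gam (h + r) \is a fin_num.
  by apply: hd; rewrite -ball_normE/= opprD addrCA addrN addr0 normrN.
have := hdel (h + r)%R; rewrite addrK => /(_ hdl).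
have := conjugate_subgradient (h + r)%R; rewrite addrK.
rewrite -(fineK ff) !lee_fin /=.
set u := fine (conjugate gam r); set v := fine (conjugate gam (h + r)%R) => lo up.
rewrite -[X in (`|X - _| <= _)%R](mulKf h0) -mulrBr normrM normfV.
rewrite ler_pdivrMl ?normr_gt0//.
rewrite ler_norml; apply/andP; split; lra.
Qed.

Lemma gap_zero_ederivable : ederivable (conjugate gam) r.
Proof.
split; first exact: gap_zero_finite_near.
rewrite /derivable; under eq_fun do rewrite /GRing.scale/= mulr1.
by apply/cvg_ex; exists t0; exact: conjugate_diff_quotient.
Qed.

Lemma gap_zero_ederive : ederive (conjugate gam) r = t0.
Proof. exact: cvg_lim conjugate_diff_quotient. Qed.

End AtZero.

(** The conjugate is nondecreasing and never -oo, so finiteness at one point on the right suffices.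
    The countable form serves measurability in z. *)
Lemma finite_nearP r : finite_near (conjugate gam) r <->
  exists k : nat, conjugate gam (r + k.+1%:R^-1) < +oo.
Proof.
split=> [/nbhs_ballP[e /= e0 he]|[k hk]].
  have [k ke] : exists k : nat, (k.+1%:R^-1 < e)%R.
    by exists (Num.trunc e^-1); rewrite invf_plt ?posrE// truncnS_gt.
  exists k; rewrite ltey_eq he// -ball_normE/= opprD addNKr normrN gtr0_norm//.
exists (k.+1%:R^-1)%R; first by rewrite /= invr_gt0.
move=> s /= sr; rewrite fin_numE gt_eqF ?conjugate_gtNy//= lt_eqF//.
apply: le_lt_trans hk; apply: conjugate_homo.
by rewrite -lerBlDl ltW// (le_lt_trans (ler_norm _))// distrC.
Qed.

Lemma finite_near_fin r : finite_near (conjugate gam) r ->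
  conjugate gam r \is a fin_num.
Proof. exact: nbhs_singleton. Qed.

(** Fenchel's inequality at [r + del] in place of [r] leaves the surplus [del * t]. *)
Lemma gap_coercive r : finite_near (conjugate gam) r ->
  exists2 del : R, (0 < del)%R & exists C : R, forall t, (del * t - C)%:E <= gap gam r t.
Proof.
move=> hr; have cfin := finite_near_fin hr.
have [k hk] := (finite_nearP r).1 hr; set del := (k.+1%:R^-1)%R in hk.
exists del; first by rewrite /del invr_gt0.
have hk' : conjugate gam (r + del) \is a fin_num.
  by rewrite fin_numE gt_eqF ?conjugate_gtNy//= lt_eqF.
exists (fine (conjugate gam (r + del)) - fine (conjugate gam r))%R => t.
have := conjugate_ge (r + del) t; rewrite /gap.
rewrite -{1}(fineK hk') -{2}(fineK cfin); have := Gamma_gtNy t hg.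
case: (gam t) => [g||]// _; last by rewrite leey.
set u := fine _; set v := fine _ => h.
have {}h : ((r + del) * t - g <= u)%R by exact: h.
by suff : (del * t - (u - v) <= v + g - r * t)%R by []; lra.
Qed.

(** Beyond [M] coercivity makes the gap at least 1. Without a zero the gap would then exceed a
    positive constant everywhere, and this constant could be subtracted from the supremum defining
    the conjugate. *)
Lemma finite_near_gap_zero r : finite_near (conjugate gam) r ->
  exists t, gap gam r t = 0.
Proof.
move=> hr; have cfin := finite_near_fin hr.
have [del del0 [C hC]] := gap_coercive hr.
pose M := Num.max 1%R ((C + 1) / del)%R.
have M0 : (0 < M)%R by rewrite lt_max ltr01.
have [//|[eta eta0 heta]] :=
  Gamma_zero_or_margin (gap_Gamma cfin) (gap_ge0 r) M0.
have geta t : (Num.min eta 1)%:E <= gap gam r t.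
  have [tM|Mt] := leP t M.
    by apply: le_trans (heta _ tM); rewrite lee_fin ge_min lexx.
  apply: le_trans (hC t); rewrite lee_fin ge_min; apply/orP; right.
  have : ((C + 1) / del < t)%R by apply: le_lt_trans Mt; rewrite le_max lexx orbT.
  by rewrite ltr_pdivrMr// mulrC; lra.
have : conjugate gam r <= (fine (conjugate gam r) - Num.min eta 1)%:E.
  apply: conjugate_le => t f _; have := geta t.
  rewrite /gap -{1}(fineK cfin) -{1}(fineK f) => h.
  have {}h : (Num.min eta 1 <= fine (conjugate gam r) + fine (gam t) - r * t)%R by exact: h.
  by rewrite lee_fin; lra.
rewrite -{1}(fineK cfin) lee_fin.
by have : (0 < Num.min eta 1)%R; [rewrite lt_min eta0 ltr01|lra].
Qed.

Lemma gap_margin_not_near r M : conjugate gam r \is a fin_num ->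
  ~ finite_near (conjugate gam) r ->
  exists2 eta : R, (0 < eta)%R & forall t, (t <= M)%R -> eta%:E <= gap gam r t.
Proof.
move=> cfin nr; have M0 : (0 < Num.max 1%R M)%R by rewrite lt_max ltr01.
have [[t /gap_zero_finite_near//]|[eta eta0 h]] :=
  Gamma_zero_or_margin (gap_Gamma cfin) (gap_ge0 r) M0.
by exists eta => // t tM; apply: h; rewrite le_max tM orbT.
Qed.

(** The reason is an affine minorant of [gam]: left of 1 the line through the points over 1 and 2,
    right of 1 the line through those over 1/2 and 1. Used in [good_set_cover]. *)
Lemma conjugate_bounded_at_Ny : exists A : R, forall s, (s <= - A)%R ->
  conjugate gam s <= A%:E.
Proof.
pose f := fine \o gam.
have h1 t : gam t \is a fin_num -> (t <= 1)%R -> (f 1 + (f 2 - f 1) * (t - 1) <= f t)%R.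
  move=> ft; rewrite le_eqVlt => /predU1P[->|t1].
    by rewrite subrr mulr0 addr0.
  have := Gamma_strict hg ft t1 (_ : 1 < 2)%R; rewrite ltr1n => /(_ isT).
  rewrite /f/=; lra.
have h2 t : (1 <= t)%R -> (f 1 + 2 * (f 1 - f (1/2)) * (t - 1) <= f t)%R.
  rewrite le_eqVlt => /predU1P[<-|t1]; first by rewrite subrr mulr0 addr0.
  have hf : gam (1 / 2)%R \is a fin_num by apply: Gamma_fin => //; lra.
  have := Gamma_strict hg hf (_ : 1 / 2 < 1)%R t1.
  have -> : (1 / 2 < 1 :> R)%R by lra.
  move=> /(_ isT); rewrite /f/=; lra.
pose a := `|f 1|%R; pose b := (`|f 2 - f 1| + 2 * `|f 1 - f (1/2)|)%R.
exists (a + b)%R => s sA; apply: conjugate_le => t ft t0; rewrite lee_fin.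
have ha : (- a <= f 1)%R by rewrite /a lerNl -normrN ler_norm.
have a0 : (0 <= a)%R by rewrite /a.
have b0 : (0 <= b)%R by rewrite /b addr_ge0// mulr_ge0.
suff : (- a - b - b * t <= f t)%R; rewrite /f /=.
  have : (s * t <= (- (a + b)) * t)%R by rewrite ler_wpM2r.
  have : (0 <= a * t)%R by rewrite mulr_ge0.
  rewrite /f/=; lra.
have key c u v : (`|c| <= b -> `|u| <= 1 + t -> f 1 + c * u <= v -> - a - b - b * t <= v)%R.
  move=> cb ut; apply: le_trans.
  have : (`|c * u| <= b * (1 + t))%R by rewrite normrM ler_pM.
  by rewrite ler_norml => /andP[]; lra.
have t1 : (`|t - 1| <= 1 + t)%R by rewrite ler_norml; apply/andP; split; lra.
have [tle|tgt] := leP t 1%R.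
  by apply: key (h1 t ft tle) => //; rewrite /b lerDl mulr_ge0.
apply: key (h2 t (ltW tgt)) => //.
by rewrite normrM (gtr0_norm (x := 2%R))// /b lerDr.
Qed.
End Conjugate.

(** * Measurability and integrals *)

Section MeasurableSublevel.
Context {d : measure_display} {Z : measurableType d} {R : realType}.

Lemma measurable_le_cst (f : Z -> R) (c : R) : measurable_fun [set: Z] f ->
  measurable [set z | f z <= c].
Proof.
move=> mf; rewrite -[X in measurable X]setTI.
have := mf measurableT _ (measurable_itv `]-oo, c]).
by congr (measurable (_ `&` _)); apply/seteqP; split => z /=; rewrite in_itv.
Qed.

Lemma emeasurable_le_cst (f : Z -> \bar R) (c : \bar R) : measurable_fun [set: Z] f ->
  measurable [set z | (f z <= c)%E].
Proof.
move=> mf; rewrite -[X in measurable X]setTI.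
have := mf measurableT _ (emeasurable_itv (Interval -oo%O (BRight c))).
by congr (measurable (_ `&` _)); apply/seteqP; split => z /=; rewrite in_itv.
Qed.

Lemma emeasurable_lt_cst (f : Z -> \bar R) (c : \bar R) : measurable_fun [set: Z] f ->
  measurable [set z | (f z < c)%E].
Proof.
move=> mf; rewrite -[X in measurable X]setTI.
have := mf measurableT _ (emeasurable_itv (Interval -oo%O (BLeft c))).
by congr (measurable (_ `&` _)); apply/seteqP; split => z /=; rewrite in_itv.
Qed.

End MeasurableSublevel.

Section Measurability.
Context {d : measure_display} {Z : measurableType d} {R : realType}.
Local Open Scope ereal_scope.

(* Closed boxes, so that they are stable under averaging. *)
Definition rat_box {n} (c : 'rV[rat]_n * nat) : set 'rV[R]_n :=
  [set x | forall i, (`|x ord0 i - ratr (c.1 ord0 i)| <= c.2.+1%:R^-1)%R].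

Lemma closed_notin_rat_box n (C : set 'rV[R]_n) x : closed C -> ~ C x ->
  exists2 c, rat_box c x & forall y, rat_box c y -> ~ C y.
Proof.
move=> cC nCx; have : nbhs x (~` C) by apply: open_nbhs_nbhs; split => //; exact: closed_openC.
move=> /nbhs_ballP[e /= e0 he].
pose k := Num.trunc (2 / e); pose w : R := (k.+1%:R^-1)%R.
have w0 : (0 < w)%R by rewrite invr_gt0.
have we : (w + w < e)%R.
  rewrite -mulr2n -mulr_natl -ltr_pdivlMl// mulrC -[(e / 2)%R]invrK invf_div.
  by rewrite ltf_pV2 ?posrE ?divr_gt0// truncnS_gt.
have /choice[q hq] : forall i, exists q : rat, (`|x ord0 i - ratr q| <= w)%R.
  move=> i; have xw : (x ord0 i < x ord0 i + w)%R by rewrite ltrDl.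
  have [q] := rat_in_itvoo xw; rewrite in_itv/= => /andP[q1 q2].
  by exists q; rewrite ltr0_norm ?subr_lt0// opprB lerBlDl ltW.
exists ((\row_i q i)%R, k); first by move=> i /=; rewrite mxE.
move=> y hy; apply: he; split => // i j; rewrite ord1 /ball/=.
have := hy j; rewrite /= mxE -/w => h1; have := hq j => h2.
rewrite -(subrKA (ratr (q j))) (le_lt_trans (ler_normD _ _))//.
by rewrite (le_lt_trans _ we)// lerD// distrC.
Qed.

Lemma measurable_rat_box n (phi : Z -> 'rV[R]_n) c :
  (forall i, measurable_fun [set: Z] (fun z => phi z ord0 i)) ->
  measurable [set z | rat_box c (phi z)].
Proof.
move=> mphi; have -> : [set z | rat_box c (phi z)] =
    \bigcap_(i in [set: 'I_n])
      [set z | (`|phi z ord0 i - ratr (c.1 ord0 i)| <= c.2.+1%:R^-1)%R].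
  by apply/seteqP; split => [z hz i _|z hz i]; [exact: hz|exact: hz i I].
apply: fin_bigcap_measurable => // i _.
apply: measurable_le_cst; apply: measurableT_comp => //.
by apply: measurable_funB => //; exact: measurable_cst.
Qed.

(** The complement of [C] is a union of countably many rational boxes, which reduces the claim to
    the coordinates of [phi]. *)
Lemma measurable_closed_preimage n (phi : Z -> 'rV[R]_n) (C : set 'rV[R]_n) :
  (forall i, measurable_fun [set: Z] (fun z => phi z ord0 i)) -> closed C ->
  measurable [set z | C (phi z)].
Proof.
move=> mphi cC; rewrite -[X in measurable X]setCK; apply: measurableC.
have -> : ~` [set z | C (phi z)] = \bigcup_(c : 'rV[rat]_n * nat)
    if `[< forall y, rat_box c y -> ~ C y >] then [set z | rat_box c (phi z)] else set0.
  apply/seteqP; split => [z /= nC|z [c _]].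
    have [c cx cC'] := closed_notin_rat_box cC nC.
    by exists c => //; case: asboolP.
  by case: asboolP => // h /= /h.
apply: countable_bigcupT_measurable => // c.
by case: asboolP => // _; exact: measurable_rat_box.
Qed.

Lemma measurable_fun_countable_index (f : int -> Z -> \bar R) (N : Z -> int) :
  (forall m, measurable_fun [set: Z] (f m)) ->
  (forall m, measurable [set z | N z = m]) ->
  measurable_fun [set: Z] (fun z => f (N z) z).
Proof.
move=> mf mN _ Y mY; rewrite setTI.
have -> : (fun z => f (N z) z) @^-1` Y =
    \bigcup_(m : int) ([set z | N z = m] `&` (f m @^-1` Y)).
  by apply/seteqP; split => [z hz|z [m _ [<-]]//]; exists (N z).
apply: countable_bigcupT_measurable => // m; apply: measurableI => //.
by rewrite -[X in measurable X]setTI; exact: mf.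
Qed.

Variable beta : Z -> R -> \bar R.
Hypothesis beta_B : classB beta.

Let mbeta t : measurable_fun [set: Z] (beta^~ t).
Proof. exact: beta_B.1. Qed.

Let hbeta z : Gamma (beta z).
Proof. exact: beta_B.2. Qed.

(* [beta z] is right-continuous, and [h] is a limit from the right of functions
   with countably many values. *)
Lemma measurable_integrand (h : Z -> R) : measurable_fun [set: Z] h ->
  measurable_fun [set: Z] (fun z => beta z (h z)).
Proof.
move=> mh; pose N k z := Num.floor (k.+1%:R * h z)%R.
(* The [+ 1] puts [hk k z] strictly above [h z], as a limit from the right requires. *)
pose hk k z : R := ((N k z + 1)%:~R / k.+1%:R)%R.
apply: (@emeasurable_fun_cvg _ _ _ _ (fun k z => beta z (hk k z))).
  move=> k; apply: (@measurable_fun_countable_index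
      (fun m z => beta z ((m + 1)%:~R / k.+1%:R)%R) (N k)) => // m.
  rewrite -[X in measurable X]setTI.
  have m' : measurable_fun [set: Z] (fun z => k.+1%:R * h z)%R.
    by apply: measurable_funM => //; exact: measurable_cst.
  have := m' measurableT _ (measurable_itv `[(m%:~R : R)%R, ((m + 1)%:~R : R)%R[).
  congr (measurable (_ `&` _)); apply/seteqP; split => z /=; rewrite in_itv/= /N.
    by move=> /andP[h1 h2]; apply: floor_def; rewrite h1.
  by move=> <-; rewrite ge_floor /= floorD1_gt.
move=> z _.
have hk_gt k : (h z < hk k z)%R.
  by rewrite /hk ltr_pdivlMr// mulrC floorD1_gt.
have hk_le k : (hk k z <= h z + k.+1%:R^-1)%R.
  rewrite /hk ler_pdivrMr// mulrDl mulVf ?pnatr_eq0// intrD lerD2r mulrC.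
  exact: ge_floor.
have cv : hk k z @[k --> \oo] --> (h z)^'+.
  move=> P [e /= e0 he]; have : \forall k \near \oo, (k.+1%:R^-1 < e)%R.
    exact: near_infty_natSinv_lt (PosNum e0).
  apply: filterS => k ke; apply: he; last exact: hk_gt.
  rewrite /= ltr0_norm ?subr_lt0// opprB ltrBlDl (le_lt_trans (hk_le k))//.
  by rewrite ltrD2l.
exact: (cvg_comp _ _ cv (Gamma_cvg_right (t := h z) (hbeta z))).
Qed.

Lemma measurable_conjugate (r : Z -> R) : measurable_fun [set: Z] r ->
  measurable_fun [set: Z] (fun z => conjugate (beta z) (r z)).
Proof.
(* Codes that denote no positive rational contribute -oo to the supremum. *)
move=> mr; pose u k z : \bar R := if @unpickle rat k is Some q then
  if (0 < q)%R then (r z * ratr q)%:E - beta z (ratr q) else -oo else -oo.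
have -> : (fun z => conjugate (beta z) (r z)) = (fun z => esups (u^~ z) 0%N).
  apply/funext => z; apply/eqP; rewrite eq_le; apply/andP; split.
    apply: conjugate_le_rat => // q q0; apply: ereal_sup_ubound.
    by exists (pickle q) => //; rewrite /u pickleK q0.
  apply: ge_ereal_sup => _ [k _ <-]; rewrite /u.
  case: (@unpickle rat k) => [q|]; last by rewrite leNye.
  by case: ifPn => // q0; [exact: conjugate_ge|rewrite leNye].
apply: measurable_fun_esups => k; rewrite /u.
case: (@unpickle rat k) => [q|]; last exact: measurable_cst.
case: (0 < q)%R; last exact: measurable_cst.
apply: emeasurable_funB => //.
by apply/measurable_EFinP; apply: measurable_funM => //; exact: measurable_cst.
Qed.

End Measurability.

(** * Integrals with the convention that two infinite parts give +oo *)

Section PrioritizedIntegral.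
Context {d : measure_display} {Z : measurableType d} {R : realType}.
Variable mu : {measure set Z -> \bar R}.
Local Open Scope ereal_scope.
Implicit Types (D : set Z) (f g h : Z -> \bar R) (v : Z -> R).

Lemma pintegral_integrable D f : measurable D -> mu.-integrable D f ->
  pintegral mu D f = \int[mu]_(z in D) f z.
Proof.
move=> mD fi; rewrite /pintegral; case: ifPn => // /andP[/eqP h _].
by have := integrable_pos_fin_num mD fi; rewrite h.
Qed.

Lemma pintegral_fin_integrable D f : measurable D -> measurable_fun D f ->
  pintegral mu D f \is a fin_num -> mu.-integrable D f.
Proof.
move=> mD mf; rewrite /pintegral; case: ifPn => // h.
have p0 : 0 <= \int[mu]_(z in D) f^\+ z by apply: integral_ge0.
have n0 : 0 <= \int[mu]_(z in D) f^\- z by apply: integral_ge0.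
rewrite integralE => ff; apply/integrableP; split => //.
rewrite (eq_integral (fun z => f^\+ z + f^\- z)); last first.
  by move=> z _; rewrite -[RHS]/((f^\+ \+ f^\-) z) -fune_abse.
rewrite ge0_integralD//; [|exact: measurable_funepos|exact: measurable_funeneg].
move: p0 n0 h ff; case: integral => [p||]//; case: integral => [q||]// *.
by rewrite -EFinD ltry.
Qed.

Lemma pintegral_ae_eq D f g : measurable D -> measurable_fun D f ->
  measurable_fun D g -> (\forall z \ae mu, D z -> f z = g z) ->
  pintegral mu D f = pintegral mu D g.
Proof.
move=> mD mf mg fg.
have [fgp fgn] := (ae_eq_funeposneg mu D f g).1 fg.
rewrite /pintegral (@ae_eq_integral _ _ _ mu D _ _ mD mf mg fg).
rewrite (@ae_eq_integral _ _ _ mu D _ _ mD (measurable_funepos mf) (measurable_funepos mg) fgp).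
by rewrite (@ae_eq_integral _ _ _ mu D _ _ mD (measurable_funeneg mf) (measurable_funeneg mg) fgn).
Qed.

(** The negative part of [f] is at most [|v|], so the convention is never invoked and additivity
    holds even if the integral of [h] is +oo. *)
Lemma pintegral_shift D v f h : measurable D ->
  mu.-integrable D (EFin \o v) -> measurable_fun D h ->
  (forall z, D z -> 0 <= h z) -> (forall z, D z -> f z = (v z)%:E + h z) ->
  pintegral mu D f = \int[mu]_(z in D) (v z)%:E + \int[mu]_(z in D) h z.
Proof.
move=> mD vi mh h0 fE.
have mv : measurable_fun D (EFin \o v) by exact: measurable_int vi.
have mf : measurable_fun D f.
  apply: (eq_measurable_fun (fun z => (v z)%:E + h z)).
    by move=> z; rewrite inE => Dz; rewrite fE.
  exact: emeasurable_funD.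
have ivn : \int[mu]_(z in D) `|(v z)%:E| < +oo by case/integrableP : vi.
have vfin := integrable_fin_num mD vi.
have fn : \int[mu]_(z in D) f^\- z < +oo.
  apply: le_lt_trans ivn; apply: ge0_le_integral => //.
  - exact: measurable_funeneg.
  - by apply: measurableT_comp.
  - move=> z Dz; rewrite funenegE fE// ge_max abse_ge0 andbT.
    have := h0 z Dz; case: (h z) => [x||]// x0; last by rewrite leNye.
    rewrite -EFinD -EFinN lee_fin; rewrite lee_fin in x0.
    by have := ler_norm (- v z)%R; rewrite normrN; lra.
have -> : pintegral mu D f = \int[mu]_(z in D) f z.
  by rewrite /pintegral; case: ifPn => // /andP[_ /eqP h']; rewrite h' in fn.
have hge0 : 0 <= \int[mu]_(z in D) h z by exact: integral_ge0.
have [hy|hfin] := eqVneq (\int[mu]_(z in D) h z) +oo.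
  have fp : \int[mu]_(z in D) f^\+ z = +oo.
    have : \int[mu]_(z in D) h z <=
        \int[mu]_(z in D) (f^\+ z + `|(v z)%:E|).
      apply: ge0_le_integral => //.
      - apply: emeasurable_funD; first exact: measurable_funepos.
        by apply: measurableT_comp.
      - move=> z Dz; rewrite funeposE fE//.
        have := h0 z Dz; case: (h z) => [x||]// x0.
        rewrite -EFinD -EFin_max -EFinD lee_fin.
        have : (v z + x <= Num.max (v z + x) 0)%R by rewrite le_max lexx.
        by have := ler_norm (- v z)%R; rewrite normrN; lra.
    rewrite hy leye_eq ge0_integralD//; [|exact: measurable_funepos|by apply: measurableT_comp].
    move: ivn; case: (\int[mu]_(z in D) f^\+ z) => [p||]//.
    by case: integral.
  rewrite integralE fp hy.
  have : 0 <= \int[mu]_(z in D) f^\- z by apply: integral_ge0.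
  by move: fn vfin; case: integral => [p||]//; case: integral.
have hi : mu.-integrable D h.
  apply/integrableP; split => //.
  rewrite (eq_integral h); first by rewrite ltey.
  by move=> z; rewrite inE => Dz; rewrite gee0_abs// h0.
rewrite -integralD//; apply: eq_integral => z; rewrite inE => Dz.
by rewrite fE.
Qed.

Lemma pintegral_split D f : measurable D -> measurable_fun [set: Z] f ->
  mu.-integrable (~` D) f ->
  pintegral mu [set: Z] f = \int[mu]_(z in ~` D) f z + pintegral mu D f.
Proof.
move=> mD mf fi; have mDC := measurableC mD.
have disj : [disjoint ~` D & D] by apply/disj_setPS; rewrite setICl.
have split_int g : measurable_fun [set: Z] g -> (forall z, 0 <= g z) ->
  \int[mu]_z g z = \int[mu]_(z in ~` D) g z + \int[mu]_(z in D) g z.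
  move=> mg g0; rewrite -(setvU D) ge0_integral_setU//.
  by rewrite setvU.
have pfin := integrable_pos_fin_num mDC fi.
have nfin := integrable_neg_fin_num mDC fi.
have pD : 0 <= \int[mu]_(z in D) f^\+ z by apply: integral_ge0.
have nD : 0 <= \int[mu]_(z in D) f^\- z by apply: integral_ge0.
have sp := split_int f^\+ (measurable_funepos mf) (fun z => funepos_ge0 f z).
have sn := split_int f^\- (measurable_funeneg mf) (fun z => funeneg_ge0 f z).
rewrite /pintegral (integralE mu [set: Z] f) (integralE mu (~` D) f).
rewrite (integralE mu D f) sp sn.
move: pfin nfin pD nD.
case: (\int[mu]_(z in ~` D) f^\+ z) => [a||]//.
case: (\int[mu]_(z in ~` D) f^\- z) => [b||]//.
case: (\int[mu]_(z in D) f^\+ z) => [p||]//;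
case: (\int[mu]_(z in D) f^\- z) => [q||]// _ _ _ _ /=.
by rewrite -!EFinD; congr _%:E; ring.
Qed.

End PrioritizedIntegral.

(** * Moments *)

Section Dotv.
Context {R : realType} {n : nat}.
Implicit Types x y : 'rV[R]_n.

Lemma dotvDr x y1 y2 : dotv x (y1 + y2) = dotv x y1 + dotv x y2.
Proof. by rewrite /dotv -big_split; apply: eq_bigr => i _; rewrite mxE mulrDr. Qed.

Lemma dotvZr x c y : dotv x (c *: y) = c * dotv x y.
Proof. by rewrite /dotv mulr_sumr; apply: eq_bigr => i _; rewrite mxE mulrCA. Qed.

Lemma dotvBr x y1 y2 : dotv x (y1 - y2) = dotv x y1 - dotv x y2.
Proof. by rewrite dotvDr -scaleN1r dotvZr mulN1r. Qed.

Lemma dotvZl c x y : dotv (c *: x) y = c * dotv x y.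
Proof. by rewrite /dotv mulr_sumr; apply: eq_bigr => i _; rewrite mxE mulrA. Qed.

Lemma dotv_continuous x : continuous (dotv x : 'rV[R]_n -> R).
Proof.
have h (s : seq 'I_n) : continuous (fun y : 'rV[R]_n => \sum_(i <- s) x 0 i * y 0 i : R).
  elim: s => [|i s IH].
    rewrite (_ : (fun y => _) = cst 0); first exact: cst_continuous.
    by apply/funext => y; rewrite big_nil.
  rewrite (_ : (fun y => _) =
      fun y : 'rV[R]_n => x 0 i * y 0 i + \sum_(j <- s) x 0 j * y 0 j); last first.
    by apply/funext => y; rewrite big_cons.
  move=> y; apply: (@cvgD _ _ _ (nbhs y) (nbhs_filter y)); last exact: IH.
  apply: (@cvgM _ _ (nbhs y) (nbhs_filter y)); first exact: cst_continuous.
  exact: coord_continuous.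
exact: h.
Qed.

Lemma dotv_closure0 x (A : set 'rV[R]_n) : (forall y, A y -> dotv x y = 0) ->
  forall y, closure A y -> dotv x y = 0.
Proof.
move=> A0; have cl : closed (dotv x @^-1` [set (0 : R)]).
  by apply: preimage_closed => [y _|]; [exact: dotv_continuous|exact: closed_eq].
move=> y cy; apply: cl; apply: closure_subset cy => z; exact: A0.
Qed.

End Dotv.

Section Moments.
Context {d : measure_display} {Z : measurableType d} {R : realType} {n : nat}.
Variables (mu : {measure set Z -> \bar R}) (phi : Z -> 'rV[R]_n).
Hypothesis mphi : forall i, measurable_fun [set: Z] (fun z => phi z ord0 i).
Implicit Types (f g h : Z -> R) (theta : 'rV[R]_n) (A : set Z).

Lemma integrable_bounded_on A (K : R) : measurable A -> (mu A < +oo)%E ->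
  mu.-integrable [set: Z] (EFin \o (fun z => K * \1_A z)).
Proof.
move=> mA Afin; apply/integrableP; split.
  by apply/measurable_EFinP; apply: measurable_funM => //; exact: measurable_indic.
under eq_integral do rewrite /= normrM (ger0_norm (x := \1_A _))// EFinM.
rewrite ge0_integralZl//; last by apply/measurable_EFinP; exact: measurable_indic.
by rewrite integral_indic// setIT lte_mul_pinfty// ?lee_fin.
Qed.

Lemma integrable_mul_indic f A : measurable A ->
  mu.-integrable [set: Z] (EFin \o f) ->
  mu.-integrable [set: Z] (EFin \o (fun z => f z * \1_A z)).
Proof.
move=> mA fi; apply: le_integrable (fi) => //.
  apply/measurable_EFinP; apply: measurable_funM => //.
  exact/measurable_EFinP/(measurable_int mu fi).
move=> z _ /=; rewrite lee_fin normrM indicE.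
by case: (z \in A); rewrite ?normr1 ?normr0 ?mulr1 ?mulr0.
Qed.

Lemma classG_measurable g : classG mu phi g -> measurable_fun [set: Z] g.
Proof. by case. Qed.

Lemma classGD g h : classG mu phi g -> classG mu phi h ->
  classG mu phi (fun z => g z + h z).
Proof.
move=> [mg ig] [mh ih]; split=> [|i]; first exact: measurable_funD.
apply: eq_integrable (integrableD measurableT (ig i) (ih i)) => // z _.
by rewrite /= -EFinD -mulrDr.
Qed.

Lemma classGZ c g : classG mu phi g -> classG mu phi (fun z => c * g z).
Proof.
move=> [mg ig]; split=> [|i].
  by apply: measurable_funM => //; exact: measurable_cst.
apply: eq_integrable (integrableZl measurableT c (ig i)) => // z _.
by rewrite /= -EFinM mulrCA.
Qed.

Lemma classG_indic g A : measurable A -> classG mu phi g ->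
  classG mu phi (fun z => g z * \1_A z).
Proof.
move=> mA [mg ig]; split=> [|i].
  by apply: measurable_funM => //; exact: measurable_indic.
apply: eq_integrable (integrable_mul_indic mA (ig i)) => // z _.
by rewrite /= mulrA.
Qed.

Lemma momentD g h : classG mu phi g -> classG mu phi h ->
  moment mu phi (fun z => g z + h z) = moment mu phi g + moment mu phi h.
Proof.
move=> [_ ig] [_ ih]; apply/rowP => i; rewrite !mxE -RintegralD//; [|exact: ig|exact: ih].
by apply: eq_Rintegral => z _; rewrite mulrDr.
Qed.

Lemma momentZ c g : classG mu phi g ->
  moment mu phi (fun z => c * g z) = c *: moment mu phi g.
Proof.
move=> [_ ig]; apply/rowP => i; rewrite !mxE -RintegralZl//; last exact: ig.
by apply: eq_Rintegral => z _; rewrite mulrCA.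
Qed.

Lemma integrable_dotv theta g : classG mu phi g ->
  mu.-integrable [set: Z] (EFin \o (fun z => dotv theta (phi z) * g z)).
Proof.
move=> [_ ig].
apply: (@eq_integrable _ _ _ mu _ measurableT
  (fun z => (\sum_i (theta 0 i)%:E * (phi z 0 i * g z)%:E)%E)).
  move=> z _ /=; rewrite /dotv mulr_suml -sumEFin; apply: eq_bigr => i _.
  by rewrite -EFinM mulrA.
by apply: integrable_sum => // i _; exact: integrableZl.
Qed.

Lemma moment_dotv theta g : classG mu phi g ->
  (\int[mu]_z (dotv theta (phi z) * g z)%:E)%E = (dotv theta (moment mu phi g))%:E.
Proof.
move=> [_ ig]; rewrite /dotv -sumEFin.
rewrite (eq_integral (fun z => (\sum_i (theta 0 i)%:E * (phi z 0 i * g z)%:E)%E)); last first.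
  move=> z _; rewrite mulr_suml -sumEFin; apply: eq_bigr => i _.
  by rewrite -EFinM mulrA.
rewrite integral_sum//; last by move=> i; exact: integrableZl.
apply: eq_bigr => i _; rewrite integralZl// EFinM !mxE; congr (_ * _)%E.
by rewrite fineK//; apply: integrable_fin_num.
Qed.

Lemma cn_cone : is_cone (cn mu phi).
Proof.
split.
  move=> _ _ [g [Gg g0] <-] [h [Gh h0] <-]; exists (fun z => g z + h z).
    by split=> [|z]; [exact: classGD|rewrite addr_ge0].
  exact: momentD.
move=> c _ c0 [g [Gg g0] <-]; exists (fun z => c * g z).
  by split=> [|z]; [exact: classGZ|rewrite mulr_ge0].
exact: momentZ.
Qed.

Lemma moment_indic_split g A : measurable A -> classG mu phi g ->
  moment mu phi g = moment mu phi (fun z => g z * \1_A z) +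
    moment mu phi (fun z => g z * \1_(~` A) z).
Proof.
move=> mA Gg; rewrite -momentD; [|exact: classG_indic|].
  congr moment; apply/funext => z; rewrite -mulrDr !indicE in_setC.
  by case: (z \in A); rewrite ?addr0 ?add0r mulr1.
by apply: classG_indic => //; exact: measurableC.
Qed.

(** Removing the part of [g] off [A] adds [e] times its moment to [a - e *: moment mu phi g], and
    that moment lies in the cone. *)
Lemma min_face_moment_indic a g A : measurable A -> classGp mu phi g ->
  min_face (cn mu phi) a (moment mu phi g) ->
  min_face (cn mu phi) a (moment mu phi (fun z => g z * \1_A z)).
Proof.
move=> mA [Gg g0] [Cg [e e0 Ce]].
have Gp B : measurable B -> classGp mu phi (fun z => g z * \1_B z).
  by move=> mB; split=> [|z]; [exact: classG_indic|rewrite mulr_ge0].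
split; first by exists (fun z => g z * \1_A z) => //; exact: Gp.
exists e => //; have [CD CZ] := cn_cone.
have -> : a - e *: moment mu phi (fun z => g z * \1_A z) =
  (a - e *: moment mu phi g) + e *: moment mu phi (fun z => g z * \1_(~` A) z).
  by rewrite (moment_indic_split mA Gg) scalerDr opprD addrA subrK.
apply: (CD) => //; apply: (CZ); first exact: ltW.
by exists (fun z => g z * \1_(~` A) z) => //; apply: Gp; exact: measurableC.
Qed.

Hypothesis mu_sigma_finite : sigma_finite [set: Z] mu.

(* If g charged a box missing the closed face, the normalized moment of g over
   that box would be a point of the face inside the box. *)
Lemma min_face_support a g : cn mu phi a -> classGp mu phi g ->
  min_face (cn mu phi) a (moment mu phi g) ->
  \forall z \ae mu, ~ closure (min_face (cn mu phi) a) (phi z) -> g z = 0.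
Proof.
move=> Ca [Gg g0] Fg; set F := min_face (cn mu phi) a.
have [_ FZ] : is_cone F by apply: min_face_cone => //; exact: cn_cone.
have [Y YT mY] := mu_sigma_finite.
have mg := classG_measurable Gg.
(* The class requires [phi g] to be integrable, not [g] itself. Finite measure and [g <= i] make the
   restricted [g] a weight that can be normalized. *)
pose A c (j i : nat) := [set z | rat_box c (phi z)] `&` (Y j `&` [set z | g z <= i%:R]).
have mA c j i : measurable (A c j i).
  apply: measurableI; first exact: measurable_rat_box.
  apply: measurableI; first exact: (mY j).1.
  exact: measurable_le_cst.
have key c j i : (forall y, rat_box c y -> ~ F y) ->
    \forall z \ae mu, A c j i z -> g z = 0.
  move=> cF; set B := A c j i.
  have mB : measurable B by exact: mA.
  pose h z := g z * \1_B z.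
  have h0 z : 0 <= h z by rewrite mulr_ge0.
  have Gh : classG mu phi h by exact: classG_indic.
  have mh := classG_measurable Gh.
  have hi : mu.-integrable [set: Z] (EFin \o h).
    apply: (le_integrable measurableT _ _ (integrable_bounded_on i%:R (mY j).1 (mY j).2)).
      exact/measurable_EFinP.
    move=> z _ /=; rewrite lee_fin /h normrM !indicE.
    have [|] := boolP (z \in B); last by rewrite normr0 mulr0.
    rewrite inE => -[_ [Yz gz]]; rewrite mem_set// !mulr1 normr1 mulr1.
    by rewrite ger0_norm// ger0_norm.
  have Fh : F (moment mu phi h) by exact: min_face_moment_indic.
  pose w := \int[mu]_z h z.
  have w0 : 0 <= w by apply: Rintegral_ge0.
  have wE : w = 0.
    apply/eqP; rewrite eq_le w0 andbT leNgt; apply/negP => wgt0.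
    (* The face is a cone, so it contains the normalized moment; as an average of [phi] over the
       box, that point stays in the closed box. *)
    apply: (cF (w^-1 *: moment mu phi h)); last first.
      by apply: (FZ) => //; rewrite invr_ge0.
    move=> k; rewrite !mxE.
    rewrite -[X in _ - X](mulKf (lt0r_neq0 wgt0)) -mulrBr normrM gtr0_norm ?invr_gt0//.
    rewrite ler_pdivrMl//.
    have i1 : mu.-integrable [set: Z] (EFin \o (fun z => ratr (c.1 ord0 k) * h z)).
      by apply: eq_integrable (integrableZl measurableT _ hi) => // z _; rewrite EFinM.
    rewrite [w * ratr _]mulrC -(RintegralZl (f := h))//.
    rewrite -RintegralB//; last exact: Gh.2.
    apply: le_trans (le_normr_Rintegral _ _) _ => //.
      by apply: eq_integrable (integrableB measurableT (Gh.2 k) i1) => // z _.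
    rewrite mulrC -(RintegralZl (f := h))//.
    apply: le_Rintegral => //.
    - apply: integrable_norm.
      by apply: eq_integrable (integrableB measurableT (Gh.2 k) i1) => // z _.
    - by apply: eq_integrable (integrableZl measurableT _ hi) => // z _; rewrite EFinM.
    - move=> z _; rewrite -mulrBl normrM (ger0_norm (h0 z)) /h indicE.
      have [|] := boolP (z \in B); last by rewrite mulr0 !mulr0.
      by rewrite inE => -[hb _]; rewrite ler_wpM2r// ?mulr1//; exact: hb.
  have : (\int[mu]_z `|(h z)%:E| = 0)%E.
    rewrite (eq_integral (EFin \o h)); last by move=> z _; rewrite /= ger0_norm.
    by rewrite -[LHS]fineK -?/(Rintegral _ _ _) -/w ?wE//; exact: integrable_fin_num.
  have mEh : measurable_fun [set: Z] (EFin \o h) by exact/measurable_EFinP.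
  move/(ae_eq_integral_abs mu measurableT mEh).
  apply: filterS => z /(_ I) hz Bz; have := congr1 fine hz.
  by rewrite /= /h indicE mem_set// mulr1.
pose P (m : nat) z :=
  if @unpickle ('rV[rat]_n * nat * nat * nat)%type m is Some (c, j, i) then
  (forall y, rat_box c y -> ~ F y) -> A c j i z -> g z = 0 else True.
have /ae_foralln : forall m, \forall z \ae mu, P m z.
  move=> m; rewrite /P; case: unpickle => [[[c j] i]|]; last exact: nearW.
  have [cF|ncF] := pselect (forall y, rat_box c y -> ~ F y).
    by apply: filterS (key c j i cF) => z h _; exact: h.
  by apply: nearW => z /ncF.
apply: filterS => z hP nF.
have [c cz cF] := closed_notin_rat_box (@closed_closure _ _) nF.
have [j _ Yz] : (\bigcup_j Y j) z by rewrite -YT.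
pose i := (Num.trunc (g z)).+1.
have := hP (pickle (c, j, i)); rewrite /P pickleK; apply.
  by move=> y /cF nFy Fy; apply: nFy; exact: subset_closure.
by split => //; split => //=; rewrite ltW// truncnS_gt.
Qed.

End Moments.

(** * Reduction to the face *)

Lemma integrable_le_perturb d (Z : measurableType d) (R : realType)
    (mu : {measure set Z -> \bar R}) (E B : set Z) (f f0 : Z -> R) (K : R) :
  measurable E -> measurable B -> (mu B < +oo)%E -> 0 <= K ->
  measurable_fun E f -> mu.-integrable E (EFin \o f0) ->
  (forall z, E z -> `|f z| <= `|f0 z| + K * \1_B z) ->
  mu.-integrable E (EFin \o f).
Proof.
move=> mE mB Bfin K0 mf f0i le_f.
have i1 : mu.-integrable E (fun z => `|f0 z|%:E) by exact: integrable_abse f0i.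
have i2 : mu.-integrable E (fun z => (K * \1_B z)%:E).
  by apply: integrableS (integrable_bounded_on K mB Bfin).
apply: (le_integrable mE _ _ (integrableD mE i1 i2)).
  exact/measurable_EFinP.
move=> z Ez; rewrite /= lee_fin [leRHS]ger0_norm; first exact: le_f.
by rewrite addr_ge0// mulr_ge0.
Qed.

Lemma measurable_switch d (Z : measurableType d) d' (U : measurableType d')
    (B : set Z) (f g : Z -> U) : measurable B ->
  measurable_fun [set: Z] f -> measurable_fun [set: Z] g ->
  measurable_fun [set: Z] (fun z => if z \in B then f z else g z).
Proof.
move=> mB mf mg; apply: measurable_fun_ifT => //.
apply: (measurable_fun_bool true); rewrite setTI.
rewrite [X in measurable X](_ : _ = B)//; apply/seteqP.
by split => z /=; [exact: set_mem|exact: mem_set].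
Qed.

Section FaceReduction.
Context {d : measure_display} {Z : measurableType d} {R : realType} {n : nat}.
Variables (mu : {measure set Z -> \bar R}) (phi : Z -> 'rV[R]_n)
  (beta : Z -> R -> \bar R) (a : 'rV[R]_n).
Hypotheses (mu_sigma_finite : sigma_finite [set: Z] mu)
  (mphi : forall i, measurable_fun [set: Z] (fun z => phi z ord0 i))
  (beta_B : classB beta) (J_fin : Jfun mu phi beta a \is a fin_num).
Implicit Types (g h : Z -> R) (theta : 'rV[R]_n).
Local Open Scope ereal_scope.

Local Notation F := (min_face (cn mu phi) a).
Local Notation D := [set z | closure F (phi z)].
Local Notation HD g := (pintegral mu D (fun z => beta z (g z))).
Local Notation gap_at theta z := (gap (beta z) (dotv theta (phi z))).

Let hbeta z : Gamma (beta z).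
Proof. exact: beta_B.2. Qed.

Let mbeta g : measurable_fun [set: Z] g -> measurable_fun [set: Z] (fun z => beta z (g z)).
Proof. exact: measurable_integrand. Qed.

Lemma measurable_face_domain : measurable D.
Proof. by apply: measurable_closed_preimage => //; exact: closed_closure. Qed.
Let mD := measurable_face_domain.
Let mDC : measurable (~` D) := measurableC mD.

Lemma measurable_dotv theta : measurable_fun [set: Z] (fun z => dotv theta (phi z)).
Proof.
rewrite /dotv; apply: measurable_sum => i.
by apply: measurable_funM => //; exact: measurable_cst.
Qed.

Lemma measurable_gap theta g : measurable_fun [set: Z] g ->
  measurable_fun [set: Z] (fun z => gap_at theta z (g z)).
Proof.
move=> mg; apply: emeasurable_funB.
  apply: emeasurable_funD; last exact: mbeta.
  by apply: measurable_conjugate => //; exact: measurable_dotv.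
by apply/measurable_EFinP; apply: measurable_funM => //; exact: measurable_dotv.
Qed.

Lemma exists_finite_point : exists2 g, classGp_at mu phi a g &
  Hfun mu beta g \is a fin_num.
Proof.
have [_ [g Gg <-] gJ] := lb_ereal_inf_adherent ltr01 J_fin; exists g => //.
rewrite fin_numE; apply/andP; split.
  rewrite gt_eqF//; apply: (@lt_le_trans _ _ (Jfun mu phi beta a)).
    by rewrite ltNye_eq J_fin.
  by apply: ereal_inf_lbound; exists g.
by rewrite lt_eqF// (lt_le_trans gJ)// leey.
Qed.

Lemma cn_point : cn mu phi a.
Proof.
have [g [[Gg ga] g0] _] := exists_finite_point.
by exists g.
Qed.

Let Ca := cn_point.

Lemma classGp_at_support g : classGp_at mu phi a g ->
  \forall z \ae mu, ~ D z -> g z = 0%R.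
Proof.
move=> [[Gg ga] g0]; apply: min_face_support => //.
by rewrite ga; apply: min_face_self => //; exact: cn_cone.
Qed.

Lemma Hfun_trunc g : classGp_at mu phi a g ->
  Hfun mu beta g = pintegral mu [set: Z] (fun z => beta z (g z * \1_D z)%R).
Proof.
move=> hg; have mg := classG_measurable hg.1.1; apply: pintegral_ae_eq => //.
- exact: mbeta.
- by apply: mbeta; apply: measurable_funM => //; exact: measurable_indic.
- apply: filterS (classGp_at_support hg) => z h _.
  have [Dz|nDz] := pselect (D z); first by rewrite indicE mem_set// mulr1.
  by rewrite indicE memNset// mulr0 h.
Qed.

Lemma integrable_omega : mu.-integrable (~` D) (fun z => beta z 0%R).
Proof.
have [g hg fg] := exists_finite_point; have mg := classG_measurable hg.1.1.
have mg' : measurable_fun [set: Z] (fun z => g z * \1_D z)%R.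
  by apply: measurable_funM => //; exact: measurable_indic.
rewrite Hfun_trunc// in fg.
have := pintegral_fin_integrable measurableT (mbeta mg') fg.
move=> /(integrableS measurableT mDC (@subsetT _ _)).
apply: eq_integrable => // z; rewrite inE => nDz.
by rewrite indicE memNset// mulr0.
Qed.

Lemma omegaE : omega mu phi beta F = \int[mu]_(z in ~` D) beta z 0%R.
Proof. exact: pintegral_integrable integrable_omega. Qed.

Lemma omega_fin : omega mu phi beta F \is a fin_num.
Proof. by rewrite omegaE; apply: integrable_fin_num => //; exact: integrable_omega. Qed.

Lemma Hfun_split g : classGp_at mu phi a g ->
  Hfun mu beta g = omega mu phi beta F + HD g.
Proof.
move=> hg; have mg := classG_measurable hg.1.1.
have mg' : measurable_fun [set: Z] (fun z => g z * \1_D z)%R.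
  by apply: measurable_funM => //; exact: measurable_indic.
rewrite Hfun_trunc// (pintegral_split mD) //; last 2 first.
- exact: mbeta.
- apply: eq_integrable integrable_omega => // z; rewrite inE => nDz.
  by rewrite indicE memNset// mulr0.
rewrite omegaE; congr (_ + _).
  by apply: eq_integral => z; rewrite inE => nDz; rewrite indicE memNset// mulr0.
apply: pintegral_ae_eq => //.
- by apply: measurable_funTS; exact: mbeta.
- by apply: measurable_funTS; exact: mbeta.
- by apply: nearW => z Dz; rewrite indicE mem_set// mulr1.
Qed.

Definition JD : R := (fine (Jfun mu phi beta a) - fine (omega mu phi beta F))%R.

Lemma JfunE : Jfun mu phi beta a = omega mu phi beta F + JD%:E.
Proof.
rewrite -(fineK omega_fin) -EFinD /JD addrC subrK fineK//.
Qed.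

Lemma JD_le g : classGp_at mu phi a g -> JD%:E <= HD g.
Proof.
move=> hg; rewrite -(leeD2lE _ _ omega_fin) -JfunE -Hfun_split//.
by apply: ereal_inf_lbound; exists g.
Qed.

(* The base point is changed on a null set so that it vanishes off D and has
   finite integrand at every point of D. *)
Lemma exists_base_point : exists g, [/\ classGp_at mu phi a g,
  (forall z, ~ D z -> g z = 0%R),
  (forall z, D z -> beta z (g z) \is a fin_num) &
  mu.-integrable D (fun z => beta z (g z))].
Proof.
have [g hg fg] := exists_finite_point; have mg := classG_measurable hg.1.1.
pose B := D `&` [set z | beta z (g z) < +oo].
have mB : measurable B.
  by apply: measurableI => //; apply: emeasurable_lt_cst; exact: mbeta.
(* The default is 1 on [D], where [beta z] is always finite, and 0 off [D]. *)
pose g1 z : R := if z \in B then g z else \1_D z.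
have mg1 : measurable_fun [set: Z] g1.
  by apply: measurable_switch => //; exact: measurable_indic.
have HDfin : HD g \is a fin_num.
  by move: fg; rewrite Hfun_split// fin_numD => /andP[].
have gi : mu.-integrable D (fun z => beta z (g z)).
  by apply: pintegral_fin_integrable => //; apply: measurable_funTS; exact: mbeta.
have gg1 : \forall z \ae mu, g z = g1 z.
  have h1 := classGp_at_support hg; have h2 := integrable_ae mD gi.
  near=> z; rewrite /g1; case: ifPn => //; rewrite notin_setE => nB.
  have [Dz|nDz] := pselect (D z); last first.
    rewrite indicE memNset//; move: nDz; near: z; exact: h1.
  exfalso; apply: nB; split => //=; rewrite ltey_eq.
  by rewrite [X in X || _](_ : _ = true)//; move: Dz; near: z; exact: h2.
have g1D z : ~ D z -> g1 z = 0%R.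
  by move=> nDz; rewrite /g1 memNset ?indicE ?memNset// => -[].
have g1fin z : D z -> beta z (g1 z) \is a fin_num.
  move=> Dz; rewrite /g1; case: ifPn => [|_].
    by rewrite inE => -[_ /= h]; rewrite fin_numE gt_eqF ?(Gamma_gtNy _ (hbeta z))// lt_eqF.
  by rewrite indicE mem_set//; apply: Gamma_fin.
have mphig1 i : measurable_fun [set: Z] (fun z => phi z ord0 i * g1 z)%R.
  exact: measurable_funM.
have Gg1 : classG mu phi g1.
  split => // i; apply/integrableP; split; first exact/measurable_EFinP.
  rewrite -(ge0_ae_eq_integral (f := fun z => `|(phi z 0 i * g z)%:E|)) //.
  - by have /integrableP[] := hg.1.1.2 i.
  - apply: measurableT_comp => //; exact: (measurable_int mu (hg.1.1.2 i)).
  - by apply: measurableT_comp => //; exact/measurable_EFinP.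
  - by apply: filterS gg1 => z -> _.
exists g1; split => //.
  split; first split => //.
    rewrite -hg.1.2; apply/rowP => i; rewrite !mxE; congr fine.
    apply: ae_eq_integral => //.
    + exact/measurable_EFinP.
    + exact: (measurable_int mu (hg.1.1.2 i)).
    + by apply: filterS gg1 => z -> _.
  by move=> z; rewrite /g1; case: ifPn => // _; exact: hg.2.
apply/integrableP; split; first by apply: measurable_funTS; exact: mbeta.
rewrite -(ge0_ae_eq_integral (f := fun z => `|beta z (g z)|)) //.
- by case/integrableP : gi.
- by apply: measurable_funTS; apply: measurableT_comp => //; exact: mbeta.
- by apply: measurable_funTS; apply: measurableT_comp => //; exact: mbeta.
- by apply: filterS gg1 => z -> _.
Unshelve. all: end_near.
Qed.

Lemma integral_dotv_face theta g : classGp_at mu phi a g ->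
  \int[mu]_(z in D) (dotv theta (phi z) * g z)%:E = (dotv theta a)%:E.
Proof.
move=> hg; have -> : (dotv theta a)%:E = \int[mu]_z (dotv theta (phi z) * g z)%:E.
  by rewrite (moment_dotv _ hg.1.1) hg.1.2.
rewrite integral_mkcond.
have mtg := measurable_int mu (integrable_dotv theta hg.1.1).
apply: ae_eq_integral => //.
- by apply/(measurable_restrictT _ mD); exact: measurable_funTS.
- apply: filterS (classGp_at_support hg) => z h _; rewrite patchE.
  by case: ifPn => //; rewrite notin_setE => /h ->; rewrite mulr0.
Qed.

Lemma integrable_fine (f : Z -> \bar R) : mu.-integrable D f ->
  mu.-integrable D (EFin \o (fine \o f)) /\
  \int[mu]_(z in D) (fine (f z))%:E = \int[mu]_(z in D) f z.
Proof.
move=> fi; have mf := measurable_int mu fi.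
have mff : measurable_fun D (EFin \o (fine \o f)).
  apply/measurable_EFinP; exact: measurableT_comp.
split.
  apply: (le_integrable mD mff _ fi) => z _ /=.
  by case: (f z) => [x||]//=; rewrite normr0 leey.
apply: ae_eq_integral => //; apply: filterS (integrable_ae mD fi) => z h Dz.
by rewrite fineK// h.
Qed.

(** Pointwise, the integrand is [dotv theta (phi z) * g z] minus the conjugate plus the gap. A
    finite [Kfun] makes the first two terms integrable; the nonnegative gap may have an infinite
    integral. *)
Lemma HD_gap theta g : classGp_at mu phi a g -> Kfun mu phi beta F theta \is a fin_num ->
  HD g = (dotv theta a)%:E - Kfun mu phi beta F theta +
    \int[mu]_(z in D) gap_at theta z (g z).
Proof.
move=> hg Kfin; have mg := classG_measurable hg.1.1.
pose u z := conjugate (beta z) (dotv theta (phi z)).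
have mu_ : measurable_fun D u.
  apply: measurable_funTS; apply: measurable_conjugate => //; exact: measurable_dotv.
have ui : mu.-integrable D u by exact: pintegral_fin_integrable.
have [fui fuE] := integrable_fine ui.
have ri : mu.-integrable D (EFin \o (fun z => dotv theta (phi z) * g z)%R).
  by apply: integrableS (integrable_dotv theta hg.1.1).
pose v z : R := (dotv theta (phi z) * g z - fine (u z))%R.
have vi : mu.-integrable D (EFin \o v).
  by apply: eq_integrable (integrableB mD ri fui) => // z _; rewrite /v /= EFinB.
have mgap := measurable_gap theta mg.
rewrite (@pintegral_ae_eq _ _ _ _ _ _ (fun z => (v z)%:E + gap_at theta z (g z)))//.
- rewrite (@pintegral_shift _ _ _ _ D v _ (fun z => gap_at theta z (g z)))//.
  + congr (_ + _); rewrite /v; under eq_integral do rewrite EFinB.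
    rewrite integralB//= integral_dotv_face// fuE.
    by rewrite /Kfun pintegral_integrable.
  + exact: measurable_funTS.
  + by move=> z _; exact: gap_ge0.
- by apply: measurable_funTS; exact: mbeta.
- by apply: emeasurable_funD; [exact: measurable_int vi|exact: measurable_funTS].
- apply: filterS (integrable_ae mD ui) => z h Dz; have uf := h Dz.
  rewrite /gap /v -/(u z) -(fineK uf) /=.
  have := Gamma_gtNy (g z) (hbeta z); case: (beta z (g z)) => [b||]// _.
  by rewrite -!EFinD; congr _%:E; ring.
Qed.

(** The identity of [HD_gap] solved for the conjugate. Integrability now comes from [g], so [Kfun]
    may be +oo. *)
Lemma Kfun_gap theta g : classGp_at mu phi a g ->
  (forall z, D z -> beta z (g z) \is a fin_num) ->
  mu.-integrable D (fun z => beta z (g z)) ->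
  Kfun mu phi beta F theta = (dotv theta a)%:E - HD g +
    \int[mu]_(z in D) gap_at theta z (g z).
Proof.
move=> hg bfin bi; have mg := classG_measurable hg.1.1.
have [fbi fbE] := integrable_fine bi.
have ri : mu.-integrable D (EFin \o (fun z => dotv theta (phi z) * g z)%R).
  by apply: integrableS (integrable_dotv theta hg.1.1).
pose v z : R := (dotv theta (phi z) * g z - fine (beta z (g z)))%R.
have vi : mu.-integrable D (EFin \o v).
  by apply: eq_integrable (integrableB mD ri fbi) => // z _; rewrite /v /= EFinB.
rewrite /Kfun (@pintegral_shift _ _ _ _ D v _ (fun z => gap_at theta z (g z)))//.
- congr (_ + _); rewrite /v; under eq_integral do rewrite EFinB.
  by rewrite integralB//= integral_dotv_face// fbE pintegral_integrable.
- by apply: measurable_funTS; exact: measurable_gap.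
- by move=> z _; exact: gap_ge0.
- move=> z Dz; rewrite /gap /v -(fineK (bfin z Dz)) /=.
  have := conjugate_gtNy (hbeta z) (dotv theta (phi z)).
  case: conjugate => [c||]// _; rewrite ?addye ?adde_eq_ninfty//.
  by rewrite -!EFinD; congr _%:E; ring.
Qed.

Lemma Kfun_gtNy theta : -oo < Kfun mu phi beta F theta.
Proof.
have [g [hg _ bfin bi]] := exists_base_point; rewrite (Kfun_gap theta hg bfin bi).
have HDfin : HD g \is a fin_num by rewrite pintegral_integrable//; exact: integrable_fin_num.
rewrite -(fineK HDfin) -EFinB.
have : 0 <= \int[mu]_(z in D) gap_at theta z (g z).
  by apply: integral_ge0 => z _; exact: gap_ge0.
by case: integral => [x||]// _; rewrite -EFinD ltNyr.
Qed.

Lemma weak_duality theta : dual_objective mu phi beta F a theta <= JD%:E.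
Proof.
rewrite /dual_objective.
have [->|Ky] := eqVneq (Kfun mu phi beta F theta) +oo; first by rewrite addeNy leNye.
have Kfin : Kfun mu phi beta F theta \is a fin_num.
  by rewrite fin_numE Ky gt_eqF// Kfun_gtNy.
rewrite -(leeD2lE _ _ omega_fin) -JfunE; apply: le_ereal_inf_tmp => _ [g hg <-].
rewrite Hfun_split// leeD2lE ?omega_fin// (HD_gap hg Kfin).
by rewrite leeDl//; apply: integral_ge0 => z _; exact: gap_ge0.
Qed.

End FaceReduction.

(** * Strong duality *)

Lemma Gamma_convex (R : realType) (gam : R -> \bar R) (x y t : R) : Gamma gam ->
  gam x \is a fin_num -> gam y \is a fin_num -> 0 <= t <= 1 ->
  gam ((1 - t) * x + t * y) \is a fin_num /\
  fine (gam ((1 - t) * x + t * y)) <= (1 - t) * fine (gam x) + t * fine (gam y).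
Proof.
move=> hg; wlog xy : x y t / x < y => [wl|] fx fy /andP[t0 t1].
  have [xy|yx|<-] := ltgtP x y; first by apply: wl => //; rewrite t0.
    have := wl y x (1 - t) yx fy fx; rewrite subr_ge0 t1 lerBlDr lerDl t0.
    rewrite (_ : 1 - (1 - t) = t); last by ring.
    by rewrite addrC [X in _ <= X]addrC; apply.
  by rewrite -!mulrDl subrK !mul1r.
have x0 := Gamma_fin_ge0 hg fx.
move: t0; rewrite le_eqVlt => /predU1P[<-|t0].
  by rewrite subr0 !mul1r !mul0r !addr0.
move: t1; rewrite le_eqVlt => /predU1P[->|t1].
  by rewrite subrr !mul1r !mul0r !add0r.
set z := (1 - t) * x + t * y.
have yx0 : 0 < y - x by rewrite subr_gt0.
have e1 : z - x = t * (y - x) by rewrite /z; ring.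
have e2 : y - z = (1 - t) * (y - x) by rewrite /z; ring.
have xz : x < z by rewrite -subr_gt0 e1 mulr_gt0.
have zy : z < y by rewrite -subr_gt0 e2 mulr_gt0// subr_gt0.
split; first by apply: Gamma_fin => //; apply: le_lt_trans xz.
have := Gamma_strict hg fx xz zy; rewrite e1 e2 !mulrA -mulrDl ltr_pM2r// => h.
by rewrite [(1 - t) * _]mulrC [t * _]mulrC ltW.
Qed.

Section StrongDuality.
Context {d : measure_display} {Z : measurableType d} {R : realType} {n : nat}.
Variables (mu : {measure set Z -> \bar R}) (phi : Z -> 'rV[R]_n)
  (beta : Z -> R -> \bar R) (a : 'rV[R]_n).
Hypotheses (mu_sigma_finite : sigma_finite [set: Z] mu)
  (mphi : forall i, measurable_fun [set: Z] (fun z => phi z ord0 i))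
  (beta_B : classB beta) (J_fin : Jfun mu phi beta a \is a fin_num).
Implicit Types (g h : Z -> R) (theta : 'rV[R]_n) (k l : nat).

Local Notation F := (min_face (cn mu phi) a).
Local Notation D := [set z | closure F (phi z)].
Local Notation HD g := (pintegral mu D (fun z => beta z (g z))).
Local Notation JD := (JD mu phi beta a).

Variable g0 : Z -> R.
Hypotheses (hg0 : classGp_at mu phi a g0) (g0D : forall z, ~ D z -> g0 z = 0)
  (g0fin : forall z, D z -> beta z (g0 z) \is a fin_num)
  (g0i : mu.-integrable D (fun z => beta z (g0 z))).

Variable Y : nat -> set Z.
Hypotheses (Ycover : [set: Z] = \bigcup_k Y k)
  (Yhomo : {homo Y : k l / (k <= l)%N >-> (k <= l)%O})
  (mY : forall k, measurable (Y k)) (Yfin : forall k, (mu (Y k) < +oo)%E).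

Let hbeta z : Gamma (beta z).
Proof. exact: beta_B.2. Qed.

Let mbeta g : measurable_fun [set: Z] g -> measurable_fun [set: Z] (fun z => beta z (g z)).
Proof. exact: measurable_integrand. Qed.

Let mD : measurable D.
Proof. exact: measurable_face_domain. Qed.

Let mg0 : measurable_fun [set: Z] g0.
Proof. exact: classG_measurable hg0.1.1. Qed.

(* The bound on the conjugate at -k bounds beta z from below by an affine
   function. *)
Definition good_set k : set Z := Y k `&` D `&` [set z | g0 z <= k%:R] `&`
  [set z | (beta z (g0 z) <= k%:R%:E)%E] `&`
  [set z | (conjugate (beta z) (- k%:R) <= k%:R%:E)%E] `&`
  [set z | forall i, `|phi z ord0 i| <= k%:R].

Lemma measurable_good_set k : measurable (good_set k).
Proof.
repeat apply: measurableI => //.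
- exact: measurable_le_cst.
- by apply: emeasurable_le_cst; exact: mbeta.
- by apply: emeasurable_le_cst; apply: measurable_conjugate => //; exact: measurable_cst.
- rewrite (_ : mkset _ = \bigcap_(i in [set: 'I_n]) [set z | `|phi z ord0 i| <= k%:R]).
    apply: fin_bigcap_measurable => // i _; apply: measurable_le_cst.
    exact: measurableT_comp.
  by apply/seteqP; split => [z hz i _|z hz i]; [exact: hz|exact: hz i I].
Qed.

Lemma good_set_homo k l : (k <= l)%N -> good_set k `<=` good_set l.
Proof.
move=> kl z [[[[[Yz Dz] gz] bz] cz] pz].
have kl' : k%:R <= l%:R :> R by rewrite ler_nat.
split; [split; [split; [split; [split|]|]|]|] => //=.
- by move: Yz; apply/subsetPset; exact: Yhomo.
- exact: le_trans gz _.
- by apply: le_trans bz _; rewrite lee_fin.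
- apply: (@le_trans _ _ (conjugate (beta z) (- k%:R))).
    by apply: conjugate_homo => //; rewrite lerN2.
  by apply: le_trans cz _; rewrite lee_fin.
- by move=> i; exact: le_trans (pz i) _.
Qed.

Lemma good_set_cover z : D z -> exists k, forall l, (k <= l)%N -> good_set l z.
Proof.
move=> Dz; have [j _ Yz] : (\bigcup_k Y k) z by rewrite -Ycover.
have [A hA] := conjugate_bounded_at_Ny (hbeta z).
pose M := `|g0 z| + `|fine (beta z (g0 z))| + `|A| + \sum_i `|phi z ord0 i|.
have s0 : 0 <= \sum_i `|phi z ord0 i| by rewrite sumr_ge0.
pose k := maxn j (Num.trunc M).+1.
have Mk : M <= k%:R.
  rewrite (le_trans (ltW (truncnS_gt M)))// ler_nat; exact: leq_maxr.
suff kz : good_set k z by exists k => l kl; exact: good_set_homo kl z kz.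
have n1 := ler_norm (g0 z).
have n2 := ler_norm (fine (beta z (g0 z))).
have n3 := ler_norm A.
have p1 := normr_ge0 (g0 z).
have p2 := normr_ge0 (fine (beta z (g0 z))).
have p3 := normr_ge0 A.
split; [split; [split; [split; [split|]|]|]|] => //=.
- by move: Yz; apply/subsetPset/Yhomo; exact: leq_maxl.
- by apply: le_trans Mk; rewrite /M; lra.
- by rewrite -(fineK (g0fin Dz)) lee_fin; apply: le_trans Mk; rewrite /M; lra.
- apply: (@le_trans _ _ A%:E).
    by apply: hA; rewrite lerN2; apply: le_trans Mk; rewrite /M; lra.
  by rewrite lee_fin; apply: le_trans Mk; rewrite /M; lra.
- move=> i; apply: le_trans Mk.
  have : `|phi z ord0 i| <= \sum_i `|phi z ord0 i|.
    by rewrite (bigD1 i)//= lerDl sumr_ge0.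
  by rewrite /M; lra.
Qed.

Lemma good_set_fin k : (mu (good_set k) < +oo)%E.
Proof.
apply: le_lt_trans (Yfin k); apply: le_measure; rewrite ?inE//.
  exact: measurable_good_set.
by move=> z [[[[[]]]]].
Qed.

(** One index bounds the place of the change, the new values and the new integrand, so the classes
    increase with [k] and their union is convex. *)
Definition admissible_at k g := [/\ measurable_fun [set: Z] g,
  forall z, ~ good_set k z -> g z = g0 z &
  forall z, good_set k z -> 0 <= g z <= k%:R /\ (beta z (g z) <= k%:R%:E)%E].

Definition admissible g := exists k, admissible_at k g.

Lemma admissible_at_homo k l g : (k <= l)%N -> admissible_at k g -> admissible_at l g.
Proof.
move=> kl [mg goff gon]; have kl' : k%:R <= l%:R :> R by rewrite ler_nat.
split=> // z zl.
  by apply: goff => /(good_set_homo kl).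
have [zk|nzk] := pselect (good_set k z).
  have [/andP[gz gk] bz] := gon z zk.
  rewrite gz (le_trans gk kl'); split => //.
  by apply: le_trans bz _; rewrite lee_fin.
rewrite goff//; move: zl => [[[[_ gz] bz] _] _].
by rewrite hg0.2.
Qed.

Lemma admissible_base : admissible g0.
Proof.
exists 0%N; split => // z [[[[_ gz] bz] _] _].
by rewrite hg0.2.
Qed.

Lemma admissible_ge0 g z : admissible g -> 0 <= g z.
Proof.
move=> [k [_ goff gon]]; have [/gon[/andP[]]//|/goff->] := pselect (good_set k z).
exact: hg0.2.
Qed.

Lemma admissible_off g z : admissible g -> ~ D z -> g z = 0.
Proof.
move=> [k [_ goff _]] nDz; rewrite goff ?g0D//.
by move=> [[[[[_]]]]].
Qed.

Lemma admissible_fin g z : admissible g -> D z -> beta z (g z) \is a fin_num.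
Proof.
move=> [k [_ goff gon]] Dz.
have [/gon[_ bz]|/goff->] := pselect (good_set k z); last exact: g0fin.
by rewrite fin_numE gt_eqF ?(Gamma_gtNy _ (hbeta z))// lt_eqF// (le_lt_trans bz)// ltry.
Qed.

Lemma admissible_measurable g : admissible g -> measurable_fun [set: Z] g.
Proof. by move=> [k []]. Qed.

Lemma admissible_classG g : admissible g -> classG mu phi g.
Proof.
move=> adm; have [k [mg goff gon]] := adm; split => // i.
have mpg : measurable_fun [set: Z] (fun z => phi z 0 i * g z) by exact: measurable_funM.
apply: (integrable_le_perturb (f0 := fun z => phi z 0 i * g0 z)
  measurableT (measurable_good_set k) (good_set_fin k) (mulr_ge0 (ler0n _ k) (ler0n _ k))) => //.
  exact: hg0.1.1.2.
move=> z _; rewrite indicE; have [zk|nzk] := pselect (good_set k z).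
  rewrite mem_set// mulr1 normrM; have [/andP[gz gk] _] := gon z zk.
  rewrite (ger0_norm gz) ler_wpDl//; apply: ler_pM => //.
  by case: zk => _; apply.
by rewrite memNset// mulr0 addr0 goff.
Qed.

Lemma integrable_admissible g : admissible g ->
  mu.-integrable D (EFin \o (fun z => fine (beta z (g z)))).
Proof.
move=> adm; have [k [mg goff gon]] := adm.
have kk : 0 <= k%:R * k%:R :> R by rewrite mulr_ge0.
apply: (integrable_le_perturb (f0 := fun z => fine (beta z (g0 z)))
  mD (measurable_good_set k) (good_set_fin k) (addr_ge0 kk (ler0n _ k))).
- by apply: measurable_funTS; apply: measurableT_comp => //; exact: mbeta.
- by have [] := integrable_fine mphi g0i.
move=> z Dz; rewrite indicE; have [zk|nzk] := pselect (good_set k z).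
  rewrite mem_set// mulr1; have [/andP[gz gk] bz] := gon z zk.
  rewrite ler_wpDl//; have bf := admissible_fin adm Dz.
  rewrite ler_norml; apply/andP; split; last first.
    by move: bz; rewrite -{1}(fineK bf) lee_fin; lra.
  (* Fenchel's inequality at [- k] gives [beta z (g z) >= - k * g z - k], which is at least
     [- (k * k + k)]. *)
  have := conjugate_ge (beta z) (- k%:R) (g z).
  move: zk => [[_ /= cz] _] /le_trans/(_ cz).
  rewrite -{1}(fineK bf) -EFinB lee_fin.
  have : k%:R * g z <= k%:R * k%:R by rewrite ler_wpM2l.
  by lra.
by rewrite memNset// mulr0 addr0 goff.
Qed.

Definition hd g : R := \int[mu]_(z in D) fine (beta z (g z)).

Lemma hdE g : admissible g -> HD g = (hd g)%:E.
Proof.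
move=> adm; have gi := integrable_admissible adm.
rewrite /hd /Rintegral fineK; last exact: integrable_fin_num.
have h z : D z -> (fine (beta z (g z)))%:E = beta z (g z).
  by move=> Dz; rewrite fineK//; exact: admissible_fin.
rewrite pintegral_integrable//.
  by apply: eq_integral => z; rewrite inE => /h.
by apply: eq_integrable gi => // z; rewrite inE => /h.
Qed.

Lemma hd_ge g : admissible g -> moment mu phi g = a -> JD <= hd g.
Proof.
move=> adm ga; rewrite -lee_fin -hdE//; apply: JD_le => //; split.
  by split => //; exact: admissible_classG.
by move=> z; exact: admissible_ge0.
Qed.

Lemma admissible_conv g h t : admissible g -> admissible h -> 0 <= t <= 1 ->
  admissible (fun z => (1 - t) * g z + t * h z).
Proof.
move=> admg admh t01; have [k hk] := admg; have [l hl] := admh.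
have [mg goff gon] := admissible_at_homo (leq_maxl k l) hk.
have [mh hoff hon] := admissible_at_homo (leq_maxr k l) hl.
exists (maxn k l); split.
- by apply: measurable_funD; apply: measurable_funM => //; exact: measurable_cst.
- by move=> z nz; rewrite goff// hoff// -mulrDl subrK mul1r.
- move=> z zk; have [/andP[gz gk] bgz] := gon z zk; have [/andP[hz hk'] bhz] := hon z zk.
  have Dz : D z by case: zk => [[[[[]]]]].
  have fg := admissible_fin admg Dz; have fh := admissible_fin admh Dz.
  have [ff fle] := Gamma_convex (hbeta z) fg fh t01.
  move/andP: t01 => [t0 t1]; have t1' : 0 <= 1 - t by rewrite subr_ge0.
  have cc x : x = (1 - t) * x + t * x :> R by rewrite -mulrDl subrK mul1r.
  split.
    rewrite addr_ge0 ?mulr_ge0//= [leRHS]cc lerD// ler_wpM2l//.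
  rewrite -(fineK ff) lee_fin (le_trans fle)// [leRHS]cc.
  by apply: lerD; apply: ler_wpM2l => //; rewrite -lee_fin fineK.
Qed.

Lemma hd_conv g h t : admissible g -> admissible h -> 0 <= t <= 1 ->
  hd (fun z => (1 - t) * g z + t * h z) <= (1 - t) * hd g + t * hd h.
Proof.
move=> admg admh t01; have admc := admissible_conv admg admh t01.
have ig := integrable_admissible admg; have ih := integrable_admissible admh.
have ig' : mu.-integrable D (EFin \o (fun z => (1 - t) * fine (beta z (g z)))).
  by apply: eq_integrable (integrableZl mD (1 - t) ig) => // z _; rewrite EFinM.
have ih' : mu.-integrable D (EFin \o (fun z => t * fine (beta z (h z)))).
  by apply: eq_integrable (integrableZl mD t ih) => // z _; rewrite EFinM.
rewrite /hd -RintegralZl// -RintegralZl// -RintegralD//.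
apply: le_Rintegral => //.
- exact: integrable_admissible.
- by apply: eq_integrable (integrableD mD ig' ih') => // z _; rewrite EFinD.
- move=> z Dz; apply: (Gamma_convex (hbeta z) _ _ t01).2; exact: admissible_fin.
Qed.

Lemma moment_conv g h t : classG mu phi g -> classG mu phi h ->
  moment mu phi (fun z => (1 - t) * g z + t * h z) =
  (1 - t) *: moment mu phi g + t *: moment mu phi h.
Proof. by move=> Gg Gh; rewrite momentD ?momentZ//; exact: classGZ. Qed.

Lemma admissible_switch g k (B : set Z) (q : R) : admissible g -> measurable B ->
  0 <= q -> q <= k%:R ->
  B `<=` good_set k `&` [set z | (beta z q <= k%:R%:E)%E] ->
  admissible (fun z => if z \in B then q else g z).
Proof.
move=> [l hl] mB q0 qk BZ.
have [mg goff gon] := admissible_at_homo (leq_maxr k l) hl.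
exists (maxn k l); split.
- by apply: measurable_switch => //; exact: measurable_cst.
- move=> z nz; case: ifPn => [|_]; last exact: goff.
  rewrite inE => /BZ[zk _]; exfalso; apply: nz.
  exact: good_set_homo (leq_maxl k l) _ zk.
- move=> z zk; case: ifPn => [|_]; last exact: gon.
  rewrite inE => /BZ[_ /= bz].
  have kk : k%:R <= (maxn k l)%:R :> R by rewrite ler_nat leq_maxl.
  rewrite q0 (le_trans qk kk); split => //.
  by apply: le_trans bz _; rewrite lee_fin.
Qed.

Lemma integral_dotv_admissible theta g : admissible g ->
  mu.-integrable D (EFin \o (fun z => dotv theta (phi z) * g z)) /\
  \int[mu]_(z in D) (dotv theta (phi z) * g z) = dotv theta (moment mu phi g).
Proof.
move=> adm; have Gg := admissible_classG adm; have ti := integrable_dotv theta Gg.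
split; first exact: integrableS ti.
rewrite -[RHS]/(fine _%:E) -moment_dotv// Rintegral_mkcond; congr fine.
apply: eq_integral => z _; congr _%:E; rewrite patchE.
by case: ifPn => //; rewrite notin_setE => nDz; rewrite (admissible_off adm nDz) mulr0.
Qed.

(** Switching [g0] to [q] exactly where the product is negative gives an admissible function. The
    hypothesis on its moment then forces the integral of the negative part to be 0. *)
Lemma switch_base_moment (eta : 'rV[R]_n) k (q : rat) :
  (forall g, admissible g -> 0 <= dotv eta (moment mu phi g - a)) ->
  0 < q -> ratr q <= k%:R :> R ->
  \forall z \ae mu, good_set k z -> (beta z (ratr q) <= k%:R%:E)%E ->
    0 <= dotv eta (phi z) * (ratr q - g0 z).
Proof.
move=> eta_ge0 q0 qk.
pose f z := dotv eta (phi z) * (ratr q - g0 z).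
have mf : measurable_fun [set: Z] f.
  apply: measurable_funM; first exact: measurable_dotv.
  by apply: measurable_funB => //; exact: measurable_cst.
pose B := good_set k `&` [set z | (beta z (ratr q) <= k%:R%:E)%E] `&` ~` [set z | 0 <= f z].
have mB : measurable B.
  apply: measurableI.
    apply: measurableI; first exact: measurable_good_set.
    by apply: emeasurable_le_cst; apply: mbeta; exact: measurable_cst.
  apply: measurableC.
  rewrite (_ : mkset _ = [set z | - f z <= 0]).
    by apply: measurable_le_cst; exact: measurableT_comp.
  by apply/seteqP; split => z /=; rewrite oppr_le0.
pose g z : R := if z \in B then ratr q else g0 z.
have q0' : 0 <= ratr q :> R by rewrite ler0q ltW.
have admg : admissible g.
  apply: (admissible_switch admissible_base mB q0' qk).
  by move=> z [[]].
have [gi gE] := integral_dotv_admissible eta admg.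
have [g0i' g0E] := integral_dotv_admissible eta admissible_base.
pose h z := - f z * \1_B z.
have hE z : - h z = dotv eta (phi z) * g z - dotv eta (phi z) * g0 z.
  rewrite /h /g indicE; case: ifPn => _; last by rewrite mulr0 oppr0 subrr.
  by rewrite mulr1 opprK /f mulrBr.
have h0 z : 0 <= h z.
  rewrite /h indicE; case: (boolP (z \in B)) => [|_]; last by rewrite mulr0.
  rewrite inE => -[_ /= /negP]; rewrite -ltNge => fz.
  by rewrite mulr1 oppr_ge0 ltW.
have ih : mu.-integrable D (EFin \o h).
  have : mu.-integrable D (EFin \o
      (fun z => dotv eta (phi z) * g0 z - dotv eta (phi z) * g z)).
    by apply: eq_integrable (integrableB mD g0i' gi) => // z _; rewrite /= EFinB.
  by apply: eq_integrable => // z _ /=; rewrite -opprB -hE opprK.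
have hI : \int[mu]_(z in D) h z = \int[mu]_(z in D) (dotv eta (phi z) * g0 z) -
    \int[mu]_(z in D) (dotv eta (phi z) * g z).
  by rewrite -RintegralB//; apply: eq_Rintegral => z _; rewrite -opprB -hE opprK.
have : \int[mu]_(z in D) h z <= 0.
  by rewrite hI gE g0E hg0.1.2; have := eta_ge0 _ admg; rewrite dotvBr; lra.
move=> hle; have hI0 : (\int[mu]_(z in D) `|(h z)%:E| = 0)%E.
  rewrite (eq_integral (EFin \o h)); last by move=> z _; rewrite /= ger0_norm.
  apply/eqP; rewrite eq_le integral_ge0 ?andbT; last by move=> z _; rewrite lee_fin.
  by rewrite -(fineK (integrable_fin_num mD ih)) lee_fin.
have mh : measurable_fun D (EFin \o h) by exact: measurable_int ih.
have := (ae_eq_integral_abs mu mD mh).1 hI0.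
apply: filterS => z hz zk bz; rewrite leNgt; apply/negP => fz.
have Dz : D z by case: zk => [[[[[]]]]].
have zB : B z by split => //=; apply/negP; rewrite -ltNge.
have := congr1 fine (hz Dz); rewrite /= /h indicE mem_set// mulr1 => /eqP.
by rewrite oppr_eq0 lt_eqF.
Qed.

(* Perturbing g0 in all admissible ways forces the functional to be nonnegative
   on the face and to vanish at its relative interior point a. *)
Lemma face_orthogonal (eta : 'rV[R]_n) :
  (forall g, admissible g -> 0 <= dotv eta (moment mu phi g - a)) ->
  forall g, admissible g -> dotv eta (moment mu phi g - a) = 0.
Proof.
move=> eta_ge0.
pose P m z := if @unpickle (rat * nat)%type m is Some (q, k) then
  0 < q -> ratr q <= k%:R :> R -> good_set k z -> (beta z (ratr q) <= k%:R%:E)%E ->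
  0 <= dotv eta (phi z) * (ratr q - g0 z) else True.
have /ae_foralln hP : forall m, \forall z \ae mu, P m z.
  move=> m; rewrite /P; case: unpickle => [[q k]|]; last exact: nearW.
  have [q0|_] := boolP (0 < q); last by apply: nearW => z h.
  have [qk|_] := boolP (ratr q <= k%:R :> R); last by apply: nearW => z _ h.
  by apply: filterS (switch_base_moment eta_ge0 q0 qk) => z h _ _; exact: h.
(* A rational above [g0 z] gives [dotv eta (phi z) >= 0]; where [g0 z > 0], a rational between 0 and
   [g0 z] gives the opposite inequality. *)
have pos : \forall z \ae mu, D z ->
    0 <= dotv eta (phi z) /\ dotv eta (phi z) * g0 z = 0.
  apply: filterS hP => z Pz Dz.
  have Pq (q : rat) : 0 < q -> 0 <= dotv eta (phi z) * (ratr q - g0 z).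
    move=> q0; have [k hk] := good_set_cover Dz.
    have q0' : 0 < ratr q :> R by rewrite ltr0q.
    have bf : beta z (ratr q) \is a fin_num by exact: Gamma_fin.
    pose M : R := `|ratr q| + `|fine (beta z (ratr q))|.
    pose l := maxn k (Num.trunc M).+1.
    have Ml : M <= l%:R.
      by rewrite (le_trans (ltW (truncnS_gt M)))// ler_nat leq_maxr.
    have := Pz (pickle (q, l)); rewrite /P pickleK; apply => //.
    - by apply: le_trans Ml; rewrite /M (le_trans (ler_norm _))// lerDl.
    - by apply: hk; exact: leq_maxl.
    - by rewrite -(fineK bf) lee_fin (le_trans _ Ml)// (le_trans (ler_norm _))// lerDr.
  have g0z := hg0.2 z.
  have d0 : 0 <= dotv eta (phi z).
    have gg : g0 z < g0 z + 1 by rewrite ltrDl.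
    have [q] := rat_in_itvoo gg.
    rewrite in_itv/= => /andP[gq _].
    have q0 : 0 < q by rewrite -(ltr0q R); exact: le_lt_trans gq.
    by have := Pq q q0; rewrite pmulr_lge0// subr_gt0.
  split => //; have [gz|gz|->] := ltgtP (g0 z) 0;
    [by rewrite ltNge g0z in gz| |by rewrite mulr0].
  have [q] := rat_in_itvoo gz; rewrite in_itv/= => /andP[q0 gq].
  have q0' : 0 < q by rewrite -(ltr0q R).
  have := Pq q q0'; rewrite nmulr_lge0 ?subr_lt0// => d0'.
  by rewrite (_ : dotv _ _ = 0) ?mul0r//; apply/eqP; rewrite eq_le d0 d0'.
have mdg0 := measurable_int mu (integral_dotv_admissible eta admissible_base).1.
have eta_a : dotv eta a = 0.
  apply: EFin_inj; rewrite -(integral_dotv_face mu_sigma_finite mphi J_fin eta hg0).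
  transitivity (\int[mu]_(z in D) cst 0%E z)%E; last by rewrite integral0.
  apply: ae_eq_integral => //.
  by apply: filterS pos => z hz /hz[_ ->].
have eta_ge0_face x : F x -> 0 <= dotv eta x.
  move=> Fx; have [[h hG hx] _] := Fx; rewrite -hx in Fx *.
  have supp := min_face_support mphi mu_sigma_finite (cn_point J_fin) hG Fx.
  have mdh := measurable_int mu (integrable_dotv eta hG.1).
  rewrite -lee_fin -moment_dotv; last exact: hG.1.
  rewrite (@ae_eq_integral _ _ _ mu _ (fun z => `|(dotv eta (phi z) * h z)%:E|)%E)//.
  - by apply: integral_ge0.
  - exact: measurableT_comp.
  - near=> z => _; rewrite gee0_abs// lee_fin.
    have [Dz|nDz] := pselect (D z).
      rewrite mulr_ge0//; last exact: hG.2.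
      suff [] : 0 <= dotv eta (phi z) /\ dotv eta (phi z) * g0 z = 0 by [].
      by move: Dz; near: z.
    by rewrite (_ : h z = 0) ?mulr0//; move: nDz; near: z.
(* Together with [x] the face contains some [a - e *: x], where [eta] takes the value
   [- e * dotv eta x]. *)
have eta_face0 x : F x -> dotv eta x = 0.
  move=> Fx; apply/eqP; rewrite eq_le eta_ge0_face// andbT.
  have [Cx [e e0 Ce]] := Fx.
  have : F (a - e *: x).
    split => //; exists 1 => //; rewrite scale1r subKr.
    by apply: (cn_cone mu phi).2 => //; exact: ltW.
  move=> /eta_ge0_face; rewrite dotvBr eta_a dotvZr sub0r oppr_ge0.
  by rewrite pmulr_rle0.
move=> g adm; rewrite dotvBr eta_a subr0.
have [_ <-] := integral_dotv_admissible eta adm.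
rewrite (_ : 0 = \int[mu]_(z in D) (0 : R)); last by rewrite Rintegral_cst// mul0r.
apply: eq_Rintegral => z; rewrite inE => Dz.
by rewrite (dotv_closure0 eta_face0 Dz) mul0r.
Unshelve. all: end_near.
Qed.

(** The cone contains [(0, 1)] but not its opposite, since no admissible function with moment [a]
    has a value below [JD]. The slack [s] absorbs the convexity defect when two points of the cone
    are added. *)
Lemma exists_multiplier : exists theta, forall g, admissible g ->
  JD - dotv theta a <= hd g - dotv theta (moment mu phi g).
Proof.
pose V : vectType R := ('rV[R]_n * R^o)%type.
pose S : set V := [set p | exists g lam s, [/\ admissible g, 0 <= lam, 0 <= s &
  p = (lam *: (moment mu phi g - a), lam * (hd g - JD + s))]].
have cS : is_cone S.
  split.
    move=> _ _ [g [l1 [s1 [admg l10 s10 ->]]]] [h [l2 [s2 [admh l20 s20 ->]]]].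
    have [L0|L0] := eqVneq (l1 + l2) 0.
      have l1E : l1 = 0 by lra.
      have l2E : l2 = 0 by lra.
      exists g, 0, 0; split => //.
      by rewrite l1E l2E !scale0r !mul0r; congr pair; rewrite addr0.
    have Lp : 0 < l1 + l2 by rewrite lt0r L0 addr_ge0.
    pose t := l2 / (l1 + l2).
    have t01 : 0 <= t <= 1.
      by rewrite /t divr_ge0 ?addr_ge0//= ler_pdivrMr// mul1r lerDr.
    have tE : (l1 + l2) * t = l2 by rewrite mulrC divfK.
    have tE' : (l1 + l2) * (1 - t) = l1 by rewrite mulrBr mulr1 tE addrK.
    have cvx := hd_conv admg admh t01.
    exists (fun z => (1 - t) * g z + t * h z), (l1 + l2).
    exists ((1 - t) * hd g + t * hd h - hd (fun z => (1 - t) * g z + t * h z)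
      + ((1 - t) * s1 + t * s2)).
    move/andP: (t01) => [t0 t1].
    split; [exact: admissible_conv|exact: ltW| |].
      by rewrite addr_ge0 ?subr_ge0// addr_ge0// mulr_ge0// subr_ge0.
    congr pair.
      rewrite moment_conv; [|exact: admissible_classG|exact: admissible_classG].
      have -> : (1 - t) *: moment mu phi g + t *: moment mu phi h - a =
          (1 - t) *: (moment mu phi g - a) + t *: (moment mu phi h - a).
        by rewrite !scalerBr addrACA -opprD -scalerDl subrK scale1r.
      by rewrite [RHS]scalerDr !scalerA tE' tE.
    have -> : (l1 + l2) * (hd (fun z => (1 - t) * g z + t * h z) - JD +
        ((1 - t) * hd g + t * hd h - hd (fun z => (1 - t) * g z + t * h z) +
        ((1 - t) * s1 + t * s2))) = ((l1 + l2) * (1 - t)) * (hd g - JD + s1) +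
        ((l1 + l2) * t) * (hd h - JD + s2) by ring.
    by rewrite tE tE'.
  move=> c _ c0 [g [l1 [s1 [admg l10 s10 ->]]]].
  exists g, (c * l1), s1; split => //; first exact: mulr_ge0.
  by congr pair; rewrite ?scalerA ?mulrA.
have hd0 : 0 <= hd g0 - JD.
  by rewrite subr_ge0; apply: hd_ge; [exact: admissible_base|exact: hg0.1.2].
have S1 : S ((0, 1) : V).
  exists g0, (hd g0 - JD + 1)^-1, 1; split => //; first exact: admissible_base.
    by rewrite invr_ge0 addr_ge0.
  rewrite hg0.1.2 subrr scaler0 mulVf// gt_eqF//; apply: ltr_wpDl => //.
have SN1 : ~ S (- ((0, 1) : V)).
  move=> [g [lam [s [admg lam0 s0 [e1 e2]]]]].
  have lamp : 0 < lam.
    rewrite lt0r lam0 andbT; apply/eqP => l0; move: e2; rewrite l0 mul0r => /eqP.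
    by rewrite oppr_eq0 oner_eq0.
  have ga : moment mu phi g = a.
    apply/eqP; rewrite -subr_eq0; have /eqP := e1; rewrite oppr0 eq_sym scaler_eq0.
    by rewrite gt_eqF.
  have := hd_ge admg ga; rewrite -subr_ge0 => h.
  have : 0 <= lam * (hd g - JD + s) by rewrite mulr_ge0// addr_ge0.
  by rewrite -e2 oppr_ge0 ler10.
have [l [lS [u Su lu]]] := cone_functional cS S1 SN1.
pose eta : 'rV[R]_n := \row_i l (delta_mx 0 i, 0).
pose c := l (0, 1).
have lE v r : l (v, r) = dotv eta v + c * r.
  have -> : (v, r) = ((v, 0) : V) + r *: ((0, 1) : V) :> V.
    by congr pair; rewrite /= ?scaler0 ?addr0// add0r /GRing.scale/= mulr1.
  rewrite linearD linearZ/= mulrC; congr (_ + _).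
  have lD x y : l (x + y, 0) = l (x, 0) + l (y, 0).
    by rewrite -linearD; congr (l _); congr pair; rewrite addr0.
  have l0 : l (0, 0) = 0 by exact: linear0.
  rewrite {1}(row_sum_delta v) (big_morph (fun x => l (x, 0)) lD l0).
  apply: eq_bigr => i _; rewrite mxE mulrC.
  have -> : (v 0 i *: delta_mx 0 i, 0) = v 0 i *: ((delta_mx 0 i, 0) : V) :> V.
    by congr pair; rewrite scaler0.
  by rewrite linearZ.
have c0 : 0 <= c by exact: lS.
have key g : admissible g -> 0 <= dotv eta (moment mu phi g - a) + c * (hd g - JD).
  move=> adm; rewrite -lE; apply: lS; exists g, 1, 0; split => //.
  by rewrite scale1r mul1r addr0.
(* If [c] were 0, [eta] would be nonnegative on all admissible moments, hence zero there by
   [face_orthogonal], and [l] would vanish on [S]. *)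
have cgt0 : 0 < c.
  rewrite lt0r c0 andbT; apply/eqP => cE; move: lu.
  have [g [lam [s [adm _ _ ->]]]] := Su.
  rewrite lE cE mul0r addr0 dotvZr (face_orthogonal _ adm) ?mulr0 ?ltxx//.
  by move=> h /key; rewrite cE mul0r addr0.
exists ((- c^-1) *: eta) => g /key.
rewrite dotvBr !dotvZl => h.
have : 0 <= c^-1 * (dotv eta (moment mu phi g) - dotv eta a + c * (hd g - JD)).
  by rewrite mulr_ge0// invr_ge0.
rewrite mulrDr mulKf ?gt_eqF//; lra.
Qed.

(* The sequence gseq tries the rational constants one after the other on good sets
   and keeps the better value, so that its values increase to the supremum defining
   the conjugate. *)
Section Interchange.
Variable theta : 'rV[R]_n.
Hypothesis multiplier : forall g, admissible g ->
  JD - dotv theta a <= hd g - dotv theta (moment mu phi g).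

(** [fine] is harmless here: the values compared are those of admissible functions on [D] and of
    positive rationals, where [beta z] is finite. *)
Let val z t := dotv theta (phi z) * t - fine (beta z t).

Let mval g : measurable_fun [set: Z] g -> measurable_fun [set: Z] (fun z => val z (g z)).
Proof.
move=> mg; apply: measurable_funB.
  by apply: measurable_funM => //; exact: measurable_dotv.
by apply: measurableT_comp => //; exact: mbeta.
Qed.

Let better g (q : rat) k : set Z := if (0 < q) && (ratr q <= k%:R :> R) then
  good_set k `&` [set z | (beta z (ratr q) <= k%:R%:E)%E] `&`
  [set z | val z (g z) < val z (ratr q)] else set0.

Let switch g (m : nat) z : R := if @unpickle (rat * nat)%type m is Some (q, k) then
  if z \in better g q k then ratr q else g z else g z.

Let gseq := fix gseq m := if m is m'.+1 then switch (gseq m') m' else g0.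

Let gseq_admissible m : admissible (gseq m).
Proof.
elim: m => [|m IH] /=; first exact: admissible_base.
rewrite /switch; case: unpickle => [[q k]|]//.
rewrite /better; case: ifPn => [/andP[q0 qk]|_]; last first.
  by under eq_fun do rewrite in_set0.
have q0' : 0 <= ratr q :> R by rewrite ler0q ltW.
apply: (admissible_switch IH _ q0' qk); last by move=> z [].
apply: measurableI.
  apply: measurableI; first exact: measurable_good_set.
  by apply: emeasurable_le_cst; apply: mbeta; exact: measurable_cst.
rewrite (_ : mkset _ = ~` [set z | val z (ratr q) - val z (gseq m z) <= 0]).
  apply/measurableC/measurable_le_cst; apply: measurable_funB; apply: mval.
    exact: measurable_cst.
  exact: admissible_measurable.
apply/seteqP; split => z /=; first by move=> h; apply/negP; rewrite -ltNge subr_gt0.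
by move/negP; rewrite -ltNge subr_gt0.
Qed.

Let val_homo z : {homo (fun m => val z (gseq m z)) : m l / (m <= l)%N >-> m <= l}.
Proof.
apply: homo_leq => // [x y w|m]; first exact: le_trans.
rewrite /= /switch; case: unpickle => [[q k]|]//.
by case: ifPn => //; rewrite inE /better; case: ifPn => // _ [_ /= /ltW].
Qed.

(** For large [l] the constant [q] is allowed at [z], so the stage coded by [(q, l)] leaves a value
    at least as good. *)
Let val_sup z (q : rat) : D z -> 0 < q -> exists m, val z (ratr q) <= val z (gseq m z).
Proof.
move=> Dz q0; have [k hk] := good_set_cover Dz.
have bf : beta z (ratr q) \is a fin_num by apply: Gamma_fin => //; rewrite ltr0q.
pose M : R := `|ratr q| + `|fine (beta z (ratr q))|.
pose l := maxn k (Num.trunc M).+1.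
have Ml : M <= l%:R.
  by rewrite (le_trans (ltW (truncnS_gt M)))// ler_nat leq_maxr.
have [m mE] : exists m, @unpickle (rat * nat)%type m = Some (q, l).
  by exists (pickle (q, l)); exact: pickleK.
exists m.+1; rewrite /= /switch mE.
case: ifPn => //; rewrite notin_setE /better q0 /= => nB; rewrite leNgt.
apply/negP => vlt; apply: nB; rewrite (_ : (_ <= _) = true).
  split => //; split; first by apply: hk; exact: leq_maxl.
  by rewrite /= -(fineK bf) lee_fin (le_trans _ Ml)// (le_trans (ler_norm _))// lerDr.
by rewrite (le_trans _ Ml)// (le_trans (ler_norm _))// lerDl.
Qed.

(** The gap at [g0] is bounded by the limit of the gains [w m] over [g0]. The multiplier inequality
    bounds the integral of each gain by [hd g0 - JD], monotone convergence passes this to the gap,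
    and [Kfun_gap] concludes. *)
Lemma Kfun_multiplier_le : (Kfun mu phi beta F theta <= (dotv theta a - JD)%:E)%E.
Proof.
pose w m z : \bar R := (val z (gseq m z) - val z (g0 z))%:E.
have w0 m z : (0 <= w m z)%E by rewrite lee_fin subr_ge0; exact: (val_homo z (leq0n m)).
have whomo z : {homo w^~ z : m l / (m <= l)%N >-> (m <= l)%E}.
  by move=> m l ml; rewrite lee_fin lerD2r; exact: val_homo.
have mw m : measurable_fun D (w m).
  apply/measurable_EFinP; apply: measurable_funTS; apply: measurable_funB; apply: mval => //.
  exact: admissible_measurable.
have wcvg z : cvgn (w^~ z) by apply/cvg_ex; eexists; exact: ereal_nondecreasing_cvgn.
have w_le z m : (w m z <= limn (w^~ z))%E.
  rewrite (cvg_lim _ (ereal_nondecreasing_cvgn (whomo z)))//.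
  by apply: ereal_sup_ubound; exists m.
have gap_le z : D z -> (gap (beta z) (dotv theta (phi z)) (g0 z) <= limn (w^~ z))%E.
  move=> Dz; rewrite /gap -(fineK (g0fin Dz)).
  have -> : (conjugate (beta z) (dotv theta (phi z)) + (fine (beta z (g0 z)))%:E -
      (dotv theta (phi z) * g0 z)%:E =
      conjugate (beta z) (dotv theta (phi z)) - (val z (g0 z))%:E)%E.
    by rewrite -addeA -EFinB -EFinN /val opprB.
  rewrite leeBlDr//; apply: conjugate_le_rat => // q q0.
  have bf : beta z (ratr q) \is a fin_num by apply: Gamma_fin => //; rewrite ltr0q.
  have [m vm] := val_sup Dz q0.
  rewrite -(fineK bf) -EFinB -/(val z (ratr q)).
  apply: (@le_trans _ _ (w m z + (val z (g0 z))%:E)%E).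
    by rewrite /w -EFinD lee_fin subrK.
  by apply: leeD.
have int_w m : (\int[mu]_(z in D) w m z <= (hd g0 - JD)%:E)%E.
  have adm := gseq_admissible m.
  have [ti tE] := integral_dotv_admissible theta adm.
  have [ti0 tE0] := integral_dotv_admissible theta admissible_base.
  have bi := integrable_admissible adm; have bi0 := integrable_admissible admissible_base.
  have vi g : mu.-integrable D (EFin \o (fun z => dotv theta (phi z) * g z)) ->
      mu.-integrable D (EFin \o (fun z => fine (beta z (g z)))) ->
      mu.-integrable D (EFin \o (fun z => val z (g z))).
    by move=> h1 h2; apply: eq_integrable (integrableB mD h1 h2).
  have i1 := vi _ ti bi; have i0 := vi _ ti0 bi0.
  have wi : mu.-integrable D (EFin \o (fun z => val z (gseq m z) - val z (g0 z))).
    by apply: eq_integrable (integrableB mD i1 i0) => // z _; rewrite /= EFinB.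
  rewrite -(fineK (integrable_fin_num mD wi)) lee_fin -/(Rintegral _ _ _).
  rewrite (RintegralB mD i1 i0) (RintegralB mD ti bi) (RintegralB mD ti0 bi0).
  rewrite tE tE0 -/(hd _) -/(hd _) hg0.1.2.
  by have := multiplier adm; lra.
have base := Kfun_gap mu_sigma_finite mphi beta_B J_fin theta hg0 g0fin g0i.
rewrite base hdE//; last exact: admissible_base.
have : (\int[mu]_(z in D) gap (beta z) (dotv theta (phi z)) (g0 z) <= (hd g0 - JD)%:E)%E.
  apply: (@le_trans _ _ (\int[mu]_(z in D) limn (w^~ z))%E).
    apply: ge0_le_integral => //.
    - by move=> z _; exact: gap_ge0.
    - by apply: measurable_funTS; exact: measurable_gap.
    - by apply: (@emeasurable_fun_cvg _ _ _ D w) => // z Dz; exact: wcvg.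
  rewrite monotone_convergence//.
  apply: lime_le; last by apply: nearW.
  apply: ereal_nondecreasing_is_cvgn => m l ml; apply: ge0_le_integral => //.
  by move=> z _; exact: whomo.
rewrite -EFinB => /(leeD2l (dotv theta a - hd g0)%:E) /le_trans; apply.
by rewrite -EFinD lee_fin; lra.
Qed.

End Interchange.
End StrongDuality.

(** * Sequences with vanishing gap *)

Section IntegralLemmas.
Context {d : measure_display} {Z : measurableType d} {R : realType}.
Variable mu : {measure set Z -> \bar R}.
Local Open Scope ereal_scope.

Lemma nneseries_cvg0 (u : nat -> \bar R) : (forall k, 0 <= u k) ->
  \sum_(0 <= k <oo) u k < +oo -> u k @[k --> \oo] --> 0.
Proof.
move=> u0 uy; have tl := nneseries_tail_cvg uy (fun k _ => u0 k).
apply: (squeeze_cvge _ (cvg_cst 0) tl); apply: nearW => k; rewrite u0/=.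
have := nneseries_lim_ge (u_ := u) (P := xpredT) (m := k) k.+1 (fun j _ _ => u0 j).
by rewrite big_nat1.
Qed.

Definition half_pow k : R := (1 / (2 ^ (k + 1))%:R)%R.

Lemma half_pow_gt0 k : (0 < half_pow k)%R.
Proof. by rewrite divr_gt0// ltr0n expn_gt0. Qed.

Lemma eseries_half_pow : \sum_(0 <= k <oo) (half_pow k)%:E = 1.
Proof.
have := @cvg_geometric_eseries_half R 1%R 0%N.
by rewrite expr0 divr1 => /cvg_lim; apply.
Qed.

Lemma half_pow_cvg0 : (half_pow k)%:E @[k --> \oo] --> 0.
Proof.
apply: nneseries_cvg0 => [k|]; first by rewrite lee_fin ltW// half_pow_gt0.
by rewrite eseries_half_pow ltry.
Qed.

(** Summable integrals make the series finite a.e., so its terms tend to 0 along the whole sequence,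
    without extraction. *)
Lemma ae_cvg0_fast (D : set Z) (f : nat -> Z -> \bar R) : measurable D ->
  (forall k, measurable_fun D (f k)) -> (forall k z, D z -> 0 <= f k z) ->
  (forall k, \int[mu]_(z in D) f k z <= (half_pow k)%:E) ->
  \forall z \ae mu, D z -> f k z @[k --> \oo] --> 0.
Proof.
move=> mD mf f0 fle.
have Sfin : \int[mu]_(z in D) \sum_(0 <= k <oo) f k z < +oo.
  rewrite integral_nneseries//; apply: (@le_lt_trans _ _ 1); last by rewrite ltry.
  rewrite -eseries_half_pow; apply: lee_nneseries => // k _ _.
  by apply: integral_ge0; exact: f0.
have S0 z : D z -> 0 <= \sum_(0 <= k <oo) f k z.
  by move=> Dz; apply: nneseries_ge0 => k _ _; exact: f0.
have Si : mu.-integrable D (fun z => \sum_(0 <= k <oo) f k z).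
  apply/integrableP; split.
    by apply: (ge0_emeasurable_sum (P := xpredT)) => // k z Dz _; exact: f0.
  rewrite (eq_integral (fun z => \sum_(0 <= k <oo) f k z))// => z; rewrite inE => Dz.
  by rewrite gee0_abs// S0.
apply: filterS (integrable_ae mD Si) => z h Dz.
by apply: nneseries_cvg0 => [k|]; [exact: f0|rewrite ltey_eq h].
Qed.

Lemma ecvg0 (u : nat -> \bar R) : (forall k, 0 <= u k) ->
  (forall e : R, (0 < e)%R -> \forall k \near \oo, u k <= e%:E) -> u k @[k --> \oo] --> 0.
Proof.
move=> u0 ule; apply/fine_cvgP; split.
  apply: filterS (ule 1%R ltr01) => k uk.
  by rewrite ge0_fin_numE// (le_lt_trans uk)// ltry.
apply/cvgrPdist_le => e e0; apply: filterS (ule e e0) => k uk /=.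
have uf : u k \is a fin_num by rewrite ge0_fin_numE// (le_lt_trans uk)// ltry.
rewrite sub0r normrN ger0_norm ?fine_ge0//.
by rewrite -lee_fin fineK.
Qed.

Lemma ecvg0_lt (u : nat -> \bar R) (e : \bar R) : u k @[k --> \oo] --> 0 ->
  0 < e -> \forall k \near \oo, u k < e.
Proof.
move=> /fine_cvgP[uf ucvg]; case: e => [e||]//; rewrite ?lte_fin => e0; last first.
  by apply: filterS uf => k; rewrite ltey_eq => ->.
have /cvgrPdist_lt/(_ _ e0) f2 := ucvg.
near=> k; have fk : u k \is a fin_num by near: k.
rewrite -(fineK fk) lte_fin (le_lt_trans (ler_norm _))//.
by rewrite -normrN -sub0r; near: k.
Unshelve. all: end_near.
Qed.

Lemma integral_eq0_null (A : set Z) : measurable A ->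
  \int[mu]_(z in A) (cst +oo z) < +oo -> mu A = 0.
Proof.
move=> mA; rewrite integral_cst//; apply: contraTeq => A0.
by rewrite gt0_mulye ?ltxx// lt0e A0/=.
Qed.

(** Local convergence in measure gives information on sets of finite measure only; this glues the
    pieces of a sigma-finite cover. *)
Lemma ae_of_negligible_inter (A : set Z) (Y : nat -> set Z) (P : Z -> Prop) :
  [set: Z] = \bigcup_j Y j -> (forall j, measurable (Y j)) -> measurable A ->
  (forall j, mu (A `&` Y j) = 0) -> (forall z, ~ A z -> P z) ->
  \forall z \ae mu, P z.
Proof.
move=> YT mY mA A0 AP; have : mu.-negligible (\bigcup_j (A `&` Y j)).
  apply: negligible_bigcup => j; apply/negligibleP; [exact: measurableI|exact: A0].
rewrite -setI_bigcupr -YT setIT; apply: negligibleS => z /= nP.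
by apply: contrapT => /AP.
Qed.

Lemma measurable_limn_einf (D : set Z) (f : nat -> Z -> \bar R) :
  (forall k, measurable_fun D (f k)) ->
  measurable_fun D (fun z => limn_einf (f^~ z)).
Proof.
move=> mf; rewrite (_ : (fun z => _) = fun z => - limn_esup (fun k => - f k z)).
  apply: measurableT_comp => //; apply: measurable_fun_limn_esup => k.
  exact: measurableT_comp.
by apply/funext => z; rewrite -[LHS]oppeK -limn_esupN.
Qed.

(* By Fatou: the indicators of {|gs k - g| > e} tend to 1 a.e. on A while their
   integrals tend to 0. *)
Lemma measure_limit_separated (gs : nat -> Z -> R) (g : Z -> R) (A : set Z) (e : R) :
  measurable A -> mu A < +oo -> (0 < e)%R ->
  (forall k, measurable_fun [set: Z] (gs k)) -> measurable_fun [set: Z] g ->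
  cvg_locally_in_measure mu gs g ->
  (\forall z \ae mu, A z -> \forall k \near \oo, (e < `|gs k z - g z|)%R) ->
  mu A = 0.
Proof.
move=> mA Afin e0 mgs mg gsg sep.
pose B k := [set z | (e < `|gs k z - g z|)%R].
have mB k : measurable (B k).
  rewrite (_ : B k = ~` [set z | (`|gs k z - g z| <= e)%R]).
    apply/measurableC/measurable_le_cst; apply: measurableT_comp => //.
    exact: measurable_funB.
  by apply/seteqP; split => z /=; rewrite /B/= ltNge; [move/negP|move/negP].
have mI k : measurable_fun A (fun z => (\1_(B k) z)%:E : \bar R).
  by apply/measurable_EFinP; apply: measurable_funTS; exact: measurable_indic.
have : \int[mu]_(z in A) limn_einf (fun k => (\1_(B k) z)%:E : \bar R) <=
    limn_einf (fun k => \int[mu]_(z in A) (\1_(B k) z)%:E).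
  by apply: fatou => // k z _; rewrite lee_fin.
have -> : limn_einf (fun k => \int[mu]_(z in A) (\1_(B k) z)%:E) = 0.
  apply: (cvg_limn_einf_sup _).1.
  under eq_fun do rewrite integral_indic// setIC.
  exact: gsg.
have -> : \int[mu]_(z in A) limn_einf (fun k => (\1_(B k) z)%:E : \bar R) = mu A.
  rewrite -[RHS]mul1e -integral_cst//; apply: ae_eq_integral => //.
    exact: measurable_limn_einf.
  apply: filterS sep => z hz Az; apply: (cvg_limn_einf_sup _).1.
  apply: cvg_near_cst; apply: filterS (hz Az) => k hk.
  by rewrite indicE mem_set.
by move=> ?; apply/eqP; rewrite eq_le measure_ge0 andbT.
Qed.

End IntegralLemmas.

Section GapSequences.
Context {R : realType}.
Variables (gam : R -> \bar R) (r : R) (t : nat -> R).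
Hypotheses (hg : Gamma gam) (gap0 : gap gam r (t k) @[k --> \oo] --> 0%E).

Lemma gap_cvg0_divergent (M : R) : conjugate gam r \is a fin_num ->
  ~ finite_near (conjugate gam) r -> \forall k \near \oo, M < t k.
Proof.
move=> cf nf; have [eta eta0 h] := gap_margin_not_near hg M cf nf.
have : (0 < eta%:E)%E by rewrite lte_fin.
move=> /(ecvg0_lt gap0); apply: filterS => k hk; rewrite ltNge; apply/negP => /h.
by rewrite leNgt hk.
Qed.

Lemma gap_cvg0_cvg (t0 : R) : gap gam r t0 = 0%E -> t k @[k --> \oo] --> t0.
Proof.
move=> z0; have [cf _] := gap0_fin hg z0.
have hG := gap_Gamma hg cf; have g0 := gap_ge0 hg r.
apply/cvgrPdist_lt => e e0; have m0 := gap_margin_gt0 hG g0 z0 e0.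
apply: filterS (ecvg0_lt gap0 m0) => k hk; rewrite ltNge; apply/negP; rewrite distrC => ek.
by have := gap_margin_le hG g0 z0 e0 ek; rewrite leNgt hk.
Qed.

End GapSequences.

(** * Primal and dual solutions *)

Section Solutions.
Context {d : measure_display} {Z : measurableType d} {R : realType} {n : nat}.
Variables (mu : {measure set Z -> \bar R}) (phi : Z -> 'rV[R]_n)
  (beta : Z -> R -> \bar R) (a : 'rV[R]_n).
Hypotheses (mu_sigma_finite : sigma_finite [set: Z] mu)
  (mphi : forall i, measurable_fun [set: Z] (fun z => phi z ord0 i))
  (beta_B : classB beta) (J_fin : Jfun mu phi beta a \is a fin_num).
Implicit Types (g h : Z -> R) (theta : 'rV[R]_n).
Local Open Scope ereal_scope.

Local Notation F := (min_face (cn mu phi) a).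
Local Notation D := [set z | closure F (phi z)].
Local Notation HD g := (pintegral mu D (fun z => beta z (g z))).
Local Notation JD := (JD mu phi beta a).
Local Notation gap_at theta z := (gap (beta z) (dotv theta (phi z))).
Local Notation near_finite theta z :=
  (finite_near (conjugate (beta z)) (dotv theta (phi z))).

Let hbeta z : Gamma (beta z).
Proof. exact: beta_B.2. Qed.

Let mD : measurable D.
Proof. exact: measurable_face_domain. Qed.

Let support := classGp_at_support mu_sigma_finite mphi J_fin.

Lemma strong_duality : exists theta, dual_objective mu phi beta F a theta = JD%:E.
Proof.
have [g0 [hg0 g0D g0fin g0i]] := exists_base_point mu_sigma_finite mphi beta_B J_fin.
have /sigma_finiteP[Y [YT Yhomo Yfin]] := mu_sigma_finite.
have mY k := (Yfin k).1; have fY k := (Yfin k).2.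
have [theta htheta] := exists_multiplier mu_sigma_finite mphi beta_B J_fin
  hg0 g0D g0fin g0i YT Yhomo mY fY.
have := Kfun_multiplier_le mu_sigma_finite mphi beta_B J_fin
  hg0 g0D g0fin g0i YT Yhomo mY fY htheta.
exists theta; apply/eqP; rewrite eq_le weak_duality//=.
rewrite /dual_objective; have := Kfun_gtNy mu_sigma_finite mphi beta_B J_fin theta.
move: H; case: Kfun => [k||]//; rewrite lee_fin => kle _.
by rewrite -EFinB lee_fin; lra.
Qed.

Lemma dual_valueE : dual_value mu phi beta F a = JD%:E.
Proof.
apply/eqP; rewrite eq_le; apply/andP; split.
  by apply: ge_ereal_sup => _ [theta _ <-]; exact: weak_duality.
by have [theta <-] := strong_duality; apply: ereal_sup_ubound; exists theta.
Qed.

Lemma exists_dual_solution : exists theta, dual_solution mu phi beta F a theta.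
Proof.
by have [theta h] := strong_duality; exists theta; split; rewrite dual_valueE.
Qed.

Lemma dual_solution_Kfun theta : dual_solution mu phi beta F a theta ->
  Kfun mu phi beta F theta = (dotv theta a - JD)%:E.
Proof.
move=> [_]; rewrite dual_valueE /dual_objective.
case: Kfun => [k||]//= /eqP; rewrite -EFinB eqe => /eqP <-.
by rewrite opprB addrC subrK.
Qed.

Lemma dual_solution_conjugate_fin theta : dual_solution mu phi beta F a theta ->
  \forall z \ae mu, D z -> conjugate (beta z) (dotv theta (phi z)) \is a fin_num.
Proof.
move=> hth; apply: (integrable_ae mD); apply: pintegral_fin_integrable => //.
  apply: measurable_funTS; apply: measurable_conjugate => //; exact: measurable_dotv.
by rewrite -/(Kfun mu phi beta F theta) (dual_solution_Kfun hth).
Qed.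

Lemma Hfun_gap theta g : dual_solution mu phi beta F a theta ->
  classGp_at mu phi a g ->
  Hfun mu beta g = Jfun mu phi beta a + \int[mu]_(z in D) gap_at theta z (g z).
Proof.
move=> hth hg; have KE := dual_solution_Kfun hth.
rewrite (Hfun_split mu_sigma_finite mphi beta_B J_fin hg).
rewrite (HD_gap mu_sigma_finite mphi beta_B J_fin (theta := theta) hg) ?KE//.
by rewrite -EFinB subKr addeA -JfunE.
Qed.

(** At this rate the gaps have summable integrals and tend to 0 a.e.; for a general minimizing
    sequence only their integrals tend to 0. *)
Lemma exists_fast_sequence : exists gs : nat -> Z -> R,
  minimizing_sequence mu phi beta a gs /\
  forall k, Hfun mu beta (gs k) <= Jfun mu phi beta a + (half_pow k : R)%:E.
Proof.
have /choice[gs hgs] : forall k : nat, exists g, classGp_at mu phi a g /\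
    Hfun mu beta g <= Jfun mu phi beta a + (half_pow k : R)%:E.
  move=> k; have [_ [g hg <-] h] := lb_ereal_inf_adherent (half_pow_gt0 k) J_fin.
  by exists g; split => //; exact: ltW.
exists gs; split => [|k]; last exact: (hgs k).2.
split => [k|]; first exact: (hgs k).1.
have cv : Jfun mu phi beta a + (half_pow k : R)%:E @[k --> \oo] --> Jfun mu phi beta a.
  rewrite -[X in _ --> X]adde0; apply: cvgeD; last exact: half_pow_cvg0.
    by rewrite fin_num_adde_defr.
  exact: cvg_cst.
apply: (squeeze_cvge _ (cvg_cst (Jfun mu phi beta a)) cv); apply: nearW => k.
rewrite (hgs k).2 andbT; apply: ereal_inf_lbound; exists (gs k) => //.
exact: (hgs k).1.
Qed.

Lemma fast_sequence_gap theta gs : dual_solution mu phi beta F a theta ->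
  minimizing_sequence mu phi beta a gs ->
  (forall k, Hfun mu beta (gs k) <= Jfun mu phi beta a + (half_pow k : R)%:E) ->
  \forall z \ae mu, D z -> gap_at theta z (gs k z) @[k --> \oo] --> 0.
Proof.
move=> hth [Ggs _] hgs; apply: ae_cvg0_fast => //.
- move=> k; apply: measurable_funTS; apply: measurable_gap => //.
  exact: classG_measurable (Ggs k).1.1.
- by move=> k z _; exact: gap_ge0.
- by move=> k; have := hgs k; rewrite (Hfun_gap hth (Ggs k)) leeD2lE.
Qed.

Lemma minimizing_gap theta gs : dual_solution mu phi beta F a theta ->
  minimizing_sequence mu phi beta a gs ->
  \int[mu]_(z in D) gap_at theta z (gs k z) @[k --> \oo] --> 0.
Proof.
move=> hth [Ggs cv]; have := cv.
under eq_fun do rewrite (Hfun_gap hth (Ggs _)).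
move=> cv'; have : Jfun mu phi beta a + \int[mu]_(z in D) gap_at theta z (gs k z)
    - Jfun mu phi beta a @[k --> \oo] --> Jfun mu phi beta a - Jfun mu phi beta a.
  apply: cvgeB => //; last exact: cvg_cst.
  by rewrite fin_num_adde_defl// fin_numN.
rewrite subee//; apply: cvg_trans; apply: near_eq_cvg; apply: nearW => k.
by rewrite addeAC subee// add0e.
Qed.

Lemma dual_fun_gap0 theta z : D z -> near_finite theta z ->
  gap_at theta z (dual_fun phi beta F theta z) = 0.
Proof.
move=> Dz nf; have [t gt] := finite_near_gap_zero (hbeta z) nf.
rewrite /dual_fun asboolT; last by split => //; exact: gap_zero_ederivable gt.
by rewrite (gap_zero_ederive (hbeta z) gt).
Qed.

Lemma dual_fun_off theta z : ~ (D z /\ near_finite theta z) ->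
  dual_fun phi beta F theta z = 0%R.
Proof. by move=> nD; rewrite /dual_fun asboolF// => -[Dz [nf _]]; exact: nD. Qed.

(** Encoded with the countable criterion [finite_nearP], which makes measurability immediate. *)
Definition regular_set theta := D `&` \bigcup_k
  [set z | conjugate (beta z) (dotv theta (phi z) + k.+1%:R^-1)%R < +oo].

Lemma regular_setP theta z : regular_set theta z <-> D z /\ near_finite theta z.
Proof.
split=> [[Dz [k _ hk]]|[Dz /(finite_nearP (hbeta z))[k hk]]].
  by split => //; apply/(finite_nearP (hbeta z)); exists k.
by split => //; exists k.
Qed.

Lemma measurable_regular_set theta : measurable (regular_set theta).
Proof.
apply: measurableI => //; apply: bigcupT_measurable => k.
apply: emeasurable_lt_cst; apply: measurable_conjugate => //.
by apply: measurable_funD; [exact: measurable_dotv|exact: measurable_cst].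
Qed.

(** On the regular set it is the limit of the difference quotients with steps [1 / k.+1]; elsewhere
    it is 0. *)
Lemma measurable_dual_fun theta : measurable_fun [set: Z] (dual_fun phi beta F theta).
Proof.
pose G := regular_set theta; have mG : measurable G := measurable_regular_set theta.
pose f k z : R := (k.+1%:R * (fine (conjugate (beta z) (dotv theta (phi z) + k.+1%:R^-1))
  - fine (conjugate (beta z) (dotv theta (phi z)))))%R.
have mdot := measurable_dotv mphi theta.
have mf k : measurable_fun [set: Z] (f k).
  apply: measurable_funM; first exact: measurable_cst.
  apply: measurable_funB; apply: measurableT_comp => //; apply: measurable_conjugate => //.
  by apply: measurable_funD => //; exact: measurable_cst.
have dE : dual_fun phi beta F theta = (dual_fun phi beta F theta \_ G)%R.
  apply/funext => z; rewrite patchE; case: ifPn => //; rewrite notin_setE => nG.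
  by apply: dual_fun_off => /regular_setP.
rewrite dE; apply/(measurable_restrictT _ mG).
apply: (@measurable_fun_cvg _ _ _ _ f).
  by move=> k; exact: measurable_funTS.
move=> z /regular_setP[Dz nf].
have g0 := dual_fun_gap0 Dz nf; have dq := conjugate_diff_quotient (hbeta z) g0.
have cv0 : (k.+1%:R^-1 : R)%R @[k --> \oo] --> (0 : R)%R^'.
  move=> P [e /= e0 he]; have : \forall k \near \oo, (k.+1%:R^-1 < e)%R.
    exact: near_infty_natSinv_lt (PosNum e0).
  apply: filterS => k ke; apply: he; last by rewrite /= invr_eq0 pnatr_eq0.
  by rewrite /= sub0r normrN ger0_norm.
have := cvg_comp _ _ cv0 dq; apply: cvg_trans; apply: near_eq_cvg; apply: nearW => k.
by rewrite /f /= invrK [(_^-1 + _)%R]addrC.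
Qed.

(* On the set where the conjugate is not finite near <theta, phi>, a fast minimizing
   sequence tends to +oo, hence so does its gap at theta0; by Fatou this set is null
   because the integrals of the gap at theta0 stay bounded. *)
Lemma dual_solution_Theta theta : Theta mu phi beta F !=set0 ->
  dual_solution mu phi beta F a theta -> Theta mu phi beta F theta.
Proof.
move=> [theta0 [K0 reg0]] hth.
have [gs [[Ggs cgs] hgs]] := exists_fast_sequence.
have KE := dual_solution_Kfun hth.
have gap0 := fast_sequence_gap hth (conj Ggs cgs) hgs.
have K0fin : Kfun mu phi beta F theta0 \is a fin_num.
  by rewrite fin_numE gt_eqF ?(Kfun_gtNy mu_sigma_finite mphi beta_B J_fin)//= lt_eqF.
have ufin := dual_solution_conjugate_fin hth.
split; first by rewrite KE ltry.
pose E := D `\` regular_set theta.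
have mE : measurable E by apply: measurableD => //; exact: measurable_regular_set.
have mgap k : measurable_fun [set: Z] (fun z => gap_at theta0 z (gs k z)).
  apply: measurable_gap => //; exact: classG_measurable (Ggs k).1.1.
have E0 : mu E = 0.
  apply: integral_eq0_null => //.
  have -> : \int[mu]_(z in E) cst +oo z =
      \int[mu]_(z in E) limn_einf (fun k => gap_at theta0 z (gs k z)).
    apply: ae_eq_integral => //.
      by apply: measurable_limn_einf => k; exact: measurable_funTS.
    near=> z => -[Dz nG].
    have nf : ~ near_finite theta z by move=> nf; apply: nG; apply/regular_setP.
    have nf0 : near_finite theta0 z by move: Dz; near: z.
    have cf : conjugate (beta z) (dotv theta (phi z)) \is a fin_num by move: Dz; near: z.
    have gz : gap_at theta z (gs k z) @[k --> \oo] --> 0 by move: Dz; near: z.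
    apply/esym; apply: (cvg_limn_einf_sup _).1.
    have [del del0 [C hC]] := gap_coercive (hbeta z) nf0.
    apply/cvgeyPge => A.
    have := gap_cvg0_divergent (hbeta z) gz ((A + C) / del)%R cf nf.
    apply: filterS => k; rewrite ltr_pdivrMr// => hk.
    by apply: le_trans (hC _); rewrite lee_fin mulrC; lra.
  apply: le_lt_trans (fatou mu mE _ _) _.
  - by move=> k; exact: measurable_funTS.
  - by move=> k z _; exact: gap_ge0.
  (* By [HD_gap] at [theta0], the integral of the gap is [HD (gs k)] minus the dual objective; the 1
     bounds [half_pow k]. *)
  - pose c : R := (JD + 1 - (dotv theta0 a - fine (Kfun mu phi beta F theta0)))%R.
    apply: (@le_lt_trans _ _ c%:E); last by rewrite ltry.
    rewrite limn_einf_lim; apply: lime_le; first exact: is_cvg_einfs.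
    apply: nearW => k; apply: (@le_trans _ _ (\int[mu]_(z in E) gap_at theta0 z (gs k z))).
      by apply: ereal_inf_lbound; exists k => /=.
    apply: (@le_trans _ _ (\int[mu]_(z in D) gap_at theta0 z (gs k z))).
      apply: ge0_subset_integral => //.
      - exact: measurable_funTS.
      - by move=> z _; exact: gap_ge0.
      - by move=> z [].
    have HDk : HD (gs k) <= (JD + 1)%:E.
      have := hgs k.
      rewrite (Hfun_split mu_sigma_finite mphi beta_B J_fin (Ggs k)).
      rewrite JfunE// -addeA leeD2lE ?omega_fin// => /le_trans; apply.
      rewrite -EFinD lee_fin lerD2l /half_pow ler_pdivrMr ?ltr0n ?expn_gt0//.
      by rewrite mul1r ler1n expn_gt0.
    move: HDk; rewrite (HD_gap mu_sigma_finite mphi beta_B J_fin (Ggs k) K0fin).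
    by rewrite -(fineK K0fin) -EFinB addeC -leeBrDr// -EFinB.
have NE : mu.-negligible E by apply/negligibleP.
apply: (negligibleS _ NE) => z /= h; apply: contrapT => nE; apply: h => Dz.
apply: contrapT => nf; apply: nE; split => //.
by move=> /regular_setP[].
Unshelve. all: end_near.
Qed.

(** * Limits of minimizing sequences *)

Lemma classGp_at_off theta g : classGp_at mu phi a g ->
  \forall z \ae mu, ~ D z -> g z = dual_fun phi beta F theta z.
Proof.
move=> hg; apply: filterS (support hg) => z h nD.
by rewrite h// dual_fun_off// => -[].
Qed.

(** Up to a null set, [A k], where [gs k] is farther than [eps] from the dual function, is covered
    by [B j], where the margin of the gap is below [1 / j.+1], and [C j k], where the gap is at
    least that. The former is small for large [j]; the latter is small for large [k] by Markov's
    inequality. *)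
Lemma minimizing_cvg theta gs : dual_solution mu phi beta F a theta ->
  Theta mu phi beta F theta -> minimizing_sequence mu phi beta a gs ->
  cvg_locally_in_measure mu gs (dual_fun phi beta F theta).
Proof.
move=> hth [_ reg] mgs Y mY Yfin eps eps0.
have x0 := minimizing_gap hth mgs; have Ggs := mgs.1.
set f := dual_fun phi beta F theta.
have mf : measurable_fun [set: Z] f := measurable_dual_fun theta.
pose S := regular_set theta; have mS : measurable S := measurable_regular_set theta.
have mg k : measurable_fun [set: Z] (gs k) by exact: classG_measurable (Ggs k).1.1.
have mgap g : measurable_fun [set: Z] g ->
    measurable_fun [set: Z] (fun z => gap_at theta z (g z)).
  by move=> ?; exact: measurable_gap.
pose m z := gap_margin (gap_at theta z) (f z) eps.
have mm : measurable_fun [set: Z] m.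
  apply: measurable_mine; apply: mgap; first by apply: measurable_funD.
  exact: measurable_funB.
have zeroS z : S z -> conjugate (beta z) (dotv theta (phi z)) \is a fin_num /\
    gap_at theta z (f z) = 0.
  by move=> /regular_setP[Dz nf]; split; [exact: finite_near_fin|exact: dual_fun_gap0].
pose B j := Y `&` S `&` [set z | m z < (j.+1%:R^-1)%:E].
have mB j : measurable (B j).
  by apply: measurableI; [exact: measurableI|exact: emeasurable_lt_cst].
pose C j k := D `&` [set z | (j.+1%:R^-1)%:E <= gap_at theta z (gs k z)].
have mC j k : measurable (C j k).
  apply: measurableI => //.
  rewrite (_ : mkset _ = ~` [set z | gap_at theta z (gs k z) < (j.+1%:R^-1)%:E]).
    by apply/measurableC/emeasurable_lt_cst; exact: mgap.
  by apply/seteqP; split => z /=; rewrite leNgt; move/negP.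
pose A k := Y `&` [set z | (eps < `|gs k z - f z|)%R].
have mA k : measurable (A k).
  apply: measurableI => //; rewrite (_ : mkset _ = ~` [set z | (`|gs k z - f z| <= eps)%R]).
    apply/measurableC/measurable_le_cst; apply: measurableT_comp => //.
    exact: measurable_funB.
  by apply/seteqP; split => z /=; rewrite ltNge; move/negP.
(* The margin is positive at every regular point, so the [B j] decrease to the empty set inside [Y],
   which has finite measure. *)
have B0 : (mu \o B) j @[j --> \oo] --> 0.
  have B0' : \bigcap_j B j = set0.
    rewrite -subset0 => z hz; have [[_ Sz] _] := hz 0%N I.
    have [cf g0] := zeroS z Sz.
    have m0 := gap_margin_gt0 (gap_Gamma (hbeta z) cf) (gap_ge0 (hbeta z) _) g0 eps0.
    have mfin := gap_margin_fin (gap_Gamma (hbeta z) cf) (gap_ge0 (hbeta z) _) g0 eps0.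
    have m0' : (0 < fine (m z))%R by rewrite fine_gt0// m0 -ge0_fin_numE// ltW.
    have [_ /=] := hz (Num.trunc (fine (m z))^-1) I.
    rewrite /m -(fineK mfin) lte_fin ltNge => /negP; apply.
    by rewrite -/(m z) invf_ple ?posrE// ltW// truncnS_gt.
  rewrite -(measure0 mu) -B0'; apply: nonincreasing_cvg_mu => //.
  - apply: le_lt_trans Yfin; apply: le_measure; rewrite ?inE//.
    by move=> z [[]].
  - by rewrite B0'.
  - move=> i j ij; apply/subsetPset => z [YSz /= mz]; split => //=.
    by apply: lt_le_trans mz _; rewrite lee_fin lef_pV2 ?posrE// ler_nat.
have muC j k : mu (C j k) <= j.+1%:R%:E * \int[mu]_(z in D) gap_at theta z (gs k z).
  have : (j.+1%:R^-1)%:E * mu (C j k) <= \int[mu]_(z in D) gap_at theta z (gs k z).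
    rewrite -integral_cst//.
    apply: (@le_trans _ _ (\int[mu]_(z in C j k) gap_at theta z (gs k z))).
      apply: ge0_le_integral => //; first by move=> z _; rewrite lee_fin.
        by apply: measurable_funTS; exact: mgap.
      by move=> z [].
    apply: ge0_subset_integral => //; first by apply: measurable_funTS; exact: mgap.
      by move=> z _; exact: gap_ge0.
    by move=> z [].
  rewrite -(@lee_pmul2l _ j.+1%:R%:E)// ?lte_fin//.
  by rewrite muleA -EFinM mulfV ?pnatr_eq0// mul1e.
have muA j k : mu (A k) <= mu (B j) + mu (C j k).
  (* Almost every point of [D] is regular, and off [D] both functions are a.e. 0. *)
  have null : mu (A k `\` S) = 0.
    apply/negligibleP; first exact: measurableD.
    have off := classGp_at_off theta (Ggs k).
    have : \forall z \ae mu, ~ (A k `\` S) z.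
      near=> z => -[[_ /= Az] nS]; have [Dz|nDz] := pselect (D z).
        by apply: nS; apply/regular_setP; split => //; move: Dz; near: z.
      move: Az; rewrite (_ : gs k z = f z); last by move: nDz; near: z.
      by rewrite subrr normr0 ltNge ltW.
    by apply: negligibleS => z h h'; exact: h' h.
  have -> : A k = (A k `&` S) `|` (A k `\` S) by rewrite setUIDK.
  apply: (@le_trans _ _ (mu (A k `&` S) + mu (A k `\` S))).
    by apply: measureU2; [exact: measurableI|exact: measurableD].
  rewrite null adde0; apply: le_trans (measureU2 _ (mB j) (mC j k)).
  apply: le_measure; rewrite ?inE; [exact: measurableI|exact: measurableU|].
  move=> z [[Yz /= ez] Sz]; have [cf g0] := zeroS z Sz.
  have mle := gap_margin_le (gap_Gamma (hbeta z) cf) (gap_ge0 (hbeta z) _) g0 eps0 (ltW ez).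
  have [mz|mz] := ltP (m z) (j.+1%:R^-1)%:E; first by left.
  right; split; first by move: Sz => /regular_setP[].
  exact: le_trans mle.
apply: ecvg0 => [k|e e0]; first exact: measure_ge0.
have e20 : 0 < (e / 2)%:E by rewrite lte_fin divr_gt0.
have [j _ Bj] := ecvg0_lt B0 e20.
have ej0 : 0 < (e / 2 / j.+1%:R)%:E by rewrite lte_fin !divr_gt0.
apply: filterS (ecvg0_lt x0 ej0) => k xk.
apply: le_trans (muA j k) _; rewrite [e in leRHS](splitr e) EFinD; apply: leeD.
  by apply/ltW/Bj => /=.
apply: le_trans (muC j k) _; apply: (@le_trans _ _ (j.+1%:R%:E * (e / 2 / j.+1%:R)%:E)).
  by rewrite lee_pmul2l ?lte_fin// ltW.
by rewrite -EFinM lee_fin mulrC divfK.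
Unshelve. all: end_near.
Qed.

(** The gaps tend to 0 a.e., so the sequence tends a.e. to the dual function. Where [g] differs from
    it by more than [1 / i.+1], the sequence stays separated from [g], which a limit in measure
    allows only on a null set. *)
Lemma fast_limit_ae theta gs g : dual_solution mu phi beta F a theta ->
  Theta mu phi beta F theta -> minimizing_sequence mu phi beta a gs ->
  (forall k, Hfun mu beta (gs k) <= Jfun mu phi beta a + (half_pow k : R)%:E) ->
  measurable_fun [set: Z] g -> cvg_locally_in_measure mu gs g ->
  \forall z \ae mu, g z = dual_fun phi beta F theta z.
Proof.
move=> hth [_ reg] mgs hgs mg gsg; have [Y YT Yfin] := mu_sigma_finite.
have gap0 := fast_sequence_gap hth mgs hgs; have Ggs := mgs.1.
set f := dual_fun phi beta F theta.
have mf : measurable_fun [set: Z] f := measurable_dual_fun theta.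
have mgs' k : measurable_fun [set: Z] (gs k) by exact: classG_measurable (Ggs k).1.1.
have gsf : \forall z \ae mu, gs k z @[k --> \oo] --> f z.
  have /ae_foralln off : forall k, \forall z \ae mu, ~ D z -> gs k z = f z.
    by move=> k; exact: classGp_at_off.
  near=> z; have [Dz|nDz] := pselect (D z).
    have nf : near_finite theta z by move: Dz; near: z.
    have gz : gap_at theta z (gs k z) @[k --> \oo] --> 0 by move: Dz; near: z.
    exact: (gap_cvg0_cvg (hbeta z) gz (dual_fun_gap0 Dz nf)).
  have offz : forall k, ~ D z -> gs k z = f z by near: z.
  by apply: cvg_near_cst; apply: nearW => k; exact: offz.
pose A (i : nat) := [set z | (i.+1%:R^-1 < `|f z - g z|)%R].
have mA i : measurable (A i).
  rewrite (_ : A i = ~` [set z | (`|f z - g z| <= i.+1%:R^-1)%R]).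
    apply/measurableC/measurable_le_cst; apply: measurableT_comp => //.
    exact: measurable_funB.
  by apply/seteqP; split => z /=; rewrite /A/= ltNge; move/negP.
have /ae_foralln : forall i, \forall z \ae mu, ~ A i z.
  move=> i; apply: (ae_of_negligible_inter YT (fun j => (Yfin j).1) (mA i)) => // j.
  have mYj := (Yfin j).1; have mAY := measurableI _ _ (mA i) mYj.
  apply: (measure_limit_separated (e := (i.+1%:R^-1)%R) mAY _ _ mgs' mg gsg) => //.
    by apply: le_lt_trans (Yfin j).2; apply: le_measure; rewrite ?inE.
  by apply: filterS gsf => z gz [Az _];
      apply: (cvgr_gt _ (cvg_norm (cvgB gz (cvg_cst (g z)))) _ Az).
apply: filterS => z hz; apply/eqP; rewrite eq_sym -subr_eq0 -normr_eq0 eq_le normr_ge0 andbT.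
rewrite leNgt; apply/negP => fg.
apply: (hz (Num.trunc (`|f z - g z|^-1)%R)); rewrite /A/=.
by rewrite invf_plt ?posrE// truncnS_gt.
Unshelve. all: end_near.
Qed.

(** Off the regular set a fast sequence tends to +oo a.e. on [D], hence stays at distance more than
    1 from the finite function [g]. *)
Lemma generalized_Theta g theta : generalized_primal_solution mu phi beta a g ->
  dual_solution mu phi beta F a theta -> Theta mu phi beta F theta.
Proof.
move=> [mg hg] hth; have [Y YT Yfin] := mu_sigma_finite.
have [gs [mgs hgs]] := exists_fast_sequence.
have gap0 := fast_sequence_gap hth mgs hgs; have Ggs := mgs.1.
have KE := dual_solution_Kfun hth.
have mgs' k : measurable_fun [set: Z] (gs k) by exact: classG_measurable (Ggs k).1.1.
have ufin := dual_solution_conjugate_fin hth.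
split; first by rewrite KE ltry.
pose E := D `\` regular_set theta.
have mE : measurable E by apply: measurableD => //; exact: measurable_regular_set.
apply: (ae_of_negligible_inter YT (fun j => (Yfin j).1) mE) => [j|z nE Dz]; last first.
  by apply: contrapT => nf; apply: nE; split => // /regular_setP[].
have mYj := (Yfin j).1; have mEY := measurableI _ _ mE mYj.
apply: (measure_limit_separated (e := 1%R) mEY _ _ mgs' mg (hg gs mgs)) => //.
  by apply: le_lt_trans (Yfin j).2; apply: le_measure; rewrite ?inE.
near=> z => -[[Dz nS] _].
have nf : ~ near_finite theta z by move=> nf; apply: nS; apply/regular_setP.
have cf : conjugate (beta z) (dotv theta (phi z)) \is a fin_num by move: Dz; near: z.
have gz : gap_at theta z (gs k z) @[k --> \oo] --> 0 by move: Dz; near: z.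
apply: filterS (gap_cvg0_divergent (hbeta z) gz (g z + 1)%R cf nf) => k gk.
by rewrite (lt_le_trans _ (ler_norm _))// ltrBrDl.
Unshelve. all: end_near.
Qed.

Lemma effective_of_fast_limit gs g : Theta mu phi beta F !=set0 ->
  minimizing_sequence mu phi beta a gs ->
  (forall k, Hfun mu beta (gs k) <= Jfun mu phi beta a + (half_pow k : R)%:E) ->
  measurable_fun [set: Z] g -> cvg_locally_in_measure mu gs g ->
  effective_dual_solution mu phi beta F a g.
Proof.
move=> T0 mgs hgs mg gsg; split => //; first exact: exists_dual_solution.
move=> theta hth; have hT := dual_solution_Theta T0 hth; split => //.
by apply: filterS (fast_limit_ae hth hT mgs hgs mg gsg) => z h _; exact: h.
Qed.

Lemma generalized_effective g : generalized_primal_solution mu phi beta a g ->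
  effective_dual_solution mu phi beta F a g.
Proof.
move=> hg; have [theta hth] := exists_dual_solution.
have [gs [mgs hgs]] := exists_fast_sequence.
apply: effective_of_fast_limit mgs hgs hg.1 (hg.2 _ mgs).
by exists theta; exact: generalized_Theta hg hth.
Qed.

Lemma generalized_exists : (exists g, generalized_primal_solution mu phi beta a g) <->
  Theta mu phi beta F !=set0.
Proof.
split=> [[g hg]|T0]; first by have [] := generalized_effective hg.
have [theta hth] := exists_dual_solution; have hT := dual_solution_Theta T0 hth.
exists (dual_fun phi beta F theta); split; first exact: measurable_dual_fun.
by move=> gs; exact: minimizing_cvg.
Qed.

(** * Primal solutions and vanishing gap *)

Lemma primal_effective g : primal_solution mu phi beta a g ->
  effective_dual_solution mu phi beta F a g.
Proof.
move=> [hg gmin]; have mg := classG_measurable hg.1.1.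
have HJ : Hfun mu beta g = Jfun mu phi beta a.
  apply/eqP; rewrite eq_le; apply/andP; split.
    by apply: le_ereal_inf_tmp => _ [h hh <-]; exact: gmin.
  by apply: ereal_inf_lbound; exists g.
have gap0 theta : dual_solution mu phi beta F a theta ->
    \forall z \ae mu, D z -> gap_at theta z (g z) = 0.
  move=> hth; have I0 : \int[mu]_(z in D) gap_at theta z (g z) = 0.
    have := HJ; rewrite (Hfun_gap hth hg) -(fineK J_fin).
    by case: integral => [x||]// h; have := congr1 fine h => /= {}h; congr _%:E; lra.
  have mgap : measurable_fun D (fun z => gap_at theta z (g z)).
    by apply: measurable_funTS; exact: measurable_gap.
  have : \int[mu]_(z in D) `|gap_at theta z (g z)| = 0.
    rewrite -[RHS]I0; apply: eq_integral => z _.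
    by rewrite gee0_abs// gap_ge0.
  by move/(ae_eq_integral_abs mu mD mgap).
have reg theta : dual_solution mu phi beta F a theta -> Theta mu phi beta F theta.
  move=> hth; split; first by rewrite (dual_solution_Kfun hth) ltry.
  apply: filterS (gap0 theta hth) => z h Dz.
  by apply: (gap_zero_finite_near (hbeta z) (t0 := g z)); exact: h.
have [theta0 hth0] := exists_dual_solution.
split => //; [by exists theta0; exact: reg|by exists theta0|].
move=> theta hth; split; first exact: reg.
have off := classGp_at_off theta hg; have on := gap0 theta hth.
near=> z => _; have [Dz|nDz] := pselect (D z); last by move: nDz; near: z.
have gz : gap_at theta z (g z) = 0 by move: Dz; near: z.
have nf := gap_zero_finite_near (hbeta z) gz.
have [cf _] := gap0_fin (hbeta z) gz.
exact: (Gamma_zero_uniq (gap_Gamma (hbeta z) cf) (gap_ge0 (hbeta z) _) gz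
  (dual_fun_gap0 Dz nf)).
Unshelve. all: end_near.
Qed.

(** The candidate is [dual_fun] and not [g]: feasibility asks for nonnegativity everywhere, which
    [g] has only almost everywhere. *)
Lemma effective_primal g : effective_dual_solution mu phi beta F a g ->
  classG_at mu phi a g -> exists h, primal_solution mu phi beta a h.
Proof.
move=> [_ [theta hth] mg eff] [Gg ga]; have [hT gE] := eff theta hth.
set f := dual_fun phi beta F theta.
have mf : measurable_fun [set: Z] f := measurable_dual_fun theta.
have gf : \forall z \ae mu, g z = f z by apply: filterS gE => z; exact.
(* Where [f] is a zero of the gap, [beta z] is finite at it, which excludes negative values;
   elsewhere [f] is 0. *)
have f0 z : (0 <= f z)%R.
  have [[Dz nf]|nD] := pselect (D z /\ near_finite theta z); last by rewrite /f dual_fun_off.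
  have [_ bf] := gap0_fin (hbeta z) (dual_fun_gap0 Dz nf).
  exact: Gamma_fin_ge0 bf.
have hf : classGp_at mu phi a f.
  split => //; split.
    split => // i; apply/integrableP.
    have mpf : measurable_fun [set: Z] (fun z => phi z 0 i * f z)%R by exact: measurable_funM.
    split; first exact/measurable_EFinP.
    rewrite -(ge0_ae_eq_integral (f := fun z => `|(phi z 0 i * g z)%:E|)) //.
    - by have /integrableP[] := Gg.2 i.
    - apply: measurableT_comp => //; exact: (measurable_int mu (Gg.2 i)).
    - by apply: measurableT_comp => //; exact/measurable_EFinP.
    - by apply: filterS gf => z -> _.
  rewrite -ga; apply/rowP => i; rewrite !mxE; congr fine.
  apply: ae_eq_integral => //.
  - by apply/measurable_EFinP; exact: measurable_funM.
  - exact: (measurable_int mu (Gg.2 i)).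
  - by apply: filterS gf => z -> _.
exists f; split => // h hh; apply: (@le_trans _ _ (Jfun mu phi beta a)); last first.
  by apply: ereal_inf_lbound; exists h.
rewrite (Hfun_gap hth hf).
have -> : \int[mu]_(z in D) gap_at theta z (f z) = 0.
  rewrite -[RHS](integral0 mu D); apply: ae_eq_integral => //.
    by apply: measurable_funTS; exact: measurable_gap.
  by apply: filterS hT.2 => z h' Dz; apply: dual_fun_gap0 => //; exact: h'.
by rewrite adde0.
Qed.

End Solutions.

(** * Assembly of the three statements *)

Local Open Scope ereal_scope.

Theorem theorem7p6 (d : measure_display) (Z : measurableType d) (R : realType)
    (n : nat) (mu : {measure set Z -> \bar R})
    (mu_sigma_finite : sigma_finite [set: Z] mu)
    (phi : Z -> 'rV[R]_n)
    (phi_measurable :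
      forall i, measurable_fun [set: Z] (fun z => phi z ord0 i))
    (beta : Z -> R -> \bar R) (beta_B : classB beta)
    (a : 'rV[R]_n) (J_fin : Jfun mu phi beta a \is a fin_num) :
  let Fa := face_at (cn mu phi) a in
  [/\ (exists theta, dual_objective mu phi beta Fa a theta =
                     dual_value mu phi beta Fa a) /\
      Jfun mu phi beta a = omega mu phi beta Fa + dual_value mu phi beta Fa a,

      ((exists g, primal_solution mu phi beta a g) <->
       (Theta mu phi beta Fa !=set0 /\
        exists g, effective_dual_solution mu phi beta Fa a g /\
                  classG_at mu phi a g)) /\
      (forall g, primal_solution mu phi beta a g ->
                 effective_dual_solution mu phi beta Fa a g) &

      ((exists g, generalized_primal_solution mu phi beta a g) <->
       Theta mu phi beta Fa !=set0) /\
      (forall g, generalized_primal_solution mu phi beta a g ->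
                 effective_dual_solution mu phi beta Fa a g)].
Proof.
move=> Fa; have Ca := cn_point J_fin.
(* [face_at] is defined by choice; on the cone [cn] the only face it can return is [min_face]. *)
have FaE : Fa = min_face (cn mu phi) a by apply: face_at_coneE => //; exact: cn_cone.
rewrite FaE; split.
- split; last by rewrite dual_valueE// JfunE.
  have [theta hth] := strong_duality mu_sigma_finite phi_measurable beta_B J_fin.
  by exists theta; rewrite hth dual_valueE.
- split=> [|g]; last exact: primal_effective.
  split=> [[g hg]|[_ [g [eff Gg]]]].
    have eff := primal_effective mu_sigma_finite phi_measurable beta_B J_fin hg.
    split; first by case: eff.
    by exists g; split => //; exact: hg.1.1.
  exact: (effective_primal mu_sigma_finite phi_measurable beta_B J_fin eff Gg).
- split=> [|g]; last exact: generalized_effective.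
  exact: generalized_exists.
Qed.
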